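(* Let $(M^n,g,f,\psi)$, $n\ge3$, be an electrostatic system. Let $\Sigma$ be a closed, connected, stable minimal hypersurface in $M$. Suppose $f>0$ on $\Sigma$. Then $\Sigma$ is totally geodesic.
   Context: Electrostatic system (solution of the static Einstein-Maxwell equations): $(M^n,g)$, $n\ge 3$, is a connected, oriented smooth Riemannian manifold and $f,\psi:M\to\mathbb{R}$ are smooth functions (the lapse function and the electric potential) satisfying $$f\,Ric=\nabla^2 f-\frac{2}{f}\nabla\psi\otimes\nabla\psi+\frac{2}{(n-1)f}|\nabla\psi|^2 g,\qquad \Delta f=2\left(\frac{n-2}{n-1}\right)\frac{|\nabla\psi|^2}{f},\qquad \mathrm{div}\left(\frac{\nabla\psi}{f}\right)=0,$$ where $Ric$, $\nabla^2$, $\Delta$, $\mathrm{div}$ are the Ricci tensor, Hessian, Laplacian and divergence of $g$. Stability of the minimal hypersurface $\Sigma$, with unit normal field $\nu$ and second fundamental form $A$, means $\int_\Sigma|\nabla_\Sigma\phi|^2\,d\sigma\ge\int_\Sigma(|A|^2+Ric(\nu,\nu))\phi^2\,d\sigma$ for all $\phi\in C^1(\Sigma)$. *)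

(* Defs.v *)
From HB Require Import structures.
From mathcomp Require Import all_boot all_order all_algebra.
From mathcomp Require Import all_classical all_reals all_analysis.
Set Implicit Arguments.
Unset Strict Implicit.
Unset Printing Implicit Defensive.
Import Order.TTheory GRing.Theory Num.Theory.
Import numFieldNormedType.Exports.
Local Open Scope classical_set_scope.
Local Open Scope ring_scope.

(* Points and tangent vectors of R^n are row vectors, so a linear map acts by
   right multiplication. *)

Section Calculus.
Context {R : realType}.

Definition pd n (i : 'I_n) (F : 'rV[R]_n -> R) (u : 'rV[R]_n) : R :=
  'D_(delta_mx 0 i) (F : 'rV[R]_n -> R^o) u.

Definition dif n (F : 'rV[R]_n -> R) (u : 'rV[R]_n) : 'rV[R]_n :=
  \row_i pd i F u.

(* Entry (i, j) is the i-th partial derivative of the j-th component. *)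
Definition jac m n (F : 'rV[R]_m -> 'rV[R]_n) (u : 'rV[R]_m) : 'M[R]_(m, n) :=
  \matrix_(i, j) pd i (fun v => F v 0 j) u.

Definition C1_on n (U : set 'rV[R]_n) (F : 'rV[R]_n -> R) : Prop :=
  forall u, U u ->
    {for u, continuous F} /\
    forall i : 'I_n, derivable (F : 'rV[R]_n -> R^o) u (delta_mx 0 i) /\
                     {for u, continuous (pd i F)}.

(* All iterated partial derivatives exist and are continuous. *)
Definition smooth_on n (U : set 'rV[R]_n) (F : 'rV[R]_n -> R) : Prop :=
  forall s : seq 'I_n, C1_on U (foldr (@pd n) F s).

Definition smooth_vec_on m n (U : set 'rV[R]_m) (F : 'rV[R]_m -> 'rV[R]_n) :
    Prop :=
  forall j : 'I_n, smooth_on U (fun u => F u 0 j).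

(* Integral over R^n as an iterated one-dimensional Lebesgue integral; it is
   only used for nonnegative Borel functions, for which it is the integral
   against n-dimensional Lebesgue measure by Tonelli's theorem. *)
Fixpoint lebesgue_iint (n : nat) : ('rV[R]_n -> \bar R) -> \bar R :=
  match n with
  | 0 => fun F => F 0
  | k.+1 => fun F => (\int[lebesgue_measure]_t
      lebesgue_iint (fun u : 'rV[R]_k =>
        F (row_mx (const_mx t : 'rV[R]_1) u : 'rV[R]_(1 + k))))%E
  end.

End Calculus.

(* Here [G u] is the Gram matrix of the coordinate frame at [u]. *)

Section LocalGeometry.
Context {R : realType} {n : nat} (G : 'rV[R]_n -> 'M[R]_n).
Implicit Types (u : 'rV[R]_n) (F : 'rV[R]_n -> R) (X : 'rV[R]_n -> 'rV[R]_n).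

(* [christoffel u k i j] is the k-th component of nabla_i d_j. *)
Definition christoffel u (k i j : 'I_n) : R :=
  2^-1 * \sum_l invmx (G u) k l *
    (pd i (fun v => G v j l) u + pd j (fun v => G v i l) u
     - pd l (fun v => G v i j) u).

(* [riemann u l i j k] is the l-th component of R(d_i, d_j) d_k, where
   R(X, Y) = nabla_X nabla_Y - nabla_Y nabla_X - nabla_[X, Y]. *)
Definition riemann u (l i j k : 'I_n) : R :=
  pd i (fun v => christoffel v l j k) u - pd j (fun v => christoffel v l i k) u
  + \sum_m (christoffel u l i m * christoffel u m j k
            - christoffel u l j m * christoffel u m i k).

(* Ric(Y, Z) is the trace of X |-> R(X, Y) Z. *)
Definition ricci u : 'M[R]_n := \matrix_(j, k) \sum_i riemann u i i j k.

Definition hessian F u : 'M[R]_n :=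
  \matrix_(i, j) (pd i (pd j F) u - \sum_k christoffel u k i j * pd k F u).

Definition laplacian F u : R := \tr (invmx (G u) *m hessian F u).

Definition gradient F u : 'rV[R]_n := dif F u *m invmx (G u).

Definition gradnorm2 F u : R := (dif F u *m invmx (G u) *m (dif F u)^T) 0 0.

Definition divergence X u : R :=
  \sum_i (pd i (fun v => X v 0 i) u + \sum_j christoffel u i i j * X u 0 j).

End LocalGeometry.

(* An n-dimensional smooth manifold without boundary, given by an atlas (not
   required to be maximal) indexed by the type [chart].  [param a] is the
   inverse of the coordinate map [coord a]; both are total functions, relevant
   on [dom a] and on its image only.  [chart_at] selects a chart around each
   point. *)
Record manifold (R : realType) (n : nat) (M : topologicalType) := Manifold {
  chart :> Type;
  dom : chart -> set M;
  coord : chart -> M -> 'rV[R]_n;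
  param : chart -> 'rV[R]_n -> M;
  chart_at : M -> chart;
  chart_atP : forall p, dom (chart_at p) p;
  open_dom : forall a, open (dom a);
  open_cod : forall a, open (coord a @` dom a);
  coordK : forall a p, dom a p -> param a (coord a p) = p;
  coord_continuous : forall a p, dom a p -> {for p, continuous (coord a)};
  param_continuous : forall a u, (coord a @` dom a) u ->
    {for u, continuous (param a)};
  transition_smooth : forall a b,
    smooth_vec_on (coord a @` (dom a `&` dom b)) (coord b \o param a);
  manifold_hausdorff : hausdorff_space M;
  manifold_second_countable : @second_countable M
}.
Arguments chart_at {R n M} X p : rename.

Section Manifold.
Context {R : realType} {n : nat} {M : topologicalType} (X : manifold R n M).

Definition cod (a : X) : set 'rV[R]_n := coord a @` dom a.

Definition transition (a b : X) : 'rV[R]_n -> 'rV[R]_n := coord b \o param a.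

(* The atlas itself is an oriented atlas. *)
Definition oriented : Prop := forall (a b : X) p, dom a p -> dom b p ->
  0 < \det (jac (transition a b) (coord a p)).

Definition C1_fun (f : M -> R) : Prop :=
  forall a : X, C1_on (cod a) (f \o param a).

Definition smooth_fun (f : M -> R) : Prop :=
  forall a : X, smooth_on (cod a) (f \o param a).

(* [gram a u] is the matrix of the metric in the coordinate frame of [a], at
   the point with coordinates [u]; [gram_change] is the transformation law of
   a covariant 2-tensor. *)
Record metric := Metric {
  gram : X -> 'rV[R]_n -> 'M[R]_n;
  gram_smooth : forall a i j, smooth_on (cod a) (fun u => gram a u i j);
  gram_sym : forall a u, cod a u -> (gram a u)^T = gram a u;
  gram_posdef : forall a u (v : 'rV[R]_n), cod a u -> v != 0 ->
    0 < (v *m gram a u *m v^T) 0 0;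
  gram_change : forall a b p, dom a p -> dom b p ->
    let J := jac (transition a b) (coord a p) in
    gram a (coord a p) = J *m gram b (coord b p) *m J^T
}.

(* At zeros of [f] the equations have no meaning and nothing is required. *)
Definition electrostatic (g : metric) (f psi : M -> R) : Prop :=
  [/\ smooth_fun f, smooth_fun psi &
    forall (a : X) u, cod a u ->
      let G := gram g a in
      let F := f \o param a in
      let P := psi \o param a in
      F u != 0 ->
      [/\ F u *: ricci G u =
            hessian G F u - (2 / F u) *: ((dif P u)^T *m dif P u)
            + (2 / ((n%:R - 1) * F u) * gradnorm2 G P u) *: G u,
          laplacian G F u =
            2 * ((n%:R - 2) / (n%:R - 1)) * (gradnorm2 G P u / F u) &
          divergence G (fun v => (F v)^-1 *: gradient G P v) u = 0]].

End Manifold.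
Arguments gram {R n M X} g a u : rename.

Definition borel (S : ptopologicalType) := g_sigma_algebraType (@open S).

(* Two Borel measures with this property agree, since countably many charts
   cover S. *)
Definition is_volume (R : realType) (m : nat) (S : ptopologicalType)
    (Y : manifold R m S) (h : metric Y)
    (sigma : {measure set (borel S) -> \bar R}) : Prop :=
  forall (a : Y) (B : set (borel S)), measurable B -> B `<=` dom a ->
    sigma B = lebesgue_iint (fun u : 'rV[R]_m =>
      (\1_(coord a @` B) u * Num.sqrt (\det (gram h a u)))%:E).

Section Hypersurface.
Context {R : realType} {m n : nat} {S : ptopologicalType} {M : topologicalType}.
Context {Y : manifold R m S} {X : manifold R n M}.
Variables (h : metric Y) (g : metric X) (iota : S -> M).

Definition locmap (a : Y) (b : X) : 'rV[R]_m -> 'rV[R]_n :=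
  coord b \o iota \o param a.

Definition locdom (a : Y) (b : X) : set 'rV[R]_m :=
  coord a @` (dom a `&` iota @^-1` dom b).

(* The metric [h] is the one induced by [iota]; as it is positive definite,
   [iota] is automatically an immersion. *)
Definition isometric_immersion : Prop :=
  [/\ continuous iota,
      forall (a : Y) (b : X), smooth_vec_on (locdom a b) (locmap a b) &
      forall (a : Y) (b : X) p, dom a p -> dom b (iota p) ->
        let J := jac (locmap a b) (coord a p) in
        gram h a (coord a p) = J *m gram g b (coord b (iota p)) *m J^T].

(* A vector field along [iota] is given by its components [nu b p] in each
   chart [b] around [iota p]. *)
Definition unit_normal (nu : X -> S -> 'rV[R]_n) : Prop :=
  [/\ forall (a : Y) (b : X), smooth_vec_on (locdom a b) (nu b \o param a),
      forall (b c : X) p, dom b (iota p) -> dom c (iota p) ->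
        nu c p = nu b p *m jac (transition b c) (coord b (iota p)),
      forall (a : Y) (b : X) p, dom a p -> dom b (iota p) ->
        jac (locmap a b) (coord a p) *m gram g b (coord b (iota p))
          *m (nu b p)^T = 0 &
      forall (b : X) p, dom b (iota p) ->
        nu b p *m gram g b (coord b (iota p)) *m (nu b p)^T = 1%:M].

Variable nu : X -> S -> 'rV[R]_n.

(* Entry (i, j) is <nabla_(d_i iota) (d_j iota), nu>. *)
Definition second_form (a : Y) (b : X) (p : S) : 'M[R]_m :=
  let u := coord a p in
  let x := coord b (iota p) in
  let F k := fun v => locmap a b v 0 k in
  \matrix_(i, j)
    ((\row_k (pd i (pd j (F k)) u
              + \sum_r \sum_s
                  christoffel (gram g b) x k r s * pd i (F r) u * pd j (F s) u))
     *m gram g b x *m (nu b p)^T) 0 0.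

Definition minimal : Prop :=
  forall (a : Y) (b : X) p, dom a p -> dom b (iota p) ->
    \tr (invmx (gram h a (coord a p)) *m second_form a b p) = 0.

Definition totally_geodesic : Prop :=
  forall (a : Y) (b : X) p, dom a p -> dom b (iota p) -> second_form a b p = 0.

(* By tensoriality, the value of this scalar and of the next two does not
   depend on the charts used. *)

Definition second_form_norm2 (p : S) : R :=
  let a := chart_at Y p in
  let A := second_form a (chart_at X (iota p)) p in
  let H := invmx (gram h a (coord a p)) in
  \tr (H *m A *m H *m A^T).

Definition ricci_normal (p : S) : R :=
  let b := chart_at X (iota p) in
  (nu b p *m ricci (gram g b) (coord b (iota p)) *m (nu b p)^T) 0 0.

Definition gradnorm2_at (phi : S -> R) (p : S) : R :=
  let a := chart_at Y p in
  gradnorm2 (gram h a) (phi \o param a) (coord a p).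

Definition stable (sigma : {measure set (borel S) -> \bar R}) : Prop :=
  forall phi : S -> R, C1_fun Y phi ->
    (\int[sigma]_p ((second_form_norm2 p + ricci_normal p) * phi p ^+ 2)%:E
     <= \int[sigma]_p (gradnorm2_at phi p)%:E)%E.

End Hypersurface.

(* Main.v *)
Require Import Defs.
From HB Require Import structures.
From mathcomp Require Import all_boot all_order all_algebra.
From mathcomp Require Import all_classical all_reals all_analysis.
From mathcomp Require Import measurable_realfun perm ring lra.
Import Defs.
Import Order.TTheory GRing.Theory Num.Theory.
Import numFieldNormedType.Exports.
Local Open Scope classical_set_scope.
Local Open Scope ring_scope.
Set Implicit Arguments.
Unset Strict Implicit.
Unset Printing Implicit Defensive.

(* Write phi and Psi for the restrictions of f and psi to the hypersurface.
   Since it is minimal, the trace of the Hessian of f over tangent directions is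
   the intrinsic Laplacian of phi, so the normal component of the first field
   equation and the second one combine into
     (|A|^2 + Ric(nu, nu)) phi^2 = |A|^2 phi^2 + 2 |grad Psi|^2 - phi Lap(phi).
   The stability inequality tested on phi itself, together with Green's formula
   [int |grad phi|^2 = - int phi Lap(phi)], gives
   [int |A|^2 phi^2 + 2 |grad Psi|^2 <= 0], whence A = 0 as phi > 0.
   Green's formula is reduced by a partition of unity to functions supported in
   a cube of a chart.  There the integrand times the volume density is the
   divergence of a compactly supported C^1 field, its integral is a limit of
   Riemann sums, and these telescope up to an arbitrarily small error, so that
   Fubini's theorem is not needed. *)

(** * Partial derivatives *)

Section Calculus.
Context {R : realType}.
Implicit Types (t s e r : R).

(** The quantities of the statement are read in the chart picked by [chart_at], which may jump
    between nearby points; continuity of |A|^2, of Laplacians and of gradient products is therefore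
    available only once they are shown not to depend on the chart. All transformation laws have one
    source. For a map T with H = J G J^T, J its Jacobian matrix, the Koszul formula shows that the
    covariant second derivative of T minus the connection of H is orthogonal to the image of J. This
    difference is zero for a change of chart and a multiple of the normal for a hypersurface. In the
    stability integrand the dimension disappears because (n - 2)/(n - 1) + 1/(n - 1) = 1, and the
    squared normal derivative of psi turns the full gradient into the tangential one. The volume
    measure is given only by iterated integrals in charts. Bounds are drawn from small cells, where
    the density is nearly constant. That |A|^2 phi^2 vanishes at every point, not just almost
    everywhere, follows from continuity and the positive volume of open sets. *)

Lemma rV_norm_leP n (v : 'rV[R]_n) (r : R) : 0 <= r ->
  (forall i, `|v 0 i| <= r) <-> `|v| <= r.
Proof.
have -> : `|v| = \big[Num.max/0]_ij `|v ij.1 ij.2| by exact: mx_normrE.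
move=> r0; split => [vr|vr i].
  by apply: bigmax_le => // ij _; case: ij => a b /=; rewrite ord1.
by apply: le_trans vr; exact: (le_bigmax _ (fun ij => `|v ij.1 ij.2|) (0, i)).
Qed.

Lemma rV_norm_coord n (v : 'rV[R]_n) i : `|v 0 i| <= `|v|.
Proof. exact: (rV_norm_leP v (normr_ge0 v)).2. Qed.

Lemma norm_delta n (i : 'I_n) (t : R) :
  `|t *: (delta_mx 0 i : 'rV[R]_n)| <= `|t|.
Proof.
apply/rV_norm_leP => // j; rewrite !mxE eqxx /=.
by case: eqP => _; rewrite ?mulr1 ?mulr0 ?normr0.
Qed.

Lemma rV_openP n (U : set 'rV[R]_n) u : open U -> U u ->
  exists2 r : R, 0 < r & forall v, `|v - u| <= r -> U v.
Proof.
move=> oU Uu; have : nbhs u U by exact: open_nbhs_nbhs.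
move=> /nbhs_ballP[r r0 rU]; exists (r / 2); first by rewrite divr_gt0.
move=> v vu; apply: rU; rewrite -ball_normE /= distrC.
apply: le_lt_trans vu _.
by have : 0 < r by []; lra.
Qed.

Lemma rV_nbhsP n (U : set 'rV[R]_n) (u : 'rV[R]_n) : nbhs u U <->
  exists2 r : R, 0 < r & forall v, `|v - u| <= r -> U v.
Proof.
split; last first.
  move=> [r r0 rU]; apply/nbhs_ballP; exists r => // v.
  by rewrite -ball_normE /= distrC => /ltW; exact: rU.
move=> /nbhs_ballP[r r0 rU]; exists (r / 2); first by rewrite divr_gt0.
move=> v vu; apply: rU; rewrite -ball_normE /= distrC.
apply: le_lt_trans vu _.
by have : 0 < r by []; lra.
Qed.

Lemma is_derive_line n (F : 'rV[R]_n -> R) (i : 'I_n) u (t : R) :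
  derivable (F : 'rV[R]_n -> R^o) (u + t *: delta_mx 0 i) (delta_mx 0 i) ->
  is_derive t 1 (fun s : R => F (u + s *: delta_mx 0 i) : R)
    (pd i F (u + t *: delta_mx 0 i)).
Proof.
set e := delta_mx 0 i => dF.
have dE : (fun h : R => h^-1 *: ((F (u + (h *: (1 : R) + t) *: e) : R)
    - F (u + t *: e))) =
  (fun h : R => h^-1 *: ((F : _ -> R^o) (h *: e + (u + t *: e)) - F (u + t *: e))).
  apply/funext => h; congr (_ *: (F _ - _)).
  by rewrite [h%:A]mulr1 scalerDl addrC addrA addrAC -addrA addrC -!addrA.
apply: DeriveDef; first by rewrite /derivable dE.
by rewrite /pd /derive dE.
Qed.

Lemma MVT_pd01 n (F : 'rV[R]_n -> R) (i : 'I_n) u (s : R) : 0 <= s ->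
  (forall t, 0 <= t <= s ->
    derivable (F : 'rV[R]_n -> R^o) (u + t *: delta_mx 0 i) (delta_mx 0 i)) ->
  exists2 t, 0 <= t <= s & F (u + s *: delta_mx 0 i) - F u =
    s * pd i F (u + t *: delta_mx 0 i).
Proof.
move=> s0 dF; set e := delta_mx 0 i.
pose f (t : R) : R := F (u + t *: e).
have fd (t : R) : 0 <= t <= s -> is_derive t 1 f (pd i F (u + t *: e)).
  by move=> ts; apply: is_derive_line; exact: dF.
have fc : {within `[0, s], continuous f}.
  apply: derivable_within_continuous => t; rewrite in_itv /= => /fd.
  by move=> /@ex_derive.
have [|c cs] := @MVT_segment R f (fun t => pd i F (u + t *: e)) 0 s s0 _ fc.
  by move=> t; rewrite in_itv /= => /andP[/ltW t0 /ltW ts]; apply: fd; rewrite t0.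
by rewrite /f scale0r addr0 subr0 mulrC => ->; exists c.
Qed.

Lemma MVT_pd n (F : 'rV[R]_n -> R) (i : 'I_n) u (s : R) :
  (forall t, `|t| <= `|s| ->
    derivable (F : 'rV[R]_n -> R^o) (u + t *: delta_mx 0 i) (delta_mx 0 i)) ->
  exists2 t, `|t| <= `|s| & F (u + s *: delta_mx 0 i) - F u =
    s * pd i F (u + t *: delta_mx 0 i).
Proof.
move=> dF; have [s0|s0] := leP 0 s.
  have [|t /andP[t0 ts] E] := @MVT_pd01 n F i u s s0.
    by move=> t /andP[t0 ts]; apply: dF; rewrite !ger0_norm.
  by exists t => //; rewrite !ger0_norm.
have sN : 0 <= - s by rewrite oppr_ge0 ltW.
have small (t : R) : 0 <= t <= - s -> `|s + t| <= `|s|.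
  move=> /andP[t0 ts]; rewrite (ltr0_norm s0) ler0_norm; lra.
have [|t ts] := @MVT_pd01 n F i (u + s *: delta_mx 0 i) (- s) sN.
  by move=> t ts; rewrite -addrA -scalerDl; apply: dF; exact: small.
rewrite -!addrA -!scalerDl subrr scale0r addr0 => E.
exists (s + t); first exact: small.
by rewrite -opprB E mulNr opprK.
Qed.

Lemma C1_onW n (U V : set 'rV[R]_n) (F : 'rV[R]_n -> R) :
  U `<=` V -> C1_on V F -> C1_on U F.
Proof. by move=> UV VF u /UV /VF. Qed.

(** Truncations form a staircase from 0 to [v] whose successive points differ along one axis only,
    so that the one-variable mean value theorem applies to each step. *)
Definition trunc n (v : 'rV[R]_n) (k : nat) : 'rV[R]_n :=
  \row_i (if (i < k)%N then v 0 i else 0).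

Lemma truncS n (v : 'rV[R]_n) (k : 'I_n) :
  trunc v k.+1 = trunc v k + v 0 k *: delta_mx 0 k.
Proof.
apply/rowP => j; rewrite !mxE eqxx /= ltnS leq_eqVlt (inj_eq val_inj).
have [->|jk] := eqVneq j k; first by rewrite ltnn mulr1 add0r.
by rewrite mulr0 addr0.
Qed.

Lemma trunc_norm n (v : 'rV[R]_n) (k : 'I_n) (t : R) : `|t| <= `|v 0 k| ->
  `|trunc v k + t *: delta_mx 0 k| <= `|v|.
Proof.
move=> tv; apply/rV_norm_leP => // j; rewrite !mxE eqxx /=.
have [->|jk] := eqVneq j k.
  by rewrite ltnn mulr1 add0r (le_trans tv) ?rV_norm_coord.
by case: ifP => _; rewrite mulr0 addr0 ?rV_norm_coord ?normr0.
Qed.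

(** Along the truncations of [v], each step equals [v 0 k] times a partial derivative at a point
    within |v| of u; continuity of the partials at u bounds the error. *)
Lemma C1_increment n (U : set 'rV[R]_n) (F : 'rV[R]_n -> R) u :
  open U -> C1_on U F -> U u -> forall e : R, 0 < e ->
  exists2 r : R, 0 < r & forall v, `|v| <= r ->
    `|F (u + v) - F u - \sum_i v 0 i * pd i F u| <= e * `|v|.
Proof.
move=> oU F1 Uu e e0.
have [r0 r00 r0U] := rV_openP oU Uu.
have pc (i : 'I_n) : \forall w \near u, `|pd i F u - pd i F w| <= e / (n.+1)%:R.
  have [_ /(_ i) [_ /cvgrPdist_le pc]] := F1 _ Uu.
  by have := pc _ (divr_gt0 e0 (ltr0Sn _ n)).
have [r1 r10 r1P] := (rV_nbhsP _ _).1 (filter_forall (nbhs_filter u) pc).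
exists (Num.min r0 r1); first by rewrite lt_min r00.
move=> v; rewrite le_min => /andP[vr0 vr1].
have -> : F (u + v) - F u = \sum_(k < n) (F (u + trunc v k.+1) - F (u + trunc v k)).
  rewrite -(big_mkord xpredT (fun k => F (u + trunc v k.+1) - F (u + trunc v k))).
  rewrite (telescope_sumr (fun k => F (u + trunc v k))) //.
  have -> : trunc v 0 = 0 by apply/rowP => j; rewrite !mxE.
  by rewrite addr0; congr (F (u + _) - _); apply/rowP => j; rewrite !mxE ltn_ord.
rewrite -sumrB (le_trans (ler_norm_sum _ _ _))//.
(* Dividing e by n + 1 keeps the quotient meaningful for n = 0; the surplus summand is
   nonnegative. *)
have -> : e * `|v| = e / n.+1%:R * `|v| *+ n.+1.
  by rewrite -mulr_natr mulrAC divfK ?pnatr_eq0.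
apply: (@le_trans _ _ (\sum_(k < n) (e / n.+1%:R * `|v|))); last first.
  rewrite sumr_const card_ord [leRHS]mulrS lerDr.
  exact: mulr_ge0 (divr_ge0 (ltW e0) (ler0n _ _)) (normr_ge0 _).
apply: ler_sum => k _.
have near_u (t : R) : `|t| <= `|v 0 k| ->
    `|u + trunc v k + t *: delta_mx 0 k - u| <= `|v|.
  by move=> tv; rewrite -(addrA u) (addrC u) addrK trunc_norm.
rewrite truncS addrA.
have [|t tv ->] := @MVT_pd n F k (u + trunc v k) (v 0 k).
  move=> t tv; have [|_ /(_ k)[]//] := F1 (u + trunc v k + t *: delta_mx 0 k).
  by apply: r0U; rewrite (le_trans (near_u _ tv)).
rewrite -mulrBr normrM mulrC ler_pM ?rV_norm_coord//.
by rewrite distrC; apply: r1P; rewrite (le_trans (near_u _ tv)).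
Qed.

Lemma for_continuous_sum (T : topologicalType) (I : Type) (r : seq I)
    (P : pred I) (f : I -> T -> R) x :
  (forall i, P i -> {for x, continuous (f i)}) ->
  {for x, continuous (fun y => \sum_(i <- r | P i) f i y)}.
Proof. by move=> fc; rewrite /prop_for /continuous_at; apply: cvg_big fc; exact: add_continuous. Qed.

Lemma for_continuousM (T : topologicalType) (f g : T -> R) x :
  {for x, continuous f} -> {for x, continuous g} ->
  {for x, continuous (fun y => f y * g y)}.
Proof. exact: continuousM. Qed.

Lemma for_continuousD (T : topologicalType) (f g : T -> R) x :
  {for x, continuous f} -> {for x, continuous g} ->
  {for x, continuous (fun y => f y + g y)}.
Proof. by move=> fc gc; exact: (@continuousD _ R^o). Qed.

Lemma for_continuousN (T : topologicalType) (f : T -> R) x :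
  {for x, continuous f} -> {for x, continuous (fun y => - f y)}.
Proof. by move=> fc; exact: (@continuousN _ R^o). Qed.

Lemma for_continuous_cst (T U : topologicalType) (c : U) (x : T) :
  {for x, continuous (fun=> c)}.
Proof. exact: cvg_cst. Qed.

(** [C1_increment] is a little-o expansion around the linear form [d], and uniqueness of the
    differential identifies the two. This opens the chain rule for differentials to the
    coordinatewise notion [C1_on]. *)
Lemma C1_differentiable n (U : set 'rV[R]_n) (F : 'rV[R]_n -> R) u :
  open U -> C1_on U F -> U u -> differentiable (F : 'rV[R]_n -> R^o) u.
Proof.
move=> oU F1 Uu.
pose d (v : 'rV[R]_n) : R^o := \sum_i v 0 i * pd i F u.
have lin_d : linear d.
  move=> k x y; rewrite /d scaler_sumr -big_split /=; apply: eq_bigr => i _.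
  by rewrite !mxE mulrDl -mulrA.
pose dM := GRing.isLinear.Build _ _ _ _ d lin_d.
pose dL : {linear 'rV[R]_n -> R^o} := HB.pack d dM.
have cd : continuous dL.
  move=> x; apply: for_continuous_sum => i _.
  apply: for_continuousM; last exact: for_continuous_cst.
  exact: matrix_normedtype.coord_continuous.
pose W : normedModType R := R^o.
pose G : 'rV[R]_n -> W := F.
pose dW : 'rV[R]_n -> W := dL.
have E : G \o shift u = cst (G u) + dW +o_ (0 : 'rV[R]_n) id.
  apply/eqaddoP => e e0.
  have [r r0 rP] := C1_increment oU F1 Uu e0.
  apply/rV_nbhsP; exists r => // v; rewrite subr0 => /rP.
  suff -> : (G \o shift u - (cst (G u) + dW)) v =
    F (u + v) - F u - \sum_i v 0 i * pd i F u by [].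
  rewrite -addrA -opprD [u + v]addrC.
  by [].
apply/diff_locallyP; have dE := diff_unique cd E.
split; first by rewrite dE.
by rewrite [in RHS]dE.
Qed.

Lemma C1_diffE n (U : set 'rV[R]_n) (F : 'rV[R]_n -> R) u (v : 'rV[R]_n) :
  open U -> C1_on U F -> U u ->
  ('d (F : 'rV[R]_n -> R^o) u : _ -> _) v = \sum_i v 0 i * pd i F u.
Proof.
move=> oU F1 Uu; have dF := C1_differentiable oU F1 Uu.
rewrite [v in LHS]row_sum_delta linear_sum; apply: eq_bigr => i _.
by rewrite linearZ /= -deriveE.
Qed.

Lemma for_continuous_near (T U : topologicalType) (f g : T -> U) x :
  (\near x, f x = g x) -> {for x, continuous f} -> {for x, continuous g}.
Proof.
move=> fg fc; rewrite /prop_for /continuous_at -(nbhs_singleton fg).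
by apply: cvg_trans fc; apply: near_eq_cvg; apply: filterS fg => y ->.
Qed.

Lemma is_derive_pd n (F : 'rV[R]_n -> R) i u d :
  is_derive u (delta_mx 0 i) (F : _ -> R^o) d -> pd i F u = d.
Proof. by case. Qed.

Lemma pd_near n (F G : 'rV[R]_n -> R) i u :
  (\near u, F u = G u) -> pd i F u = pd i G u.
Proof. by move=> FG; exact: (@near_eq_derive _ _ R^o). Qed.

Lemma pd_eq_on n (U : set 'rV[R]_n) (F G : 'rV[R]_n -> R) i u :
  open U -> U u -> {in U, F =1 G} -> pd i F u = pd i G u.
Proof.
move=> oU Uu FG; apply: pd_near.
have : nbhs u U by exact: open_nbhs_nbhs.
by apply: filterS => v Uv; apply: FG; rewrite inE.
Qed.

Lemma C1_on_eq n (U : set 'rV[R]_n) (F G : 'rV[R]_n -> R) :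
  open U -> {in U, F =1 G} -> C1_on U F -> C1_on U G.
Proof.
move=> oU FG F1 u Uu; have [Fc Fd] := F1 _ Uu.
have nU : nbhs u U by exact: open_nbhs_nbhs.
have nFG : \near u, F u = G u.
  by apply: filterS nU => v Uv; apply: FG; rewrite inE.
split; first exact: for_continuous_near Fc.
move=> i; have [dF cF] := Fd i; split.
  exact: (@near_eq_derivable _ _ R^o _ _ _ _ nFG dF).
apply: for_continuous_near cF; apply: filterS nU => v Uv.
exact: pd_eq_on Uv FG.
Qed.

(** * Calculus rules for continuously differentiable functions *)

Section C1_algebra.
Variables (n : nat) (U : set 'rV[R]_n).
Hypothesis oU : open U.
Implicit Types (F G : 'rV[R]_n -> R) (u : 'rV[R]_n).

(** As U is open, the candidates [dF] agree with the partial derivatives near each point of U, so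
    their continuity carries over. *)
Lemma C1_on_pd F (dF : 'I_n -> 'rV[R]_n -> R) :
  (forall u, U u -> {for u, continuous F}) ->
  (forall u i, U u -> is_derive u (delta_mx 0 i) (F : _ -> R^o) (dF i u)) ->
  (forall u i, U u -> {for u, continuous (dF i)}) ->
  C1_on U F.
Proof.
move=> Fc Fd dFc u Uu; split; first exact: Fc.
move=> i; split; first by have /@ex_derive := Fd u i Uu.
have nU : nbhs u U by exact: open_nbhs_nbhs.
apply: for_continuous_near (dFc _ _ Uu); apply: filterS nU => v Uv.
by rewrite (is_derive_pd (Fd v i Uv)).
Qed.

Lemma C1_on_is_derive F u i : C1_on U F -> U u ->
  is_derive u (delta_mx 0 i) (F : _ -> R^o) (pd i F u).
Proof. by move=> F1 /F1 [_ /(_ i)[? _]]; exact: DeriveDef. Qed.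

Lemma C1_on_continuous F u : C1_on U F -> U u -> {for u, continuous F}.
Proof. by move=> F1 /F1[]. Qed.

Lemma C1_on_pd_continuous F i u :
  C1_on U F -> U u -> {for u, continuous (pd i F)}.
Proof. by move=> F1 /F1[_ /(_ i)[]]. Qed.

Lemma C1_on_cst (c : R) : C1_on U (fun=> c).
Proof.
apply: (@C1_on_pd _ (fun _ _ => 0)) => [u _|u i _];
  exact: for_continuous_cst.
Qed.

Lemma pd_cst (c : R) i u : pd i (fun=> c) u = 0.
Proof. exact: derive_cst. Qed.

Lemma C1_onD F G : C1_on U F -> C1_on U G -> C1_on U (fun v => F v + G v).
Proof.
move=> F1 G1; apply: (@C1_on_pd _ (fun i v => pd i F v + pd i G v)).
- by move=> u Uu; apply: for_continuousD; exact: C1_on_continuous.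
- move=> u i Uu.
  exact: is_deriveD (C1_on_is_derive i F1 Uu) (C1_on_is_derive i G1 Uu).
- by move=> u i Uu; apply: for_continuousD; exact: C1_on_pd_continuous.
Qed.

Lemma pdD F G i u : C1_on U F -> C1_on U G -> U u ->
  pd i (fun v => F v + G v) u = pd i F u + pd i G u.
Proof.
move=> F1 G1 Uu; apply: is_derive_pd.
exact: is_deriveD (C1_on_is_derive i F1 Uu) (C1_on_is_derive i G1 Uu).
Qed.

Lemma C1_onM F G : C1_on U F -> C1_on U G -> C1_on U (fun v => F v * G v).
Proof.
move=> F1 G1; apply: (@C1_on_pd _ (fun i v => F v * pd i G v + G v * pd i F v)).
- by move=> u Uu; apply: for_continuousM; exact: C1_on_continuous.
- move=> u i Uu.
  exact: is_deriveM (C1_on_is_derive i F1 Uu) (C1_on_is_derive i G1 Uu).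
- move=> u i Uu; apply: (for_continuousD (for_continuousM _ _) (for_continuousM _ _)).
  + exact: C1_on_continuous F1 Uu.
  + exact: C1_on_pd_continuous G1 Uu.
  + exact: C1_on_continuous G1 Uu.
  + exact: C1_on_pd_continuous F1 Uu.
Qed.

Lemma pdM F G i u : C1_on U F -> C1_on U G -> U u ->
  pd i (fun v => F v * G v) u = F u * pd i G u + G u * pd i F u.
Proof.
move=> F1 G1 Uu; apply: is_derive_pd.
exact: is_deriveM (C1_on_is_derive i F1 Uu) (C1_on_is_derive i G1 Uu).
Qed.

Lemma C1_onZ (c : R) F : C1_on U F -> C1_on U (fun v => c * F v).
Proof. by move=> F1; apply: (C1_onM _ F1); exact: C1_on_cst. Qed.

Lemma pdZ (c : R) F i u : C1_on U F -> U u ->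
  pd i (fun v => c * F v) u = c * pd i F u.
Proof.
move=> F1 Uu; rewrite (pdM i (@C1_on_cst c) F1 Uu).
by rewrite [pd i (fun=> c) u]pd_cst mulr0 addr0.
Qed.

Lemma C1_onN F : C1_on U F -> C1_on U (fun v => - F v).
Proof.
move=> /(C1_onZ (-1)); apply: C1_on_eq => // u _.
by rewrite mulN1r.
Qed.

Lemma C1_on_sum (I : Type) (r : seq I) (P : pred I) (F : I -> 'rV[R]_n -> R) :
  (forall k, P k -> C1_on U (F k)) ->
  C1_on U (fun v => \sum_(k <- r | P k) F k v).
Proof.
move=> F1; elim: r => [|k r IH].
  have -> : (fun v => \sum_(k <- [::] | P k) F k v) = (fun=> 0).
    by apply/funext => v; rewrite big_nil.
  exact: C1_on_cst.
have -> : (fun v => \sum_(k <- k :: r | P k) F k v) =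
    (fun v => if P k then F k v + \sum_(k <- r | P k) F k v
              else \sum_(k <- r | P k) F k v).
  by apply/funext => v; rewrite big_cons.
case Pk : (P k); last exact: IH.
by apply: (C1_onD _ IH); exact: F1.
Qed.

Lemma pd_sum (I : Type) (r : seq I) (P : pred I) (F : I -> 'rV[R]_n -> R) i u :
  (forall k, P k -> C1_on U (F k)) -> U u ->
  pd i (fun v => \sum_(k <- r | P k) F k v) u = \sum_(k <- r | P k) pd i (F k) u.
Proof.
move=> F1 Uu; elim: r => [|k r IH].
  have -> : (fun v => \sum_(k <- [::] | P k) F k v) = (fun=> 0).
    by apply/funext => v; rewrite big_nil.
  by rewrite big_nil pd_cst.
have -> : (fun v => \sum_(k <- k :: r | P k) F k v) =
    (fun v => if P k then F k v + \sum_(k <- r | P k) F k v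
              else \sum_(k <- r | P k) F k v).
  by apply/funext => v; rewrite big_cons.
rewrite big_cons; case Pk : (P k); last exact: IH.
by rewrite (pdD i (F1 _ Pk) _ Uu) ?IH; [by []|exact: C1_on_sum].
Qed.

(** The conditions on [g] are imposed only at the values taken by F on U, which covers inversion
    away from 0 and the square root on positive numbers. *)
Lemma C1_on_comp1 (F : 'rV[R]_n -> R) (g dg : R -> R) : C1_on U F ->
  (forall u, U u -> is_derive (F u) 1 g (dg (F u))) ->
  (forall u, U u -> {for F u, continuous dg}) ->
  C1_on U (g \o F) /\
  forall u i, U u -> pd i (g \o F) u = dg (F u) * pd i F u.
Proof.
move=> F1 gd dgc.
have D u i : U u ->
    is_derive u (delta_mx 0 i) ((g \o F) : _ -> R^o) (dg (F u) * pd i F u).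
  move=> Uu; have dF := C1_differentiable oU F1 Uu.
  have /@ex_derive dg' := gd u Uu.
  have {}dg' : differentiable (g : R -> R^o) (F u) by apply/derivable1_diffP.
  have dgF : differentiable ((g : R -> R^o) \o (F : _ -> R^o)) u.
    exact: differentiable_comp.
  apply: DeriveDef; first exact: diff_derivable.
  rewrite deriveE// diff_comp// diff1E// derive1E.
  have -> : 'D_1 (g : R -> R^o) (F u) = dg (F u) by case: (gd u Uu).
  by rewrite /= /GRing.scale/= mulrC /pd deriveE.
split; last by move=> u i /(D _ i) /is_derive_pd.
apply: (C1_on_pd _ D) => [u Uu|u i Uu].
  have [Fc _] := F1 _ Uu.
  apply: continuous_comp => //.
  have /@ex_derive dg' := gd u Uu.
  by apply: differentiable_continuous; apply/derivable1_diffP.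
have [Fc /(_ i)[_ dFc]] := F1 _ Uu.
apply: for_continuousM => //.
by apply: (@continuous_comp _ _ _ F dg) => //; exact: dgc.
Qed.

Lemma C1_onV F : C1_on U F -> (forall u, U u -> F u != 0) ->
  C1_on U (fun v => (F v)^-1).
Proof.
move=> F1 F0; apply: (@C1_on_comp1 F GRing.inv (fun x => - x ^- 2) F1 _ _).1.
  move=> u Uu; apply: is_derive_eq; first exact: is_deriveV (F0 _ Uu) _.
  by rewrite [_ *: _]mulr1.
move=> u Uu; apply: for_continuousN.
apply: continuousV; first by rewrite expf_neq0// F0.
exact: exprn_continuous.
Qed.

Lemma C1_on_sqrt F : C1_on U F -> (forall u, U u -> 0 < F u) ->
  C1_on U (Num.sqrt \o F) /\
  forall u i, U u ->
    pd i (Num.sqrt \o F) u = (2 * Num.sqrt (F u))^-1 * pd i F u.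
Proof.
move=> F1 F0.
apply: (@C1_on_comp1 F Num.sqrt (fun x => (2 * Num.sqrt x)^-1) F1).
  by move=> u /F0 Fu; exact: is_derive1_sqrt.
move=> u /F0 Fu; apply: continuousV.
  by rewrite mulf_neq0// sqrtr_eq0 -ltNge.
apply: for_continuousM; first exact: for_continuous_cst.
exact: sqrt_continuous.
Qed.

End C1_algebra.

(** * The chain rule in several variables *)

Section Chain_rule.
Variables (m n : nat) (U : set 'rV[R]_m) (V : set 'rV[R]_n).
Variables (T : 'rV[R]_m -> 'rV[R]_n).
Hypotheses (oU : open U) (oV : open V) (TUV : forall u, U u -> V (T u)).
Hypothesis T1 : forall j, C1_on U (fun v => T v 0 j).

Lemma C1_vec_differentiable u : U u -> differentiable T u.
Proof.
move=> Uu.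
have -> : T = \sum_(j < n) (fun v => T v 0 j *: delta_mx 0 j).
  by apply/funext => v; rewrite fct_sumE [LHS]row_sum_delta.
apply: differentiable_sum => j; apply: differentiableZl.
exact: C1_differentiable oU (T1 j) Uu.
Qed.

Lemma is_derive_comp (F : 'rV[R]_n -> R) i u : C1_on V F -> U u ->
  is_derive u (delta_mx 0 i) ((F \o T) : _ -> R^o)
    (\sum_j pd i (fun v => T v 0 j) u * pd j F (T u)).
Proof.
move=> F1 Uu; have dT := C1_vec_differentiable Uu.
have dF := C1_differentiable oV F1 (TUV Uu).
have dFT : differentiable ((F : _ -> R^o) \o T) u by exact: differentiable_comp.
apply: DeriveDef; first exact: diff_derivable.
rewrite deriveE// diff_comp//= (C1_diffE _ oV F1 (TUV Uu)) -deriveE//.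
apply: eq_bigr => j _; congr (_ * _).
by rewrite derive_mx ?mxE//; exact: diff_derivable.
Qed.

Lemma pd_comp (F : 'rV[R]_n -> R) i u : C1_on V F -> U u ->
  pd i (F \o T) u = \sum_j pd i (fun v => T v 0 j) u * pd j F (T u).
Proof. by move=> F1 Uu; apply: is_derive_pd; exact: is_derive_comp. Qed.

Lemma for_continuous_comp_T (F : 'rV[R]_n -> R) u : U u ->
  {for T u, continuous F} -> {for u, continuous (F \o T)}.
Proof.
move=> Uu Fc; apply: continuous_comp => //.
exact: differentiable_continuous (C1_vec_differentiable Uu).
Qed.

Lemma C1_on_comp (F : 'rV[R]_n -> R) : C1_on V F -> C1_on U (F \o T).
Proof.
move=> F1; apply: (C1_on_pd oU _ (fun u i => is_derive_comp i F1)).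
  by move=> u Uu; apply: for_continuous_comp_T => //; case: (F1 _ (TUV Uu)).
move=> u i Uu; apply: for_continuous_sum => j _; apply: for_continuousM.
  by have [_ /(_ i)[]] := T1 j Uu.
apply: (@for_continuous_comp_T (pd j F)) => //.
by have [_ /(_ j)[]] := F1 _ (TUV Uu).
Qed.

End Chain_rule.

(** The mean value theorem is applied along axis i to the increment [G] in direction j, then along
    axis j to [pd i F]. The radius 2|s| allows for i = j, where both steps add up. *)
Lemma double_increment n (U : set 'rV[R]_n) (F : 'rV[R]_n -> R) i j u s :
  (forall v, `|v - u| <= 2 * `|s| -> U v) ->
  C1_on U F -> C1_on U (pd i F) ->
  exists2 v, `|v - u| <= 2 * `|s| &
    F (u + s *: delta_mx 0 i + s *: delta_mx 0 j) - F (u + s *: delta_mx 0 i)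
    - F (u + s *: delta_mx 0 j) + F u = s * (s * pd j (pd i F) v).
Proof.
move=> UP F1 dF1.
have ball2 (a b : R) : `|a| <= `|s| -> `|b| <= `|s| ->
    `|u + a *: delta_mx 0 i + b *: delta_mx 0 j - u| <= 2 * `|s|.
  move=> sa sb; rewrite -(addrA u) (addrC u) addrK (le_trans (ler_normD _ _))//.
  rewrite mulr2n mulrDl !mul1r lerD//.
    exact: le_trans (norm_delta _ _) _.
  exact: le_trans (norm_delta _ _) _.
have ball1 (a : R) : `|a| <= `|s| -> U (u + a *: delta_mx 0 i).
  move=> sa; apply: UP; have := ball2 a 0 sa; rewrite scale0r addr0.
  by apply; rewrite normr0.
have ball1' (a : R) : `|a| <= `|s| ->
    U (u + a *: delta_mx 0 i + s *: delta_mx 0 j).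
  by move=> sa; apply: UP; exact: ball2.
pose e : 'rV[R]_n := s *: delta_mx 0 j.
pose G v := F (v + e) - F v.
have dG v : U (v + e) -> U v -> is_derive v (delta_mx 0 i) (G : _ -> R^o)
    (pd i F (v + e) - pd i F v).
  move=> Uve Uv; have [_ /(_ i)[dv _]] := F1 _ Uv.
  have [_ /(_ i)[dve _]] := F1 _ Uve.
  have dvE : (fun h : R => h^-1 *: ((F : _ -> R^o) ((h *: delta_mx 0 i + v) + e)
      - F (v + e))) = (fun h : R => h^-1 *:
      ((F : _ -> R^o) (h *: delta_mx 0 i + (v + e)) - F (v + e))).
    by apply/funext => h; rewrite addrA.
  apply: is_deriveB; last exact: DeriveDef.
  apply: DeriveDef.
    by rewrite /derivable dvE.
  by rewrite /pd /derive dvE.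
have [|a sa Ga] := @MVT_pd n G i u s.
  by move=> t ts; have /@ex_derive := dG _ (ball1' _ ts) (ball1 _ ts).
have [|b sb Gb] := @MVT_pd n (pd i F) j (u + a *: delta_mx 0 i) s.
  move=> t ts; have [] := dF1 (u + a *: delta_mx 0 i + t *: delta_mx 0 j).
    by apply: UP; exact: ball2.
  by move=> _ /(_ j)[].
exists (u + a *: delta_mx 0 i + b *: delta_mx 0 j); first exact: ball2.
rewrite -Gb -/e -(is_derive_pd (dG _ (ball1' _ sa) (ball1 _ sa))) -Ga /G.
by rewrite opprB addrA addrAC.
Qed.

Lemma ler_dist_split (a b c d e : R) :
  `|a - b| <= e / 2 -> `|c - d| <= e / 2 -> b = d -> `|c - a| <= e.
Proof.
move=> ab cd bd; rewrite -(subrKA d) [leRHS]splitr (le_trans (ler_normD _ _))//.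
by rewrite lerD// -bd distrC.
Qed.

(** The second difference is symmetric in i and j, so at every scale some value of one mixed
    derivative equals some value of the other; both are close to their values at u. *)
Lemma pd_comm n (U : set 'rV[R]_n) (F : 'rV[R]_n -> R) i j u :
  open U -> C1_on U F -> (forall k, C1_on U (pd k F)) -> U u ->
  pd i (pd j F) u = pd j (pd i F) u.
Proof.
move=> oU F1 dF1 Uu; apply/eqP; rewrite -subr_eq0 -normr_le0.
apply/ler_addgt0Pl => e e0; rewrite addr0.
have c1 : {for u, continuous (pd j (pd i F))} := C1_on_pd_continuous (dF1 i) Uu.
have c2 : {for u, continuous (pd i (pd j F))} := C1_on_pd_continuous (dF1 j) Uu.
have e20 : 0 < e / 2 by rewrite divr_gt0.
have n1 : \forall v \near u, `|pd j (pd i F) u - pd j (pd i F) v| <= e / 2.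
  by move/cvgrPdist_le : c1 => /(_ _ e20).
have n2 : \forall v \near u, `|pd i (pd j F) u - pd i (pd j F) v| <= e / 2.
  by move/cvgrPdist_le : c2 => /(_ _ e20).
have nU : nbhs u U by exact: open_nbhs_nbhs.
have [r r0 rP] := (rV_nbhsP _ _).1 (filterI nU (filterI n1 n2)).
have r20 : 0 < r / 2 by rewrite divr_gt0.
have r2 : 2 * `|r / 2| = r by rewrite gtr0_norm// mulrC divfK.
have rU v : `|v - u| <= 2 * `|r / 2| -> U v by rewrite r2 => /rP[].
have [v1 v1u E1] := double_increment j rU F1 (dF1 i).
have [v2 v2u E2] := double_increment i rU F1 (dF1 j).
have E : pd j (pd i F) v1 = pd i (pd j F) v2.
  have r2n : r / 2 != 0 by rewrite gt_eqF.
  have E3 : r / 2 * (r / 2 * pd j (pd i F) v1) = r / 2 * (r / 2 * pd i (pd j F) v2).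
    apply: etrans (esym E1) _; apply: etrans _ E2.
    rewrite (addrAC u); congr (_ + _); exact: addrAC.
  by move/(mulfI r2n)/(mulfI r2n) : E3.
have /rP[_ [H1 _]] : `|v1 - u| <= r by rewrite -r2.
have /rP[_ [_ H2]] : `|v2 - u| <= r by rewrite -r2.
exact: ler_dist_split H1 H2 E.
Qed.

End Calculus.

(** * Derivatives of matrix products, determinants and inverses *)

Section Matrix_calculus.
Context {R : realType}.
Variables (d : nat) (U : set 'rV[R]_d).
Hypothesis oU : open U.

Lemma C1_on_prod (I : Type) (r : seq I) (F : I -> 'rV[R]_d -> R) :
  (forall k, C1_on U (F k)) -> C1_on U (fun v => \prod_(k <- r) F k v).
Proof.
move=> F1; elim: r => [|k r IH].
  have -> : (fun v => \prod_(k <- [::]) F k v) = (fun=> 1).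
    by apply/funext => v; rewrite big_nil.
  exact: C1_on_cst.
have -> : (fun v => \prod_(k <- k :: r) F k v) =
    (fun v => F k v * \prod_(k <- r) F k v).
  by apply/funext => v; rewrite big_cons.
exact: C1_onM (F1 k) IH.
Qed.

Lemma pd_prod (I : eqType) (r : seq I) (F : I -> 'rV[R]_d -> R) i u :
  uniq r -> (forall k, C1_on U (F k)) -> U u ->
  pd i (fun v => \prod_(k <- r) F k v) u =
  \sum_(k <- r) pd i (F k) u * \prod_(l <- r | l != k) F l u.
Proof.
move=> + F1 Uu; elim: r => [_|k r IH].
  have -> : (fun v => \prod_(k <- [::]) F k v) = (fun=> 1).
    by apply/funext => v; rewrite big_nil.
  by rewrite big_nil pd_cst.
move=> /= /andP[kr ur].
have -> : (fun v => \prod_(k <- k :: r) F k v) =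
    (fun v => F k v * \prod_(k <- r) F k v).
  by apply/funext => v; rewrite big_cons.
rewrite (pdM i (F1 k) (C1_on_prod r F1) Uu) IH// big_cons addrC.
congr (_ + _).
  rewrite mulrC big_cons eqxx/=; congr (_ * _).
  rewrite big_seq [RHS]big_seq_cond; apply: eq_bigl => l.
  by case: eqP kr => [->|]; [move/negPf->|rewrite andbT].
rewrite mulr_sumr [LHS]big_seq [RHS]big_seq; apply: eq_bigr => l lr.
rewrite big_cons; case: eqP lr kr => [-> ->//|_ _ _].
by rewrite mulrCA.
Qed.

Definition mpd m n (i : 'I_d) (G : 'rV[R]_d -> 'M[R]_(m, n)) u : 'M[R]_(m, n) :=
  \matrix_(k, l) pd i (fun v => G v k l) u.

Definition mC1 m n (G : 'rV[R]_d -> 'M[R]_(m, n)) :=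
  forall k l, C1_on U (fun v => G v k l).

Lemma mC1_mulmx m n p (G : 'rV[R]_d -> 'M[R]_(m, n)) (H : 'rV[R]_d -> 'M[R]_(n, p)) :
  mC1 G -> mC1 H -> mC1 (fun v => G v *m H v).
Proof.
move=> G1 H1 k l.
apply: (@C1_on_eq _ _ _ (fun v => \sum_j G v k j * H v j l)) => //.
  by move=> v _; rewrite mxE.
by apply: C1_on_sum => // j _; apply: C1_onM.
Qed.

Lemma mpd_mulmx m n p (G : 'rV[R]_d -> 'M[R]_(m, n)) (H : 'rV[R]_d -> 'M[R]_(n, p))
    i u : mC1 G -> mC1 H -> U u ->
  mpd i (fun v => G v *m H v) u = mpd i G u *m H u + G u *m mpd i H u.
Proof.
move=> G1 H1 Uu; apply/matrixP => k l; rewrite !mxE -big_split /=.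
rewrite (@pd_eq_on _ _ U _ (fun v => \sum_j G v k j * H v j l))//; last first.
  by move=> v _; rewrite mxE.
rewrite (pd_sum (U := U))// => [|j _]; last by apply: C1_onM.
apply: eq_bigr => j _; rewrite (pdM i (G1 k j) (H1 j l) Uu) !mxE.
by rewrite addrC [H u j l * _]mulrC.
Qed.

Lemma mC1_tr m n (G : 'rV[R]_d -> 'M[R]_(m, n)) :
  mC1 G -> mC1 (fun v => (G v)^T).
Proof.
move=> G1 k l; apply: (C1_on_eq oU _ (G1 l k)) => v _.
by rewrite mxE.
Qed.

Lemma mpd_tr m n (G : 'rV[R]_d -> 'M[R]_(m, n)) i u :
  mpd i (fun v => (G v)^T) u = (mpd i G u)^T.
Proof.
apply/matrixP => k l; rewrite !mxE; congr (pd i _ u).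
by apply/funext => v; rewrite mxE.
Qed.

Lemma C1_on_det m (G : 'rV[R]_d -> 'M[R]_m) :
  mC1 G -> C1_on U (fun v => \det (G v)).
Proof.
move=> G1; apply: C1_on_sum => // s _; apply: C1_onZ => //.
by apply: C1_on_prod => k; exact: G1.
Qed.

(** Jacobi's formula: the product rule differentiates one row at a time. *)
Lemma pd_det_cofactor m (G : 'rV[R]_d -> 'M[R]_m) i u : mC1 G -> U u ->
  pd i (fun v => \det (G v)) u =
  \sum_k \sum_l pd i (fun v => G v k l) u * cofactor (G u) k l.
Proof.
move=> G1 Uu.
have Gk1 (s : 'S_m) k : C1_on U (fun v => G v k (s k)) by exact: G1.
rewrite (pd_sum (U := U))//; last first.
  move=> s _; apply: C1_onZ => //; exact: C1_on_prod.
transitivity (\sum_(k < m) \sum_(s : 'S_m)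
    (-1) ^+ s * (pd i (fun v => G v k (s k)) u * \prod_(l | l != k) G u l (s l))).
  rewrite exchange_big; apply: eq_bigr => s _.
  rewrite (pdZ oU _ _ (C1_on_prod _ (Gk1 s)) Uu).
  rewrite (pd_prod _ (index_enum_uniq _) (Gk1 s) Uu) mulr_sumr.
  by apply: eq_bigr.
apply: eq_bigr => k _.
(* Row k of G is replaced by its derivative; the expansion along that row then involves the
   cofactors of G itself. *)
pose A : 'M[R]_m := \matrix_(a, b)
  if a == k then pd i (fun v => G v k b) u else G u a b.
transitivity (\det A).
  apply: eq_bigr => s _; congr (_ * _); rewrite [RHS](bigD1 k)//= mxE eqxx.
  by congr (_ * _); apply: eq_bigr => l /negPf lk; rewrite mxE lk.
rewrite (expand_det_row _ k); apply: eq_bigr => l _; rewrite mxE eqxx.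
congr (_ * _); rewrite /cofactor; congr (_ * \det _).
by apply/matrixP => a b; rewrite !mxE eq_sym (negPf (neq_lift _ _)).
Qed.

Variables (m : nat) (G : 'rV[R]_d -> 'M[R]_m).
Hypotheses (G1 : mC1 G) (Gunit : forall u, U u -> G u \in unitmx).

Lemma pd_det i u : U u -> pd i (fun v => \det (G v)) u =
  \det (G u) * \tr (invmx (G u) *m mpd i G u).
Proof.
move=> Uu; rewrite pd_det_cofactor// exchange_big mulr_sumr.
apply: eq_bigr => k _; rewrite mxE mulr_sumr; apply: eq_bigr => l _.
have -> : invmx (G u) k l = (\det (G u))^-1 * cofactor (G u) l k.
  by rewrite /invmx Gunit// !mxE.
have d0 : \det (G u) != 0 by rewrite -unitfE -unitmxE Gunit.
by rewrite mxE !mulrA divff// mul1r -mulrA mulrC.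
Qed.

(** By Cramer's rule the entries of the inverse are cofactors divided by the determinant, both
    polynomial in the entries of G. *)
Lemma mC1_invmx : mC1 (fun v => invmx (G v)).
Proof.
move=> k l.
apply: (@C1_on_eq _ _ _ (fun v => (\det (G v))^-1 * cofactor (G v) l k)) => //.
  by move=> v /[!inE] Uv; rewrite /invmx Gunit// !mxE.
apply: C1_onM => //.
  apply: C1_onV => //; first exact: C1_on_det.
  by move=> v Uv; rewrite -unitfE -unitmxE Gunit.
apply: C1_onZ => //.
pose H v : 'M[R]_m.-1 := row' l (col' k (G v)).
apply: (@C1_on_det _ H) => a b; apply: (C1_on_eq oU _ (G1 (lift l a) (lift k b))).
by move=> v _; rewrite !mxE.
Qed.

(** Obtained by differentiating G G^-1 = 1. *)
Lemma mpd_invmx i u : U u -> mpd i (fun v => invmx (G v)) u =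
  - (invmx (G u) *m mpd i G u *m invmx (G u)).
Proof.
move=> Uu; have := mpd_mulmx i G1 mC1_invmx Uu.
have -> : mpd i (fun v => G v *m invmx (G v)) u = 0.
  apply/matrixP => k l; rewrite !mxE.
  rewrite (@pd_eq_on _ _ U _ (fun v => (1%:M : 'M[R]_m) k l))//; first exact: pd_cst.
  by move=> v /[!inE] Uv; rewrite mulmxV ?Gunit.
move=> /(congr1 (mulmx (invmx (G u)))).
rewrite mulmx0 mulmxDr !mulmxA mulVmx ?Gunit// mul1mx => /eqP.
by rewrite eq_sym addrC addr_eq0 => /eqP.
Qed.

End Matrix_calculus.

(** * Hessians along maps *)

(* Conversion would otherwise unfold partial derivatives down to limits. *)
Opaque pd.

Section Second_order.
Context {R : realType}.

Definition C2_on n (U : set 'rV[R]_n) (F : 'rV[R]_n -> R) : Prop :=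
  C1_on U F /\ forall i, C1_on U (pd i F).

Definition christoffel_row n (G : 'rV[R]_n -> 'M[R]_n) u i j : 'rV[R]_n :=
  \row_k christoffel G u k i j.

(** Christoffel symbols of the first kind, that is, with the upper index lowered by the metric. No
    inverse matrix occurs in them, which makes their pullback computable. *)
Definition christoffel1 n (G : 'rV[R]_n -> 'M[R]_n) u i j : 'rV[R]_n :=
  \row_l (2^-1 * (pd i (fun v => G v j l) u + pd j (fun v => G v i l) u
                  - pd l (fun v => G v i j) u)).

Lemma christoffel_rowE n (G : 'rV[R]_n -> 'M[R]_n) u i j :
  christoffel_row G u i j = christoffel1 G u i j *m (invmx (G u))^T.
Proof.
apply/rowP => k; rewrite !mxE /christoffel mulr_sumr; apply: eq_bigr => l _.
by rewrite !mxE mulrCA [RHS]mulrC.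
Qed.

Lemma christoffel_row_mul n (G : 'rV[R]_n -> 'M[R]_n) u i j :
  (G u)^T = G u -> G u \in unitmx ->
  christoffel_row G u i j *m G u = christoffel1 G u i j.
Proof.
move=> Gsym Gu; rewrite christoffel_rowE -{2}Gsym -mulmxA -trmx_mul mulmxV//.
by rewrite trmx1 mulmx1.
Qed.

Lemma sub_mxE p q (A B : 'M[R]_(p, q)) i j : (A - B) i j = A i j - B i j.
Proof. by rewrite !mxE. Qed.

(** The cancellation behind the Koszul formula. In its use [aijp] is the product of the second
    derivative d_i d_j T with d_p T, symmetric in i and j, and the [b] terms come from derivatives
    of the target metric. *)
Lemma koszul_sum (aijp aipj ajip ajpi apij apji bi bj bp : R) :
  aipj = apij -> ajpi = apji -> ajip = aijp ->
  2^-1 * (aijp + aipj + bi + (ajip + ajpi + bj) - (apij + apji + bp)) =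
  aijp + 2^-1 * (bi + bj - bp).
Proof. by move=> -> -> ->; field. Qed.

Section Map.
Variables (m n : nat) (U : set 'rV[R]_m) (V : set 'rV[R]_n).
Variables (T : 'rV[R]_m -> 'rV[R]_n).
Hypotheses (oU : open U) (oV : open V) (TUV : forall u, U u -> V (T u)).
Hypothesis T2 : forall k, C2_on U (fun v => T v 0 k).

(** The covariant derivative of d_j T in direction d_i, in target coordinates; its product with the
    unit normal is an entry of the second fundamental form. *)
Definition acceleration (G : 'rV[R]_n -> 'M[R]_n) u (i j : 'I_m) : 'rV[R]_n :=
  \row_k (pd i (pd j (fun v => T v 0 k)) u
    + \sum_r \sum_s christoffel G (T u) k r s
        * pd i (fun v => T v 0 r) u * pd j (fun v => T v 0 s) u).

Lemma accelerationE (G : 'rV[R]_n -> 'M[R]_n) u i j :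
  acceleration G u i j = row j (mpd i (jac T) u) +
    \sum_r \sum_s (jac T u i r * jac T u j s) *: christoffel_row G (T u) r s.
Proof.
apply/rowP => k; rewrite !mxE; congr (_ + _).
  by congr (pd i _ u); apply/funext => v; rewrite mxE.
rewrite summxE; apply: eq_bigr => r _; rewrite summxE; apply: eq_bigr => s _.
by rewrite !mxE -mulrA [RHS]mulrC.
Qed.

Lemma mC1_jac : mC1 U (jac T).
Proof.
move=> i k; apply: (C1_on_eq oU _ ((T2 k).2 i)) => v _.
by rewrite mxE.
Qed.

Lemma jac_sym u i j : U u -> row j (mpd i (jac T) u) = row i (mpd j (jac T) u).
Proof.
move=> Uu; apply/rowP => k.
have mpdE a b : row b (mpd a (jac T) u) 0 k = pd a (fun v => jac T v b k) u.
  by rewrite 2!mxE.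
have jacE a b : pd a (fun v => jac T v b k) u = pd a (pd b (fun v => T v 0 k)) u.
  by congr (pd a _ u); apply/funext => v; rewrite mxE.
apply: etrans (mpdE i j) (etrans _ (esym (mpdE j i))).
apply: etrans (jacE i j) (etrans _ (esym (jacE j i))).
exact: pd_comm oU (T2 k).1 (T2 k).2 Uu.
Qed.

Variables (G : 'rV[R]_n -> 'M[R]_n) (H : 'rV[R]_m -> 'M[R]_m).
Hypotheses (G1 : mC1 V G) (Gsym : forall x, V x -> (G x)^T = G x).
Hypothesis Gunit : forall x, V x -> G x \in unitmx.
Hypothesis Hunit : forall u, U u -> H u \in unitmx.
Hypothesis HE : forall u, U u -> H u = jac T u *m G (T u) *m (jac T u)^T.

Let T1 k : C1_on U (fun v => T v 0 k) := (T2 k).1.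

Lemma mC1_comp p q (K : 'rV[R]_n -> 'M[R]_(p, q)) : mC1 V K -> mC1 U (K \o T).
Proof. by move=> K1 k l; exact: (C1_on_comp oU oV TUV T1 (K1 k l)). Qed.

Lemma mpd_metric u p : U u -> mpd p H u =
  mpd p (jac T) u *m G (T u) *m (jac T u)^T
  + (mpd p (jac T) u *m G (T u) *m (jac T u)^T)^T
  + jac T u *m mpd p (G \o T) u *m (jac T u)^T.
Proof.
move=> Uu.
have -> : mpd p H u = mpd p (fun v => jac T v *m (G \o T) v *m (jac T v)^T) u.
  apply/matrixP => k l; rewrite !mxE.
  by apply: (pd_eq_on p oU Uu) => v /[!inE] Uv; rewrite HE.
have G1' := mC1_comp G1.
have JT1 : mC1 U (fun v => (jac T v)^T) by apply: (mC1_tr oU); exact: mC1_jac.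
rewrite (mpd_mulmx oU p (mC1_mulmx oU mC1_jac G1') JT1 Uu).
rewrite (mpd_mulmx oU p mC1_jac G1' Uu).
rewrite mpd_tr mulmxDl addrAC; congr (_ + _ + _).
by rewrite !trmx_mul trmxK Gsym ?mulmxA//; exact: TUV.
Qed.

(** Derivatives of H = J G J^T are of two kinds. Those that hit J cancel in the Koszul combination
    except for d_i d_j T, and those that hit G assemble into the Christoffel symbols of G along
    T. *)
Lemma christoffel1_pullback u i j : U u ->
  christoffel1 H u i j = acceleration G u i j *m G (T u) *m (jac T u)^T.
Proof.
move=> Uu; set J := jac T u; set x := T u.
have Vx : V x by exact: TUV.
pose dg r k l := pd r (fun y => G y k l) x.
pose a p : 'M[R]_m := mpd p (jac T) u *m G x *m J^T.
pose b p i j := \sum_r \sum_k \sum_l J p r * J i k * J j l * dg r k l.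
have dH p k l : pd p (fun v => H v k l) u = a p k l + a p l k + b p k l.
  have := congr1 (fun M : 'M[R]_m => M k l) (mpd_metric p Uu).
  rewrite !mxE => ->; congr (_ + _ + _).
  transitivity (\sum_s \sum_r \sum_q J p q * J k r * J l s * dg q r s).
    apply: eq_bigr => s _; rewrite [X in X * _]mxE [J^T _ _]mxE mulr_suml.
    apply: eq_bigr => r _; rewrite [mpd _ _ _ _ _]mxE.
    have -> : pd p (fun v => (G \o T) v r s) u = \sum_q J p q * dg q r s.
      rewrite (pd_comp oU oV TUV T1 _ (G1 r s) Uu).
      by apply: eq_bigr => q _; rewrite mxE.
    rewrite mulr_sumr mulr_suml; apply: eq_bigr => q _.
    by rewrite [RHS]mulrAC mulrA [J p q * J k r]mulrC.
  rewrite exchange_big; under eq_bigr do rewrite exchange_big.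
  by rewrite exchange_big.
have a_sym p k l : a p k l = a k p l.
  have aE q k' : a q k' l = (row k' (mpd q (jac T) u) *m G x *m J^T) 0 l.
    by rewrite -!row_mul [RHS]mxE.
  apply: etrans (aE p k) (etrans _ (esym (aE k p))).
  by rewrite (jac_sym p k Uu).
apply/rowP => p; rewrite [LHS]mxE !dH accelerationE !mulmxDl [RHS]mxE.
have -> : (row j (mpd i (jac T) u) *m G x *m J^T) 0 p = a i j p.
  by rewrite -!row_mul mxE.
have -> : ((\sum_r \sum_s (J i r * J j s) *: christoffel_row G x r s)
    *m G x *m J^T) 0 p = 2^-1 * (b i j p + b j i p - b p i j).
  have bE : b i j p + b j i p - b p i j = \sum_r \sum_s \sum_l
      J i r * J j s * J p l * (dg r s l + dg s r l - dg l r s).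
    have -> : b j i p = \sum_r \sum_s \sum_l J i r * J j s * J p l * dg s r l.
      rewrite /b exchange_big; apply: eq_bigr => r _; apply: eq_bigr => s _.
      by apply: eq_bigr => l _; rewrite [J j s * _]mulrC.
    have -> : b p i j = \sum_r \sum_s \sum_l J i r * J j s * J p l * dg l r s.
      rewrite /b exchange_big; apply: eq_bigr => r _.
      rewrite exchange_big; apply: eq_bigr => s _.
      apply: eq_bigr => l _; congr (_ * _).
      by rewrite [J p l * _]mulrC mulrAC.
    rewrite /b -!(big_split, sumrB) /=; apply: eq_bigr => r _.
    rewrite -!(big_split, sumrB) /=; apply: eq_bigr => s _.
    rewrite -!(big_split, sumrB) /=; apply: eq_bigr => l _.
    by rewrite mulrBr mulrDr.
  rewrite bE !mulmx_suml summxE mulr_sumr; apply: eq_bigr => r _.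
  rewrite !mulmx_suml summxE mulr_sumr; apply: eq_bigr => s _.
  rewrite -!scalemxAl christoffel_row_mul ?Gsym ?Gunit// !mxE mulr_sumr mulr_sumr.
  apply: eq_bigr => l _; rewrite !mxE -/(dg r s l) -/(dg s r l) -/(dg l r s).
  ring.
exact: koszul_sum (a_sym i p j) (a_sym j p i) (a_sym j i p).
Qed.

(** A restatement of [christoffel1_pullback]: the connection of H is the tangential part of the
    connection of G, so what is left over is orthogonal to the image of J. *)
Lemma gauss_formula u i j : U u ->
  (acceleration G u i j - christoffel_row H u i j *m jac T u)
    *m G (T u) *m (jac T u)^T = 0.
Proof.
move=> Uu; have Hsym : (H u)^T = H u.
  by rewrite HE// !trmx_mul trmxK Gsym ?mulmxA//; exact: TUV.
rewrite !mulmxBl -christoffel1_pullback//.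
have -> : christoffel_row H u i j *m jac T u *m G (T u) *m (jac T u)^T =
    christoffel_row H u i j *m H u by rewrite HE// !mulmxA.
by rewrite christoffel_row_mul ?subrr ?Hunit.
Qed.

(** The second order chain rule, with the Christoffel terms of both metrics inserted. The last
    summand pairs dF with the vector that [gauss_formula] shows to be orthogonal to the image of
    J. *)
Lemma hessian_comp F u i j : C2_on V F -> U u ->
  hessian H (F \o T) u i j =
  (jac T u *m hessian G F (T u) *m (jac T u)^T) i j
  + ((acceleration G u i j - christoffel_row H u i j *m jac T u)
     *m (dif F (T u))^T) 0 0.
Proof.
move=> [F1 F2] Uu; set x := T u.
have Vx : V x by exact: TUV.
pose tt k := pd i (pd j (fun v => T v 0 k)) u.
pose J := jac T u.
have E1 : pd i (pd j (F \o T)) u =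
    \sum_k tt k * pd k F x + \sum_k \sum_l J i k * J j l * pd k (pd l F) x.
  rewrite (pd_eq_on i oU Uu
    (G := fun v => \sum_k pd j (fun v => T v 0 k) v * (pd k F \o T) v)); last first.
    by move=> v /[!inE] Uv; rewrite (pd_comp oU oV TUV T1 _ F1 Uv).
  have tF1 k : C1_on U (pd k F \o T) by exact: (C1_on_comp oU oV TUV T1 (F2 k)).
  rewrite (pd_sum oU) //; last by move=> k _; apply: C1_onM => //; exact: (T2 k).2.
  rewrite [X in _ + X]exchange_big -big_split /=; apply: eq_bigr => k _.
  rewrite (pdM i ((T2 k).2 j) (tF1 k) Uu) [LHS]addrC; congr (_ + _); first by rewrite mulrC.
  rewrite (pd_comp oU oV TUV T1 _ (F2 k) Uu) mulr_sumr; apply: eq_bigr => l _.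
  by rewrite !mxE mulrCA mulrA.
have E2 k : pd k (F \o T) u = \sum_l J k l * pd l F x.
  rewrite (pd_comp oU oV TUV T1 _ F1 Uu).
  by apply: eq_bigr => l _; rewrite mxE.
have E3 : (J *m hessian G F x *m J^T) i j =
    \sum_k \sum_l J i k * J j l * pd k (pd l F) x
    - \sum_k \sum_r \sum_s J i r * J j s * christoffel G x k r s * pd k F x.
  rewrite mxE.
  transitivity (\sum_k \sum_l (J i k * J j l * pd k (pd l F) x
    - \sum_q J i k * J j l * christoffel G x q k l * pd q F x)).
    rewrite exchange_big; apply: eq_bigr => l _; rewrite !mxE mulr_suml.
    apply: eq_bigr => k _; rewrite !mxE mulrBr mulrBl; congr (_ - _).
      by rewrite mulrAC.
    rewrite mulr_sumr mulr_suml; apply: eq_bigr => q _.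
    by ring.
  under eq_bigr do rewrite sumrB.
  rewrite sumrB; congr (_ - _).
  under eq_bigr do rewrite exchange_big.
  by rewrite exchange_big.
have E4 : (acceleration G u i j *m (dif F x)^T) 0 0 = \sum_k tt k * pd k F x
    + \sum_k \sum_r \sum_s J i r * J j s * christoffel G x k r s * pd k F x.
  rewrite mxE -big_split; apply: eq_bigr => k _; rewrite !mxE mulrDl; congr (_ + _).
  rewrite mulr_suml; apply: eq_bigr => r _; rewrite mulr_suml; apply: eq_bigr => s _.
  by rewrite !mxE; ring.
have E5 : (christoffel_row H u i j *m J *m (dif F x)^T) 0 0 =
    \sum_k christoffel H u k i j * pd k (F \o T) u.
  rewrite -mulmxA mxE; apply: eq_bigr => k _; rewrite E2 !mxE; congr (_ * _).
  by apply: eq_bigr => l _; rewrite !mxE.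
rewrite [LHS]mxE mulmxBl sub_mxE E3 E4 E5 E1; ring.
Qed.

End Map.
End Second_order.

(** * Gradients and Hessians under chart changes and on hypersurfaces *)

Section Frames.
Context {R : realType}.

(** The polarization of [gradnorm2]; a cut-off in Green's formula brings in two different
    functions. *)
Definition graddot n (G : 'rV[R]_n -> 'M[R]_n) (E F : 'rV[R]_n -> R) u : R :=
  (dif E u *m invmx (G u) *m (dif F u)^T) 0 0.

Section Linear_algebra.
Variables (m : nat) (J : 'M[R]_(m, m.+1)) (N : 'rV[R]_m.+1) (G : 'M[R]_m.+1).
Hypotheses (Gsym : G^T = G) (Hunit : J *m G *m J^T \in unitmx).
Hypotheses (JN : J *m G *m N^T = 0) (NN : N *m G *m N^T = 1%:M).

(** In the frame formed by N and the rows of J the metric is block diagonal, with blocks 1 and J G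
    J^T; inverting the blocks splits the inverse metric into a normal and a tangential part. *)
Lemma invmx_frame :
  invmx G = J^T *m invmx (J *m G *m J^T) *m J + N^T *m N.
Proof.
pose E : 'M[R]_(1 + m, m.+1) := col_mx N J.
pose H := J *m G *m J^T.
pose D : 'M[R]_(1 + m) := block_mx 1%:M 0 0 H.
pose D' : 'M[R]_(1 + m) := block_mx 1%:M 0 0 (invmx H).
have NJ : N *m G *m J^T = 0.
  by apply: trmx_inj; rewrite trmx0 !trmx_mul trmxK Gsym mulmxA JN.
have ED : E *m G *m E^T = D.
  by rewrite tr_col_mx mul_col_mx mul_col_row NN NJ JN.
have DD' : D *m D' = 1%:M.
  rewrite mulmx_block !mul0mx !mulmx0 !addr0 !add0r mulmx1 mulmxV//.
  by rewrite -scalar_mx_block.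
(* E is square, so its right inverse is also a left inverse, and E can be moved to the other end of
   the product. *)
have E1 : E *m (G *m E^T *m D') = 1%:M by rewrite !mulmxA ED.
have E2 : G *m (E^T *m D' *m E) = 1%:M.
  by have := mulmx1C E1; rewrite !mulmxA.
have GE : G \in unitmx by case/mulmx1_unit : E2.
have -> : invmx G = E^T *m D' *m E.
  by rewrite -[RHS]mul1mx -(mulVmx GE) -(mulmxA (invmx G)) E2 mulmx1.
rewrite tr_col_mx mul_row_block mulmx1 !mulmx0 addr0 add0r mul_row_col.
by rewrite addrC.
Qed.

Hypothesis Gunit : G \in unitmx.

(** [B] is expanded by means of [invmx_frame]; orthogonality to the rows of J removes the tangential
    part. *)
Lemma normal_component (B : 'rV[R]_m.+1) :
  B *m G *m J^T = 0 -> B = (B *m G *m N^T) 0 0 *: N.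
Proof.
move=> BJ; rewrite -[LHS]mulmx1 -(mulmxV Gunit) mulmxA invmx_frame.
rewrite mulmxDr !mulmxA BJ !mul0mx add0r.
by rewrite [X in X *m N]mx11_scalar mul_scalar_mx.
Qed.

Lemma trace_frame (S : 'M[R]_m.+1) :
  \tr (invmx (J *m G *m J^T) *m (J *m S *m J^T)) =
  \tr (invmx G *m S) - (N *m S *m N^T) 0 0.
Proof.
rewrite invmx_frame mulmxDl mxtraceD.
have -> : \tr (N^T *m N *m S) = (N *m S *m N^T) 0 0.
  by rewrite -mulmxA mxtrace_mulC trace_mx11.
by rewrite addrK -(mulmxA _ J) -[in RHS]mulmxA [RHS]mxtrace_mulC !mulmxA.
Qed.

Lemma graddot_frame (a b : 'rV[R]_m.+1) :
  (a *m J^T *m invmx (J *m G *m J^T) *m (b *m J^T)^T) 0 0 =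
  (a *m invmx G *m b^T) 0 0 - (a *m N^T) 0 0 * (b *m N^T) 0 0.
Proof.
rewrite invmx_frame mulmxDr mulmxDl trmx_mul trmxK !mulmxA [X in _ = X - _]mxE.
suff -> : (a *m N^T *m N *m b^T) 0 0 = (a *m N^T) 0 0 * (b *m N^T) 0 0.
  by rewrite addrK.
rewrite -(mulmxA _ N) [X in X *m _]mx11_scalar mul_scalar_mx mxE; congr (_ * _).
by rewrite -[N *m _]trmxK trmx_mul trmxK mxE.
Qed.

End Linear_algebra.

Lemma invmx_congruence m (J G : 'M[R]_m) :
  J *m G *m J^T \in unitmx ->
  [/\ J \in unitmx, G \in unitmx & invmx G = J^T *m invmx (J *m G *m J^T) *m J].
Proof.
move=> HU; have := HU; rewrite !unitmx_mul unitmx_tr => /andP[/andP[Ju Gu] _].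
split=> //; have := mulVmx HU; rewrite !mulmxA => /mulmx1C.
rewrite !mulmxA => E.
have {}E : G *m (J^T *m invmx (J *m G *m J^T) *m J) = 1%:M.
  apply: (can_inj (mulKmx Ju)).
  by rewrite mulmx1 !mulmxA mulmxV// mul1mx.
by rewrite -[RHS]mul1mx -(mulVmx Gu) -(mulmxA (invmx G)) E mulmx1.
Qed.

Section Map.
Variables (m n : nat) (U : set 'rV[R]_m) (V : set 'rV[R]_n).
Variables (T : 'rV[R]_m -> 'rV[R]_n).
Hypotheses (oU : open U) (oV : open V) (TUV : forall u, U u -> V (T u)).
Hypothesis T2 : forall k, C2_on U (fun v => T v 0 k).

Lemma dif_comp (F : 'rV[R]_n -> R) u : C1_on V F -> U u ->
  dif (F \o T) u = dif F (T u) *m (jac T u)^T.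
Proof.
move=> F1 Uu; apply/rowP => i; rewrite [LHS]mxE.
rewrite (pd_comp oU oV TUV (fun k => (T2 k).1) _ F1 Uu) mxE.
by apply: eq_bigr => j _; rewrite !mxE mulrC.
Qed.

Lemma C2_on_comp (F : 'rV[R]_n -> R) : C2_on V F -> C2_on U (F \o T).
Proof.
have T1 k := (T2 k).1; move=> [F1 F2]; split.
  exact: (C1_on_comp oU oV TUV T1 F1).
move=> i; apply: (C1_on_eq (F := fun v => \sum_j pd i (fun v => T v 0 j) v *
    (pd j F \o T) v) oU).
  by move=> v /[!inE] Uv; rewrite (pd_comp oU oV TUV T1 _ F1 Uv).
apply: (C1_on_sum oU) => j _; apply: (C1_onM oU ((T2 j).2 i)).
exact: (C1_on_comp oU oV TUV T1 (F2 j)).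
Qed.

End Map.

Section Chart_change.
Variables (m : nat) (U V : set 'rV[R]_m) (T : 'rV[R]_m -> 'rV[R]_m).
Hypotheses (oU : open U) (oV : open V) (TUV : forall u, U u -> V (T u)).
Hypothesis T2 : forall k, C2_on U (fun v => T v 0 k).
Variables (G H : 'rV[R]_m -> 'M[R]_m).
Hypotheses (G1 : mC1 V G) (Gsym : forall x, V x -> (G x)^T = G x).
Hypothesis Gunit : forall x, V x -> G x \in unitmx.
Hypothesis Hunit : forall u, U u -> H u \in unitmx.
Hypothesis HE : forall u, U u -> H u = jac T u *m G (T u) *m (jac T u)^T.
Variables (E F : 'rV[R]_m -> R) (u : 'rV[R]_m).
Hypotheses (E1 : C1_on V E) (F2 : C2_on V F) (Uu : U u).

(** Here J is square and invertible, so a vector orthogonal to its image is zero and the error term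
    of [hessian_comp] vanishes. *)
Lemma hessian_change :
  hessian H (F \o T) u = jac T u *m hessian G F (T u) *m (jac T u)^T.
Proof.
have HU := Hunit Uu; rewrite (HE Uu) in HU.
have [Ju Gu _] := invmx_congruence HU.
apply/matrixP => i j.
rewrite (hessian_comp oU oV TUV T2 G H i j F2 Uu).
have := gauss_formula oU oV TUV T2 G1 Gsym Gunit Hunit HE i j Uu.
set B := acceleration _ _ _ _ _ - _ => B0.
suff -> : B = 0 by rewrite mul0mx [X in _ + X]mxE addr0.
have JTu : (jac T u)^T \in unitmx by rewrite unitmx_tr.
by rewrite -[B](mulmxK Gu) -[B *m _](mulmxK JTu) B0 !mul0mx.
Qed.

Lemma laplacian_change : laplacian H (F \o T) u = laplacian G F (T u).
Proof.
have HU := Hunit Uu; rewrite (HE Uu) in HU.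
have [Ju Gu GE] := invmx_congruence HU.
rewrite /laplacian hessian_change GE (HE Uu).
by rewrite -(mulmxA _ (jac T u)) -[in RHS]mulmxA [RHS]mxtrace_mulC !mulmxA.
Qed.

Lemma graddot_change : graddot H (E \o T) (F \o T) u = graddot G E F (T u).
Proof.
have HU := Hunit Uu; rewrite (HE Uu) in HU.
have [Ju Gu GE] := invmx_congruence HU.
rewrite /graddot (dif_comp oU oV TUV T2 E1 Uu) (dif_comp oU oV TUV T2 F2.1 Uu).
by rewrite GE (HE Uu) trmx_mul trmxK !mulmxA.
Qed.

End Chart_change.

Section Hypersurface.
Variables (m : nat) (U : set 'rV[R]_m) (V : set 'rV[R]_m.+1).
Variables (T : 'rV[R]_m -> 'rV[R]_m.+1).
Hypotheses (oU : open U) (oV : open V) (TUV : forall u, U u -> V (T u)).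
Hypothesis T2 : forall k, C2_on U (fun v => T v 0 k).
Variables (G : 'rV[R]_m.+1 -> 'M[R]_m.+1) (H : 'rV[R]_m -> 'M[R]_m).
Hypotheses (G1 : mC1 V G) (Gsym : forall x, V x -> (G x)^T = G x).
Hypothesis Gunit : forall x, V x -> G x \in unitmx.
Hypothesis Hunit : forall u, U u -> H u \in unitmx.
Hypothesis HE : forall u, U u -> H u = jac T u *m G (T u) *m (jac T u)^T.
Variables (N : 'rV[R]_m.+1) (u : 'rV[R]_m).
Hypothesis Uu : U u.
Hypotheses (JN : jac T u *m G (T u) *m N^T = 0).
Hypotheses (NN : N *m G (T u) *m N^T = 1%:M).

Definition scalar_form : 'M[R]_m :=
  \matrix_(i, j) (acceleration T G u i j *m G (T u) *m N^T) 0 0.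

(** The error term of [hessian_comp] pairs dF with a vector orthogonal to all tangent vectors, hence
    with a multiple of N. *)
Lemma hessian_hypersurface (F : 'rV[R]_m.+1 -> R) : C2_on V F ->
  hessian H (F \o T) u = jac T u *m hessian G F (T u) *m (jac T u)^T
    + (N *m (dif F (T u))^T) 0 0 *: scalar_form.
Proof.
move=> F2; apply/matrixP => i j.
have Vx := TUV Uu.
have HU := Hunit Uu; rewrite (HE Uu) in HU.
rewrite (hessian_comp oU oV TUV T2 G H i j F2 Uu) [RHS]mxE; congr (_ + _).
have := gauss_formula oU oV TUV T2 G1 Gsym Gunit Hunit HE i j Uu.
set B := acceleration _ _ _ _ _ - _ => B0.
rewrite (normal_component (Gsym Vx) HU JN NN (Gunit Vx) B0).
rewrite -scalemxAl [LHS]mxE [RHS]mxE mulrC; congr (_ * _).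
(* The Christoffel symbols of H multiply tangent vectors only, which are orthogonal to N, so the
   coefficient is that of the acceleration alone. *)
by rewrite [RHS]mxE /B !mulmxBl -!(mulmxA (christoffel_row _ _ _ _)) JN mulmx0 subr0.
Qed.

Lemma laplacian_hypersurface (F : 'rV[R]_m.+1 -> R) : C2_on V F ->
  laplacian H (F \o T) u =
    laplacian G F (T u) - (N *m hessian G F (T u) *m N^T) 0 0
    + (N *m (dif F (T u))^T) 0 0 * \tr (invmx (H u) *m scalar_form).
Proof.
move=> F2; have Vx := TUV Uu.
have HU := Hunit Uu; rewrite (HE Uu) in HU.
rewrite /laplacian hessian_hypersurface// mulmxDr mxtraceD; congr (_ + _).
  by rewrite (HE Uu) (trace_frame (Gsym Vx) HU JN NN).
by rewrite -scalemxAr mxtraceZ.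
Qed.

Lemma graddot_hypersurface (E F : 'rV[R]_m.+1 -> R) : C1_on V E -> C1_on V F ->
  graddot H (E \o T) (F \o T) u = graddot G E F (T u)
    - (dif E (T u) *m N^T) 0 0 * (dif F (T u) *m N^T) 0 0.
Proof.
move=> E1 F1; have Vx := TUV Uu.
have HU := Hunit Uu; rewrite (HE Uu) in HU.
rewrite /graddot (dif_comp oU oV TUV T2 E1 Uu) (dif_comp oU oV TUV T2 F1 Uu).
by rewrite (HE Uu) (graddot_frame (Gsym Vx) HU JN NN).
Qed.

(* The equations of the system are only used in the normal direction and after
   taking the trace. *)
Lemma ricci_normal_hypersurface (F P : 'rV[R]_m.+1 -> R) :
  (0 < m)%N -> C2_on V F -> C1_on V P -> F (T u) != 0 ->
  F (T u) *: ricci G (T u) =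
    hessian G F (T u) - (2 / F (T u)) *: ((dif P (T u))^T *m dif P (T u))
    + (2 / ((m.+1%:R - 1) * F (T u)) * gradnorm2 G P (T u)) *: G (T u) ->
  laplacian G F (T u) = 2 * ((m.+1%:R - 2) / (m.+1%:R - 1))
    * (gradnorm2 G P (T u) / F (T u)) ->
  \tr (invmx (H u) *m scalar_form) = 0 ->
  (N *m ricci G (T u) *m N^T) 0 0 * F (T u) ^+ 2 =
    2 * gradnorm2 H (P \o T) u - F (T u) * laplacian H (F \o T) u.
Proof.
move=> m0 F2 P1 Fu ric lap minimal.
have -> : gradnorm2 H (P \o T) u = gradnorm2 G P (T u) - (dif P (T u) *m N^T) 0 0 ^+ 2.
  exact: graddot_hypersurface.
rewrite (laplacian_hypersurface F2) minimal mulr0 addr0 lap.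
have := congr1 (fun A : 'M[R]_m.+1 => (N *m A *m N^T) 0 0) ric.
rewrite -scalemxAr -scalemxAl [LHS]mxE mulmxDr mulmxBr mulmxDl mulmxBl.
rewrite [RHS]mxE [X in X + _]mxE [X in _ + X + _]mxE.
rewrite -!scalemxAr -!scalemxAl NN.
rewrite [X in _ - X + _]mxE [X in _ + X]mxE [1%:M _ _]mxE eqxx mulr1.
have -> : (N *m ((dif P (T u))^T *m dif P (T u)) *m N^T) 0 0 =
    (dif P (T u) *m N^T) 0 0 ^+ 2.
  rewrite mulmxA -(mulmxA (N *m _)) mxE big_ord1 expr2; congr (_ * _).
  by rewrite -[N *m _]trmxK trmx_mul trmxK mxE.
have n1 : m.+1%:R - 1 != 0 :> R by rewrite -natr1 addrK pnatr_eq0 -lt0n.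
move: n1; set q : R := m.+1%:R => n1.
set X := (N *m ricci _ _ *m _) 0 0; set Y := (N *m hessian _ _ _ *m _) 0 0.
set Z := gradnorm2 _ _ _; set W := (dif P _ *m _) 0 0.
move=> ricE; rewrite expr2 mulrA [X * _]mulrC ricE; field.
by rewrite Fu addrAC subrr add0r pnatr_eq0 -lt0n.
Qed.

End Hypersurface.
End Frames.

(** * The Laplacian in divergence form *)

Section Divergence.
Context {R : realType} {m : nat}.
Variables (U : set 'rV[R]_m) (G : 'rV[R]_m -> 'M[R]_m).
Hypotheses (oU : open U) (G1 : mC1 U G).
Hypothesis Gsym : forall u, U u -> (G u)^T = G u.
Hypothesis Gdet : forall u, U u -> 0 < \det (G u).

Definition volume_density u : R := Num.sqrt (\det (G u)).

(** The components of the field sqrt(det G) E grad F: its ordinary coordinate divergence is the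
    density times the Riemannian divergence of E grad F. *)
Definition density_flux (E F : 'rV[R]_m -> R) (i : 'I_m) u : R :=
  volume_density u * (E u * \sum_j invmx (G u) i j * pd j F u).

Let Gunit u : U u -> G u \in unitmx.
Proof. by move=> Uu; rewrite unitmxE unitfE gt_eqF// Gdet. Qed.

Let w u := invmx (G u).
Let w1 : mC1 U w. Proof. exact: mC1_invmx. Qed.

Lemma C1_on_density : C1_on U volume_density.
Proof. exact: (C1_on_sqrt oU (C1_on_det oU G1) Gdet).1. Qed.

Lemma pd_density i u : U u ->
  pd i volume_density u = volume_density u * (2^-1 * \tr (w u *m mpd i G u)).
Proof.
move=> Uu; rewrite ((C1_on_sqrt oU (C1_on_det oU G1) Gdet).2 u i Uu).
rewrite (pd_det oU G1 Gunit i Uu) -/(w u).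
have d0 := Gdet Uu.
have s0 : volume_density u != 0 by rewrite sqrtr_eq0 -ltNge.
rewrite -[X in _ * (X * _)](sqr_sqrtr (ltW d0)) -/(volume_density u); field.
exact: s0.
Qed.

Lemma C1_on_flux (E F : 'rV[R]_m -> R) i : C1_on U E -> C2_on U F ->
  C1_on U (density_flux E F i).
Proof.
move=> E1 [F1 F2]; apply: (C1_onM oU C1_on_density); apply: (C1_onM oU E1).
by apply: (C1_on_sum oU) => j _; apply: (C1_onM oU (w1 i j)); exact: F2.
Qed.

(** The classical identity d_i(sqrt(det G) G^ij) = - sqrt(det G) G^ik Gamma^j_ik, divided by the
    density. It matches the first order terms of the Laplacian with those of the flux. *)
Lemma divergence_christoffel u j : U u ->
  \sum_i pd i (fun v => w v i j) u
    + 2^-1 * \sum_i \tr (w u *m mpd i G u) * w u i j =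
  - \sum_i \sum_k w u i k * christoffel G u j i k.
Proof.
move=> Uu.
pose D i k l := pd i (fun v => G v k l) u.
have Dsym i k l : D i k l = D i l k.
  apply: (pd_eq_on i oU Uu) => v /[!inE] Uv.
  by rewrite -[in LHS](Gsym Uv) mxE.
have wsym a b : w u a b = w u b a.
  have wT : (w u)^T = w u by rewrite /w trmx_inv Gsym.
  by rewrite -[in LHS]wT mxE.
have dw i : pd i (fun v => w v i j) u =
    - \sum_l (\sum_k w u i k * D i k l) * w u l j.
  have := congr1 (fun A : 'M[R]_m => A i j) (mpd_invmx oU G1 Gunit i Uu).
  rewrite [LHS]mxE => ->; rewrite mxE [X in - X]mxE; congr (- _).
  apply: eq_bigr => l _; congr (_ * _); rewrite mxE.
  by apply: eq_bigr => k _; congr (_ * _); rewrite mxE.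
have trE l : \tr (w u *m mpd l G u) = \sum_i \sum_k w u i k * D l i k.
  apply: eq_bigr => i _; rewrite mxE; apply: eq_bigr => k _; rewrite mxE.
  by rewrite -/(D l k i) Dsym.
have GammaE i k : christoffel G u j i k =
    \sum_l 2^-1 * (D i k l + D k i l - D l i k) * w u l j.
  rewrite /christoffel mulr_sumr; apply: eq_bigr => l _.
  by rewrite -/(w u) wsym mulrA mulrAC.
under eq_bigr do rewrite dw.
rewrite sumrN exchange_big mulr_sumr -sumrN -big_split /=.
transitivity (- \sum_l (\sum_i \sum_k w u i k *
    (2^-1 * (D i k l + D k i l - D l i k))) * w u l j); last first.
  congr (- _).
  transitivity (\sum_i \sum_k \sum_l w u i k *
      (2^-1 * (D i k l + D k i l - D l i k)) * w u l j).
    under [in RHS]eq_bigr do rewrite exchange_big.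
    rewrite exchange_big; apply: eq_bigr => l _; rewrite mulr_suml.
    by apply: eq_bigr => i _; rewrite mulr_suml.
  apply: eq_bigr => i _; apply: eq_bigr => k _; rewrite GammaE mulr_sumr.
  by apply: eq_bigr => l _; rewrite [RHS]mulrA.
rewrite -sumrN; apply: eq_bigr => l _.
(* By symmetry of the inverse metric the first two terms of the Christoffel symbol contribute
   equally, which removes the factor 1/2. *)
have S2 : \sum_i \sum_k w u i k * D k i l = \sum_i \sum_k w u i k * D i k l.
  rewrite exchange_big; apply: eq_bigr => i _; apply: eq_bigr => k _.
  by rewrite wsym.
have -> : \sum_i \sum_k w u i k * (2^-1 * (D i k l + D k i l - D l i k)) =
    \sum_i \sum_k w u i k * D i k l - 2^-1 * \sum_i \sum_k w u i k * D l i k.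
  transitivity (2^-1 * (\sum_i \sum_k w u i k * D i k l +
      \sum_i \sum_k w u i k * D k i l - \sum_i \sum_k w u i k * D l i k)).
    rewrite -big_split -sumrB mulr_sumr; apply: eq_bigr => i _.
    rewrite -big_split -sumrB mulr_sumr; apply: eq_bigr => k _ /=; ring.
  by rewrite S2; field.
rewrite -mulr_suml trE; ring.
Qed.

Lemma divergence_flux (E F : 'rV[R]_m -> R) u :
  C1_on U E -> C2_on U F -> U u ->
  \sum_i pd i (density_flux E F i) u =
  volume_density u * (graddot G E F u + E u * laplacian G F u).
Proof.
move=> E1 [F1 F2] Uu.
have wF1 i j : C1_on U (fun v => w v i j * pd j F v).
  by apply: (C1_onM oU (w1 i j)); exact: F2.
have X1 i : C1_on U (fun v => \sum_j w v i j * pd j F v).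
  by apply: (C1_on_sum oU) => j _; exact: wF1.
have wsym a b : w u a b = w u b a.
  have wT : (w u)^T = w u by rewrite /w trmx_inv Gsym.
  by rewrite -[in LHS]wT mxE.
pose X i := \sum_j w u i j * pd j F u.
pose dX i := \sum_j w u i j * pd i (pd j F) u.
pose dwX i := \sum_j pd i (fun v => w v i j) u * pd j F u.
have fluxE i : pd i (density_flux E F i) u = volume_density u *
    (pd i E u * X i + E u * (dX i + dwX i)
     + E u * (2^-1 * \tr (w u *m mpd i G u) * X i)).
  rewrite (pdM i C1_on_density (C1_onM oU E1 (X1 i)) Uu) pd_density//.
  rewrite (pdM i E1 (X1 i) Uu) (pd_sum oU _ i (fun j _ => wF1 i j) Uu).
  have -> : \sum_j pd i (fun v => w v i j * pd j F v) u = dX i + dwX i.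
    rewrite -big_split; apply: eq_bigr => j _.
    rewrite (pdM i (w1 i j) (F2 j) Uu); congr (_ + _); exact: mulrC.
  rewrite -/(X i); ring.
under eq_bigr do rewrite fluxE.
rewrite -mulr_sumr; congr (_ * _).
rewrite !big_split -!mulr_sumr /= -addrA -mulrDr; congr (_ + E u * _).
  rewrite /graddot mxE.
  transitivity (\sum_i \sum_j pd i E u * (w u i j * pd j F u)).
    by apply: eq_bigr => i _; rewrite mulr_sumr.
  rewrite exchange_big; apply: eq_bigr => j _; rewrite !mxE mulr_suml.
  by apply: eq_bigr => i _; rewrite !mxE mulrA.
have -> : laplacian G F u = \sum_i dX i
    - \sum_j (\sum_i \sum_k w u i k * christoffel G u j i k) * pd j F u.
  transitivity (\sum_i \sum_j (w u i j * pd i (pd j F) u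
    - \sum_k w u i j * christoffel G u k i j * pd k F u)).
    rewrite /laplacian /mxtrace exchange_big; apply: eq_bigr => i _; rewrite mxE.
    apply: eq_bigr => j _; rewrite mxE -/(w u) wsym mulrBr; congr (_ - _).
    by rewrite mulr_sumr; apply: eq_bigr => k _; rewrite mulrA.
  under eq_bigr do rewrite sumrB.
  rewrite sumrB; congr (_ - _).
  under eq_bigr do rewrite exchange_big.
  rewrite exchange_big; apply: eq_bigr => j _.
  rewrite mulr_suml; apply: eq_bigr => i _.
  by rewrite mulr_suml.
rewrite big_split /= -addrA; congr (_ + _).
rewrite -sumrN.
have -> : \sum_j - ((\sum_i \sum_k w u i k * christoffel G u j i k) * pd j F u) =
   \sum_j (\sum_i pd i (fun v => w v i j) u
    + 2^-1 * \sum_i \tr (w u *m mpd i G u) * w u i j) * pd j F u.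
  by apply: eq_bigr => j _; rewrite divergence_christoffel// mulNr.
under [in RHS]eq_bigr do rewrite mulrDl.
rewrite [RHS]big_split /=; congr (_ + _).
  rewrite /dwX exchange_big; apply: eq_bigr => j _.
  by rewrite mulr_suml.
transitivity (\sum_i \sum_j 2^-1 * \tr (w u *m mpd i G u) * (w u i j * pd j F u)).
  by apply: eq_bigr => i _; rewrite mulr_sumr.
rewrite exchange_big; apply: eq_bigr => j _.
rewrite mulr_sumr mulr_suml; apply: eq_bigr => i _.
by rewrite !mulrA.
Qed.

End Divergence.

(** * Riemann sums and volume *)

Section Riemann_sums.
Context {R : realType}.

(** Stronger than uniform continuity on K, as v may lie outside K. The near-covering form of
    compactness, over radii tending to 0 from the right, takes the place of a finite subcover. *)
Lemma compact_uniform n (K : set 'rV[R]_n) (f : 'rV[R]_n -> R) (e : R) :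
  compact K -> (forall u, K u -> {for u, continuous f}) -> 0 < e ->
  exists2 r : R, 0 < r &
    forall u v, K u -> `|v - u| <= r -> `|f v - f u| <= e.
Proof.
move=> /compact_near_coveringP Kc fc e0.
have := @Kc R 0^'+ (fun r u => forall v, `|v - u| <= r -> `|f v - f u| <= e) _ _.
case.
  move=> u Ku; have /cvgrPdist_le /(_ (e / 2)) := fc _ Ku.
  rewrite divr_gt0// => /(_ isT) uP; have [d d0 dP] := (rV_nbhsP _ _).1 uP.
  have d20 : 0 < d / 2 by rewrite divr_gt0.
  have n1 : nbhs u [set w : 'rV[R]_n | `|w - u| <= d / 2].
    by apply/rV_nbhsP; exists (d / 2).
  have n2 : 0^'+ [set r : R | r <= d / 2] by exact: nbhs_right_le.
  exists ([set w | `|w - u| <= d / 2], [set r : R | r <= d / 2]).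
    by split; [exact: n1|exact: n2].
  move=> [w r] /= [wu rd] v vw.
  rewrite -(subrKA (f u)) (le_trans (ler_normD _ _))//.
  rewrite [leRHS]splitr lerD//; last by apply: dP; rewrite (le_trans wu)// ler_pdivrMr// ler_pMr// ler1n.
  rewrite distrC; apply: dP; rewrite -(subrKA w) (le_trans (ler_normD _ _))//.
  by rewrite [leRHS]splitr lerD// (le_trans vw).
move=> d /= d0 dP; exists (d / 2); first by rewrite divr_gt0.
move=> u v Ku vu; apply: (dP (d / 2)) => //=; last by rewrite divr_gt0.
by rewrite sub0r normrN gtr0_norm ?divr_gt0// ltr_pdivrMr// ltr_pMr// ltr1n.
Qed.

Lemma compact_bound (T : topologicalType) (K : set T) (f : T -> R) :
  compact K -> (forall u, K u -> {for u, continuous f}) ->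
  exists2 M : R, 0 <= M & forall u, K u -> `|f u| <= M.
Proof.
move=> /compact_near_coveringP Kc fc.
have := @Kc R +oo (fun r u => `|f u| <= r) _ _.
case.
  move=> u Ku; have /cvgrPdist_le /(_ 1 ltr01) fu := fc _ Ku.
  exists ([set w | `|f u - f w| <= 1], [set r : R | `|f u| + 1 <= r]) => /=.
    by split => //; apply: nbhs_pinfty_ge; exact: num_real.
  move=> [w r] /= [wu rd]; rewrite (le_trans _ rd)// addrC -lerBlDr.
  by rewrite (le_trans _ wu)// distrC lerB_dist.
move=> M [Mreal MP]; exists (`|M| + 1); first by rewrite addr_ge0.
move=> u Ku; apply: (MP (`|M| + 1)) => //.
by rewrite (le_lt_trans (ler_norm _))// ltrDl.
Qed.

(** The norm of row vectors is the maximum norm, so its closed balls are cubes with sides parallel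
    to the axes. *)
Definition cube n (x : 'rV[R]_n) (r : R) : set 'rV[R]_n := [set u | `|u - x| <= r].

Lemma cube_compact n (x : 'rV[R]_n) r : compact (cube x r).
Proof.
apply: bounded_closed_compact.
  exists (`|x| + r); split; first exact: num_real.
  move=> M Mr u ux; apply: le_trans (ltW Mr); rewrite -lerBlDl.
  exact: le_trans (lerB_dist _ _) ux.
have -> : cube x r = closed_ball_ Num.norm x r.
  by apply/seteqP; split => u; rewrite /cube /closed_ball_ /= distrC.
exact: closed_closed_ball_.
Qed.

Section Grid.
Variables (m : nat) (x : 'rV[R]_m) (r : R).
Hypothesis r0 : 0 < r.

Definition mesh (N : nat) : R := 2 * r / N%:R.

(** The lower corner of a cell. Indexing by finite functions makes the grid a finite type, on which
    a shift of one coordinate reindexes sums. *)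
Definition gridpt N (k : {ffun 'I_m -> 'I_N}) : 'rV[R]_m :=
  \row_i (x 0 i - r + mesh N * (k i)%:R).

Lemma mesh_gt0 N : (0 < N)%N -> 0 < mesh N.
Proof. by move=> N0; rewrite divr_gt0 ?mulr_gt0 ?ltr0n. Qed.

Lemma grid_cube N (k : {ffun 'I_m -> 'I_N}) (v : 'rV[R]_m) : (0 < N)%N ->
  (forall i, 0 <= v 0 i <= mesh N) -> cube x r (gridpt k + v).
Proof.
move=> N0 v0; apply/rV_norm_leP; first exact: ltW.
move=> i; rewrite !mxE ler_norml; have /andP[vi0 vie] := v0 i.
have e0 := mesh_gt0 N0.
have k1 : mesh N * (k i)%:R + mesh N <= 2 * r.
  rewrite -[X in _ + X]mulr1 -mulrDr natr1.
  have <- : mesh N * N%:R = 2 * r by rewrite divfK// pnatr_eq0 -lt0n.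
  by rewrite ler_pM2l// ler_nat.
have k0 : 0 <= mesh N * (k i)%:R by rewrite mulr_ge0// ltW.
apply/andP; split; lra.
Qed.

(* The shift by one in direction i, taken cyclically, permutes the grid; where it
   wraps around, V vanishes at both ends. *)
Lemma grid_telescope N (V : 'rV[R]_m -> R) (i : 'I_m) : (0 < N)%N ->
  (forall u, cube x r u -> `|u 0 i - x 0 i| = r -> V u = 0) ->
  \sum_(k : {ffun 'I_m -> 'I_N})
    (V (gridpt k + mesh N *: delta_mx 0 i) - V (gridpt k)) = 0.
Proof.
move=> N0 V0; have e0 := mesh_gt0 N0.
pose s (k : {ffun 'I_m -> 'I_N}) : {ffun 'I_m -> 'I_N} :=
  [ffun j => if j == i then ordS (k j) else k j].
have s_inj : injective s.
  move=> k l /ffunP kl; apply/ffunP => j; have := kl j; rewrite !ffunE.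
  by case: eqP => // _ /ordS_inj.
rewrite sumrB [X in _ - X](reindex_inj s_inj) /= -sumrB big1// => k _.
have step0 j : 0 <= (mesh N *: delta_mx 0 i : 'rV[R]_m) 0 j <= mesh N.
  rewrite !mxE eqxx /=; case: eqP => _; rewrite ?mulr1 ?mulr0 lexx (ltW e0)//.
have cube1 := grid_cube k N0 step0.
have cube2 : cube x r (gridpt (s k)).
  rewrite -[gridpt _]addr0; apply: grid_cube => // j.
  by rewrite mxE lexx (ltW e0).
have [kN|kN] := ltnP (k i).+1 N.
  suff -> : gridpt (s k) = gridpt k + mesh N *: delta_mx 0 i by rewrite subrr.
  apply/rowP => j; rewrite !mxE ffunE eqxx /=.
  have [->|ji] := eqVneq j i; last by rewrite mulr0 addr0.
  by rewrite /= modn_small// -natr1 mulrDr !mulr1 addrA.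
have kE : (k i).+1 = N by apply/eqP; rewrite eqn_leq kN ltn_ord.
rewrite !V0 ?subrr//.
  rewrite !mxE ffunE eqxx /= kE modnn mulr0 addr0.
  by rewrite addrAC subrr sub0r normrN gtr0_norm.
have E : mesh N * (k i)%:R + mesh N = 2 * r.
  rewrite -[X in _ + X]mulr1 -mulrDr natr1 kE /mesh divfK// pnatr_eq0.
  by rewrite -lt0n.
rewrite !mxE !eqxx /= mulr1.
have -> : x 0 i - r + mesh N * (k i)%:R + mesh N - x 0 i = r.
  by rewrite -(addrA (x 0 i - r)) E; ring.
by rewrite gtr0_norm.
Qed.

End Grid.

(** In each direction i the mesh times the derivative of [V i] differs from the increment of [V i]
    across the cell by at most the mesh times d / C. The increments add up to zero by
    [grid_telescope], so only these errors remain. *)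
Lemma riemann_sum_flux m (x : 'rV[R]_m) (r : R) (W : set 'rV[R]_m)
    (V : 'I_m -> 'rV[R]_m -> R) (d : R) :
  0 < r -> 0 < d -> cube x r `<=` W -> (forall i, C1_on W (V i)) ->
  (forall i u, cube x r u -> `|u 0 i - x 0 i| = r -> V i u = 0) ->
  exists N0 : nat, forall N, (N0 < N)%N ->
    `|\sum_(k : {ffun 'I_m -> 'I_N})
       (\sum_i pd i (V i) (gridpt x r k)) * mesh r N ^+ m| <= d.
Proof.
move=> r0 d0 QW V1 V0.
(* Each of the m directions contributes an error of at most (2 r)^m d / C; the factor m + 1 keeps C
   positive for m = 0 too. *)
pose C : R := m.+1%:R * (2 * r) ^+ m.
have C0 : 0 < C by rewrite mulr_gt0 ?exprn_gt0 ?mulr_gt0.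
have uc i : exists2 t : R, 0 < t & forall u v, cube x r u ->
    `|v - u| <= t -> `|pd i (V i) v - pd i (V i) u| <= d / C.
  apply: compact_uniform; [exact: cube_compact| |by rewrite divr_gt0].
  by move=> u Qu; apply: (C1_on_pd_continuous (V1 i)); exact: QW.
(* A radius valid for all directions at once; the default value 1 of the minimum is harmless, as
   smaller radii also work. *)
pose eta := \big[Num.min/1]_i sval (cid2 (uc i)).
have eta0 : 0 < eta.
  rewrite /eta; apply: (big_ind (fun t => 0 < t)) => //.
    by move=> a b a0 b0; rewrite lt_min a0.
  by move=> i _; case: (cid2 _).
have etaP i u v : cube x r u -> `|v - u| <= eta ->
    `|pd i (V i) v - pd i (V i) u| <= d / C.
  move=> Qu vu; have := svalP (cid2 (uc i)).
  have : eta <= sval (cid2 (uc i)) by exact: bigmin_le.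
  case: (cid2 _) => t /= t0 tP et _; apply: tP => //.
  exact: le_trans vu et.
exists (Num.bound (2 * r / eta)) => N NN.
have N0 : (0 < N)%N by apply: leq_ltn_trans NN.
have e0 := mesh_gt0 r0 N0.
have e_eta : mesh r N <= eta.
  rewrite /mesh ler_pdivrMr ?ltr0n// -ler_pdivrMl// mulrC.
  have /ltW H : 2 * r / eta < (Num.bound (2 * r / eta))%:R.
    by apply: archi_boundP; rewrite divr_ge0 ?mulr_ge0 ?ltW.
  by rewrite (le_trans H)// ler_nat ltnW.
have step i (k : {ffun 'I_m -> 'I_N}) :
    `|mesh r N * pd i (V i) (gridpt x r k) -
      (V i (gridpt x r k + mesh r N *: delta_mx 0 i) - V i (gridpt x r k))|
    <= mesh r N * (d / C).
  have onseg t : 0 <= t <= mesh r N ->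
      cube x r (gridpt x r k + t *: delta_mx 0 i).
    move=> t0; apply: grid_cube => // j; rewrite !mxE eqxx /=.
    by case: eqP => _; rewrite ?mulr1 ?mulr0 ?lexx ?(ltW e0).
  have [|t te ->] := @MVT_pd01 R m (V i) i (gridpt x r k) (mesh r N) (ltW e0).
    move=> t te; have [_ /(_ i)[]//] := V1 i _ (QW _ (onseg t te)).
  rewrite -mulrBr normrM (gtr0_norm e0) ler_pM2l// distrC.
  apply: etaP; first by have := onseg 0; rewrite scale0r addr0; apply; rewrite lexx ltW.
  rewrite addrC addKr (le_trans (norm_delta _ _))//.
  by case/andP : te => t0 te; rewrite ger0_norm// (le_trans te).
have bound i : `|\sum_(k : {ffun 'I_m -> 'I_N}) pd i (V i) (gridpt x r k)|
    <= N%:R ^+ m * (d / C).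
  rewrite -(ler_pM2l e0) -[X in X * `|_|](gtr0_norm e0) -normrM mulr_sumr.
  have -> : \sum_(k : {ffun 'I_m -> 'I_N}) mesh r N * pd i (V i) (gridpt x r k) =
      \sum_(k : {ffun 'I_m -> 'I_N}) (mesh r N * pd i (V i) (gridpt x r k) -
      (V i (gridpt x r k + mesh r N *: delta_mx 0 i) - V i (gridpt x r k))).
    by rewrite sumrB (grid_telescope r0 N0 (V0 i)) subr0.
  rewrite (le_trans (ler_norm_sum _ _ _))//.
  rewrite (le_trans (ler_sum _ (fun k _ => step i k)))//.
  rewrite sumr_const card_ffun !card_ord -[leLHS]mulr_natl natrX.
  by rewrite mulrCA.
rewrite -mulr_suml normrM exchange_big (ger0_norm (exprn_ge0 _ (ltW e0))).
rewrite -ler_pdivlMr ?exprn_gt0//.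
rewrite (le_trans (ler_norm_sum _ _ _))//.
rewrite (le_trans (ler_sum _ (fun i _ => bound i)))//.
rewrite sumr_const card_ord -[leLHS]mulr_natl ler_pdivlMr ?exprn_gt0//.
have -> : m%:R * (N%:R ^+ m * (d / C)) * mesh r N ^+ m =
    m%:R * (d / C) * (N%:R * mesh r N) ^+ m.
  rewrite [in RHS]exprMn; move: (d / C) (N%:R ^+ m : R) (mesh r N ^+ m) => c a b; ring.
have -> : N%:R * mesh r N = 2 * r.
  by rewrite mulrC divfK// pnatr_eq0 -lt0n.
have -> : m%:R * (d / C) * (2 * r) ^+ m = d * (m%:R / m.+1%:R).
  have : (2 * r) ^+ m != 0 by rewrite expf_neq0// gt_eqF// mulr_gt0.
  rewrite /C; move: ((2 * r) ^+ m) => t t0; field.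
  by rewrite t0 nat1r pnatr_eq0.
by rewrite ler_piMr ?(ltW d0)// ler_pdivrMr// mul1r ler_nat.
Qed.

End Riemann_sums.

(** * Monotonicity of integrals *)

Section Integral_monotone.
Context {R : realType}.
Local Open Scope ereal_scope.

(* No measurability is needed: the integral of a nonnegative function is a
   supremum over the simple functions below it. *)
Lemma le_integral_nonmeas d (T : measurableType d) (mu : {measure set T -> \bar R})
    (f g : T -> \bar R) : (forall x, f x <= g x) ->
  \int[mu]_x f x <= \int[mu]_x g x.
Proof.
move=> fg; rewrite /integral; apply: leeB; apply: ereal_sup_le => _ [k kf <-].
  exists k => // x; apply: le_trans (kf x) _; rewrite !patch_setT.
  by rewrite !funeposE ge_max !le_max fg lexx orbT.
exists k => // x; apply: le_trans (kf x) _; rewrite !patch_setT.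
by rewrite !funenegE ge_max !le_max lexx orbT leeN2 fg.
Qed.

Lemma le_lebesgue_iint n (F G : 'rV[R]_n -> \bar R) :
  (forall u, F u <= G u) -> lebesgue_iint F <= lebesgue_iint G.
Proof.
elim: n F G => [F G FG|n IH F G FG] /=; first exact: FG.
by apply: le_integral_nonmeas => t; apply: IH => u; exact: FG.
Qed.

End Integral_monotone.

(** * Half-open cells and their Lebesgue measure *)

Section Cells.
Context {R : realType}.

(** Half-open, so that the cells of a grid are disjoint and still cover the open cube. *)
Definition cell n (c : 'rV[R]_n) (e : R) : set 'rV[R]_n :=
  [set u | forall i, c 0 i <= u 0 i < c 0 i + e].

Lemma cell_row_mx n (c : 'rV[R]_n.+1) (e t : R) (u : 'rV[R]_n) :
  cell c e (row_mx (const_mx t : 'rV[R]_1) u : 'rV[R]_(1 + n)) <->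
  (`[c 0 ord0, c 0 ord0 + e[%classic t /\ cell (\row_i c 0 (lift ord0 i)) e u).
Proof.
have E0 : (row_mx (const_mx t : 'rV[R]_1) u : 'rV[R]_(1 + n)) 0 ord0 = t.
  have -> : ord0 = lshift n (ord0 : 'I_1) by apply: val_inj.
  by rewrite row_mxEl mxE.
have ES (i : 'I_n) : (row_mx (const_mx t : 'rV[R]_1) u : 'rV[R]_(1 + n)) 0
    (lift ord0 i) = u 0 i.
  have -> : lift ord0 i = rshift 1 i by apply: val_inj.
  by rewrite row_mxEr.
split=> [cu|[ct cu] i].
  split; first by have := cu ord0; rewrite E0 /= in_itv.
  by move=> i; have := cu (lift ord0 i); rewrite ES mxE.
case: (unliftP ord0 i) => [j|] ->; last by rewrite E0; move: ct; rewrite /= in_itv.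
by rewrite ES; have := cu j; rewrite mxE.
Qed.

(** Induction on the dimension. The factor [a] stays arbitrary because the indicator of the first
    interval is absorbed into it. *)
Lemma lebesgue_iint_cell n (c : 'rV[R]_n) (a e : R) : 0 <= a -> 0 < e ->
  lebesgue_iint (fun u => (\1_(cell c e) u * a)%:E) = (a * e ^+ n)%:E.
Proof.
move=> a0 e0; elim: n c a a0 => [c a a0|n IH c a a0] /=.
  by rewrite indicE mem_set ?mul1r ?mulr1// => -[].
have inner (t : R) : lebesgue_iint (fun u : 'rV[R]_n =>
    (\1_(cell c e) (row_mx (const_mx t : 'rV[R]_1) u : 'rV[R]_(1 + n)) * a)%:E)
    = ((a * e ^+ n) * \1_(`[c 0 ord0, c 0 ord0 + e[%classic) t)%:E.
  have -> : (fun u : 'rV[R]_n =>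
      (\1_(cell c e) (row_mx (const_mx t : 'rV[R]_1) u : 'rV[R]_(1 + n)) * a)%:E) =
    (fun u => (\1_(cell (\row_i c 0 (lift ord0 i)) e) u *
       (\1_(`[c 0 ord0, c 0 ord0 + e[%classic) t * a))%:E).
    apply/funext => u; rewrite mulrA; congr (_ * a)%:E; rewrite !indicE.
    rewrite mulrC -natrM mulnb; congr (_%:R); congr nat_of_bool.
    apply/idP/andP => [|[]]; rewrite !inE.
      by move=> /cell_row_mx[].
    by move=> ? ?; apply/cell_row_mx.
  rewrite IH; last by rewrite mulr_ge0// indicE.
  by congr (_%:E); rewrite [RHS]mulrC mulrA.
under eq_integral do rewrite inner EFinM.
have ae0 : 0 <= a * e ^+ n by rewrite mulr_ge0// exprn_ge0// ltW.
rewrite ge0_integralZl_EFin//; last first.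
  by apply/measurable_EFinP; exact: measurable_indic.
rewrite integral_indic// setIT.
have L : lebesgue_measure `[c 0 ord0, c 0 ord0 + e[%classic = e%:E.
  rewrite lebesgue_measure_itv/= lte_fin ltrDl e0.
  by rewrite -EFinD addrAC subrr add0r.
by rewrite [X in (_ * X)%E]L -EFinM exprSr mulrA.
Qed.

End Cells.

(** * Volumes of coordinate cells *)

Section Volume.
Context {R : realType} {m : nat} {S : ptopologicalType}.
Context (Y : manifold R m S) (h : metric Y).
Context (sigma : {measure set (borel S) -> \bar R}) (hsigma : is_volume h sigma).

Lemma open_borel (A : set S) : open A -> measurable (A : set (borel S)).
Proof. by move=> oA; apply: sub_sigma_algebra. Qed.

Lemma continuous_borel (f : S -> R) : continuous f ->
  measurable_fun [set: borel S] (f : borel S -> R).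
Proof.
move=> fc; apply: (measurability (@RGenOInfty.G R)).
  exact: RGenOInfty.measurableE.
move=> _ [_ [x ->] <-]; rewrite setTI; apply: open_borel.
by apply: open_comp => [p _|]; [exact: fc|exact: interval_open].
Qed.

Definition pullback (a : Y) (A : set 'rV[R]_m) : set S :=
  dom a `&` coord a @^-1` A.

Lemma image_pullback (a : Y) A : A `<=` cod a -> coord a @` pullback a A = A.
Proof.
move=> Aa; apply/seteqP; split => [_ [p [_ Ap] <-]//|u Au].
by have [p ap pu] := Aa _ Au; exists p => //; split => //=; rewrite pu.
Qed.

Lemma open_pullback (a : Y) A : open A -> open (pullback a A).
Proof.
move=> oA; rewrite openE => p [ap Ap]; rewrite /interior.
apply: filterI; first exact: open_nbhs_nbhs (conj (open_dom a) ap).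
exact: coord_continuous ap _ (open_nbhs_nbhs (conj oA Ap)).
Qed.

(** A cell is a finite intersection of differences of open half-spaces, whose preimages in the chart
    domain are open. *)
Lemma measurable_pullback_cell (a : Y) c e :
  measurable (pullback a (cell c e) : set (borel S)).
Proof.
pose O (i : 'I_m) (t : R) : set S := pullback a [set u | u 0 i < t].
have mO i t : measurable (O i t : set (borel S)).
  apply: open_borel; apply: open_pullback.
  have ci : {in (fun u : 'rV[R]_m => u 0 i) @^-1` [set s | s < t],
      continuous (fun u : 'rV[R]_m => u 0 i)}.
    by move=> u _; exact: matrix_normedtype.coord_continuous.
  by apply: (open_comp ci); exact: open_lt.
have -> : pullback a (cell c e) =
    dom a `&` \bigcap_(i in [set: 'I_m]) (O i (c 0 i + e) `\` O i (c 0 i)).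
  apply/seteqP; split => [p [ap pc]|p [ap pc]]; split=> // i.
    move=> _; have /andP[ci ice] := pc i; split; first by split.
    by move=> [_ /=]; rewrite ltNge ci.
  have [[_ /= ice] nci] := pc i I; rewrite ice andbT leNgt; apply/negP => ci.
  by apply: nci; split.
apply: measurableI; first exact: open_borel (open_dom a).
apply: fin_bigcap_measurable => // i _; exact: measurableD.
Qed.

(** The iterated integral of the density is not evaluated but compared, by monotonicity, with those
    of two constants on the cell, which are explicit. *)
Lemma volume_cell (a : Y) c e (lo hi : R) : 0 < e -> 0 <= lo ->
  cell c e `<=` cod a ->
  (forall u, cell c e u -> lo <= Num.sqrt (\det (gram h a u)) <= hi) ->
  ((lo * e ^+ m)%:E <= sigma (pullback a (cell c e)) <= (hi * e ^+ m)%:E)%E.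
Proof.
move=> e0 lo0 ca lohi.
have sub : (pullback a (cell c e) : set (borel S)) `<=` dom a by move=> p [].
rewrite (hsigma (measurable_pullback_cell a c e) sub).
rewrite image_pullback//.
have [hi0|hi0] := leP 0 hi; last first.
  have cell0 : cell c e c by move=> i; rewrite lexx ltrDl.
  have /andP[lo1 hi1] := lohi _ cell0.
  by have := le_trans lo0 (le_trans lo1 hi1); rewrite leNgt hi0.
rewrite -!(lebesgue_iint_cell c)//; apply/andP; split.
  apply: le_lebesgue_iint => u; rewrite lee_fin indicE.
  by case: (boolP (u \in cell c e)); rewrite ?mul0r// !mul1r inE => /lohi/andP[].
apply: le_lebesgue_iint => u; rewrite lee_fin indicE.
by case: (boolP (u \in cell c e)); rewrite ?mul0r// !mul1r inE => /lohi/andP[].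
Qed.

End Volume.

(** * Subdivision of a cube into grid cells *)

Section Grid_cells.
Context {R : realType} {m : nat}.
Variables (x : 'rV[R]_m) (r : R) (N : nat).
Hypotheses (r0 : 0 < r) (N0 : (0 < N)%N).
Let e0 : 0 < mesh r N. Proof. exact: mesh_gt0. Qed.

Lemma grid_cell_sub (k : {ffun 'I_m -> 'I_N}) :
  cell (gridpt x r k) (mesh r N) `<=` cube x r.
Proof.
move=> u uk; have -> : u = gridpt x r k + (u - gridpt x r k) by rewrite addrC subrK.
apply: grid_cube => // i; have := uk i; rewrite !mxE => /andP[ku uke].
by rewrite subr_ge0 ku lerBlDl ltW.
Qed.

Lemma cell_norm (c u : 'rV[R]_m) (e : R) : 0 < e -> cell c e u -> `|u - c| <= e.
Proof.
move=> ee uc; apply/rV_norm_leP; first exact: ltW.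
move=> i; have := uc i; rewrite !mxE => /andP[cu uce].
by rewrite ger0_norm ?subr_ge0// lerBlDl ltW.
Qed.

Lemma grid_cell_inj (k l : {ffun 'I_m -> 'I_N}) u :
  cell (gridpt x r k) (mesh r N) u -> cell (gridpt x r l) (mesh r N) u -> k = l.
Proof.
have le_kl (k' l' : {ffun 'I_m -> 'I_N}) i :
    cell (gridpt x r k') (mesh r N) u -> cell (gridpt x r l') (mesh r N) u ->
    (k' i <= l' i)%N.
  move=> /(_ i) + /(_ i); rewrite !mxE => /andP[ku _] /andP[_ ul].
  have := le_lt_trans ku ul; rewrite -(addrA (x 0 i - r)) ltrD2l -[X in _ < _ + X]mulr1 -mulrDr.
  by rewrite ltr_pM2l// natr1 ltr_nat ltnS.
move=> uk ul; apply/ffunP => i; apply: val_inj; apply/eqP.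
by rewrite eqn_leq !le_kl.
Qed.

(** The index of the cell is the integer part of the rescaled coordinate; the strict bound on the
    norm keeps it below N. *)
Lemma grid_cell_cover u : `|u - x| < r ->
  exists k : {ffun 'I_m -> 'I_N}, cell (gridpt x r k) (mesh r N) u.
Proof.
move=> ux.
pose t i := (u 0 i - x 0 i + r) / mesh r N.
have ui i : `|u 0 i - x 0 i| < r.
  by apply: le_lt_trans ux; have := rV_norm_coord (u - x) i; rewrite !mxE.
have t0 i : 0 <= t i.
  rewrite divr_ge0 ?(ltW e0)//; have := ui i; rewrite ltr_norml; lra.
have tN i : (Num.truncn (t i) < N)%N.
  rewrite -(ltr_nat R); have /andP[tt _] := truncn_itv (t0 i).
  apply: le_lt_trans tt _; rewrite ltr_pdivrMr//.
  rewrite mulrC divfK ?pnatr_eq0 -?lt0n//.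
  have := ui i; rewrite ltr_norml; lra.
exists [ffun i => Ordinal (tN i)] => i; rewrite !mxE ffunE /=.
have /andP[t1 t2] := truncn_itv (t0 i).
have tE : u 0 i = x 0 i - r + mesh r N * t i.
  rewrite [mesh r N * _]mulrC divfK ?gt_eqF//; ring.
rewrite {1 2}tE lerD2l ler_pM2l// t1/= -(addrA (x 0 i - r)) ltrD2l.
by rewrite -[X in _ < _ + X]mulr1 -mulrDr ltr_pM2l// natr1.
Qed.

End Grid_cells.

(** The contribution of one cell: f and D are the values of the function and of the density at the
    corner, s is the volume of the cell and q its Euclidean volume. The bound d <= 1 makes the term
    in d^2 linear. *)
Lemma cell_estimate (R : realFieldType) (f d s D q Mf MD : R) :
  0 < q -> 0 < d -> d <= 1 -> `|f| <= Mf -> `|D| <= MD ->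
  `|s - D * q| <= d * q ->
  (f + d) * s <= f * D * q + (Mf + MD + 1) * d * q.
Proof.
move=> q0 d0 d1 fM DM sD.
have h1 : f * (s - D * q) <= Mf * (d * q).
  by rewrite (le_trans (ler_norm _))// normrM ler_pM.
have h2 : d * (s - D * q) <= d * (d * q).
  by rewrite ler_pM2l// (le_trans (ler_norm _)).
have h3 : d * q * d <= d * q * 1 by rewrite ler_pM2l// mulr_gt0.
have h4 : d * q * D <= d * q * MD.
  by rewrite ler_pM2l ?mulr_gt0// (le_trans (ler_norm _)).
lra.
Qed.

(** * Integrals of functions supported in a coordinate cube *)

Section Local_integral.
Context {R : realType} {m : nat} {S : ptopologicalType}.
Context (Y : manifold R m S) (h : metric Y).
Context (sigma : {measure set (borel S) -> \bar R}) (hsigma : is_volume h sigma).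

Lemma integrable_indic_fin (B : set (borel S)) :
  measurable B -> sigma B \is a fin_num ->
  sigma.-integrable setT (fun p => (\1_B p)%:E).
Proof.
move=> mB fB; apply/integrableP; split.
  by apply/measurable_EFinP; exact: measurable_indic.
under eq_integral do rewrite gee0_abs ?lee_fin//.
by rewrite integral_indic// setIT ltey_eq fB.
Qed.

Lemma integral_indic_sum (I : Type) (ks : seq I) (B : I -> set (borel S))
    (c : I -> R) :
  (forall k, measurable (B k)) -> (forall k, sigma (B k) \is a fin_num) ->
  (\int[sigma]_p (\sum_(k <- ks) c k * \1_(B k) p)%:E =
   (\sum_(k <- ks) c k * fine (sigma (B k)))%:E)%E.
Proof.
move=> mB fB.
have intB k := integrable_indic_fin (mB k) (fB k).
have intc k : sigma.-integrable setT (fun p => (c k)%:E * (\1_(B k) p)%:E)%E.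
  exact: integrableZl.
under eq_integral do rewrite -sumEFin.
under eq_integral do under eq_bigr do rewrite EFinM.
rewrite integral_sum// -sumEFin; apply: eq_bigr => k _.
by rewrite integralZl// integral_indic// setIT EFinM fineK.
Qed.

(* Applied to F and to - F, this gives that the integral vanishes. *)
Lemma integral_local_le0 (a : Y) (x : 'rV[R]_m) (r : R) (F : S -> R)
    (V : 'I_m -> 'rV[R]_m -> R) :
  0 < r -> cube x r `<=` cod a ->
  (forall p, F p != 0 -> dom a p /\ `|coord a p - x| < r) ->
  (forall u, cube x r u -> {for u, continuous (F \o param a)}) ->
  (forall u, cube x r u ->
    {for u, continuous (fun v => Num.sqrt (\det (gram h a v)))}) ->
  (forall i, C1_on (cod a) (V i)) ->
  (forall i u, cube x r u -> `|u 0 i - x 0 i| = r -> V i u = 0) ->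
  (forall u, cube x r u ->
    F (param a u) * Num.sqrt (\det (gram h a u)) = \sum_i pd i (V i) u) ->
  (\int[sigma]_p (F p)%:E <= 0)%E.
Proof.
move=> r0 Qa Fsupp Fc Dc V1 V0 FV.
pose f := F \o param a.
pose D (u : 'rV[R]_m) := Num.sqrt (\det (gram h a u)).
have D0 u : 0 <= D u by exact: sqrtr_ge0.
have [Mf Mf0 MfP] := compact_bound (@cube_compact R m x r) Fc.
have [MD MD0 MDP] := compact_bound (@cube_compact R m x r) Dc.
pose vol := (2 * r) ^+ m.
have vol0 : 0 < vol by rewrite exprn_gt0 ?mulr_gt0.
apply/lee_addgt0Pr => e e0; rewrite add0e.
pose C := vol * (Mf + MD + 1).
have C0 : 0 < C by rewrite mulr_gt0 ?ltr_wpDl ?addr_ge0.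
(* Half of e pays for the Riemann sum of the divergence, the other half for the cell errors of
   [cell_estimate], whose sum is C d. *)
pose d := Num.min 1 (e / 2 / C).
have d0 : 0 < d by rewrite lt_min ltr01 !divr_gt0.
have d1 : d <= 1 by rewrite ge_min lexx.
have dC : C * d <= e / 2.
  by rewrite mulrC -ler_pdivlMr// ge_min lexx orbT.
have [t1 t10 t1P] := compact_uniform (@cube_compact R m x r) Fc d0.
have [t2 t20 t2P] := compact_uniform (@cube_compact R m x r) Dc d0.
have e20 : 0 < e / 2 by rewrite divr_gt0.
have [N1 N1P] := riemann_sum_flux r0 e20 Qa V1 V0.
pose t := Num.min t1 t2.
have t0 : 0 < t by rewrite lt_min t10.
pose N := (maxn N1 (Num.bound (2 * r / t))).+1.
have N0 : (0 < N)%N by [].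
have N1N : (N1 < N)%N by rewrite ltnS leq_maxl.
have mesh0 := mesh_gt0 r0 N0.
have mesh_t : mesh r N <= t.
  rewrite /mesh ler_pdivrMr ?ltr0n// -ler_pdivrMl// mulrC.
  have /ltW H : 2 * r / t < (Num.bound (2 * r / t))%:R.
    by apply: archi_boundP; rewrite divr_ge0 ?mulr_ge0 ?ltW.
  by rewrite (le_trans H)// ler_nat (leq_trans (leq_maxr N1 _)).
pose c (k : {ffun 'I_m -> 'I_N}) := gridpt x r k.
pose B k : set (borel S) := pullback a (cell (c k) (mesh r N)).
have cellQ k : cell (c k) (mesh r N) `<=` cube x r by exact: grid_cell_sub.
have cQ k : cube x r (c k).
  by apply: (cellQ k) => i; rewrite lexx ltrDl.
have cell_near k u : cell (c k) (mesh r N) u -> `|u - c k| <= t.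
  by move=> uk; apply: le_trans mesh_t; exact: cell_norm.
have DP k u : cell (c k) (mesh r N) u -> `|D u - D (c k)| <= d.
  move=> uk; apply: t2P => //; apply: le_trans (cell_near _ _ uk) _.
  by rewrite ge_min lexx orbT.
have fP k u : cell (c k) (mesh r N) u -> `|f u - f (c k)| <= d.
  move=> uk; apply: t1P => //; apply: le_trans (cell_near _ _ uk) _.
  by rewrite ge_min lexx.
have mB k : measurable (B k) by exact: measurable_pullback_cell.
have sB k : exists2 s : R, sigma (B k) = s%:E &
    `|s - D (c k) * mesh r N ^+ m| <= d * mesh r N ^+ m.
  (* The lower bound is cut off at 0, since [volume_cell] asks for a nonnegative one. *)
  have := @volume_cell _ _ _ _ h sigma hsigma a (c k) (mesh r N)
    (Num.max 0 (D (c k) - d)) (D (c k) + d) mesh0.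
  rewrite le_max lexx => /(_ isT).
  have subc : cell (c k) (mesh r N) `<=` cod a by move=> u /cellQ /Qa.
  move=> /(_ subc).
  case/(_ _)/andP.
    move=> u uk; have := DP k u uk; rewrite ler_distl => /andP[Dl Du].
    by rewrite ge_max D0 Dl Du.
  rewrite -/(B k) => lo hi.
  have fin : sigma (B k) \is a fin_num.
    rewrite ge0_fin_numE ?measure_ge0//; exact: le_lt_trans hi (ltry _).
  exists (fine (sigma (B k))); first by rewrite fineK.
  move: lo hi; rewrite -(fineK fin) !lee_fin /= => lo hi.
  have eps0 : 0 < mesh r N ^+ m by rewrite exprn_gt0.
  rewrite ler_distl -mulrBl -mulrDl hi andbT (le_trans _ lo)//.
  by rewrite ler_pM2r// le_max lexx orbT.
pose s k := projT1 (cid2 (sB k)).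
have sE k : sigma (B k) = (s k)%:E by rewrite /s; case: (cid2 _).
have sP k : `|s k - D (c k) * mesh r N ^+ m| <= d * mesh r N ^+ m.
  by rewrite /s; case: (cid2 _).
(* F is dominated by a step function: on a cell by uniform continuity, and outside all cells because
   F is zero there, its nonzero values lying over the open cube. *)
apply: (@le_trans _ _ (\int[sigma]_p (\sum_k (f (c k) + d) * \1_(B k) p)%:E)%E).
  apply: le_integral_nonmeas => p; rewrite lee_fin.
  have [[k pk]|np] := pselect (exists k, B k p).
    rewrite (bigD1 k)//= big1 ?addr0.
      rewrite indicE mem_set// mulr1.
      case: pk => ap pk; have := fP k _ pk; rewrite /f /= coordK//.
      by rewrite ler_distl => /andP[].
    move=> l lk; rewrite indicE memNset ?mulr0// => pl.
    move: lk; rewrite (grid_cell_inj r0 N0 pl.2 pk.2) eqxx//.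
  rewrite big1; last first.
    by move=> k _; rewrite indicE memNset ?mulr0// => pk; apply: np; exists k.
  have [->//|/Fsupp [ap px]] := eqVneq (F p) 0.
  have [k pk] := grid_cell_cover r0 N0 px.
  by exfalso; apply: np; exists k; split.
have fB k : sigma (B k) \is a fin_num by rewrite sE.
rewrite (integral_indic_sum _ _ mB fB) lee_fin.
under eq_bigr do rewrite sE.
have step k : (f (c k) + d) * s k <=
    (\sum_i pd i (V i) (c k)) * mesh r N ^+ m
    + (Mf + MD + 1) * d * mesh r N ^+ m.
  rewrite -(FV _ (cQ k)).
  apply: cell_estimate (MfP _ (cQ k)) (MDP _ (cQ k)) (sP k) => //.
  by rewrite exprn_gt0.
apply: le_trans (ler_sum _ (fun k _ => step k)) _.
rewrite big_split [leRHS]splitr /=; apply: lerD.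
  exact: le_trans (ler_norm _) (N1P _ N1N).
rewrite sumr_const card_ffun !card_ord -[leLHS]mulr_natl natrX.
have -> : N%:R ^+ m * ((Mf + MD + 1) * d * mesh r N ^+ m) =
    (N%:R * mesh r N) ^+ m * ((Mf + MD + 1) * d).
  by rewrite [in RHS]exprMn mulrCA mulrC.
have -> : N%:R * mesh r N = 2 * r by rewrite mulrC divfK// pnatr_eq0.
by rewrite mulrA.
Qed.

End Local_integral.

(** * Functions on a manifold *)

Section Positive_definite.
Context {R : realType}.

Lemma for_continuous_prod (T : topologicalType) (I : Type) (r : seq I)
    (f : I -> T -> R) x :
  (forall i, {for x, continuous (f i)}) ->
  {for x, continuous (fun y => \prod_(i <- r) f i y)}.
Proof.
move=> fc; rewrite /prop_for /continuous_at.
apply: cvg_big; last by move=> i _; exact: fc.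
by move=> z; apply: for_continuousM; [exact: cvg_fst|exact: cvg_snd].
Qed.

(* The determinant has no zero along the segment from the identity to G. *)
Lemma posdef_det n (G : 'M[R]_n) :
  (forall v : 'rV[R]_n, v != 0 -> 0 < (v *m G *m v^T) 0 0) -> 0 < \det G.
Proof.
move=> Gpos.
pose A (t : R) : 'M[R]_n := (1 - t)%:M + t *: G.
pose f t := \det (A t).
have f_neq0 t : 0 <= t <= 1 -> f t != 0.
  move=> /andP[t0 t1]; apply/negP => /det0P[v v0 vA].
  have v2 : 0 < (v *m v^T) 0 0.
    have : 0 <= (v *m v^T) 0 0.
      by rewrite mxE sumr_ge0// => i _; rewrite mxE -expr2 sqr_ge0.
    rewrite le_eqVlt => /predU1P[/esym E|//]; exfalso; move/negP : v0; apply.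
    apply/eqP/rowP => i; rewrite mxE; apply/eqP; rewrite -sqrf_eq0.
    move: E; rewrite mxE => /eqP; rewrite psumr_eq0; last first.
      by move=> j _; rewrite mxE -expr2 sqr_ge0.
    by move=> /allP/(_ i (mem_index_enum _)); rewrite mxE -expr2.
  (* A kernel vector would make a combination of two positive numbers with weights 1 - t and t equal
     to zero. *)
  have : (v *m A t *m v^T) 0 0 = 0 by rewrite vA mul0mx mxE.
  rewrite mulmxDr mulmxDl mul_mx_scalar -scalemxAr -!scalemxAl mxE [X in X + _]mxE.
  rewrite [X in _ + X]mxE => /eqP; apply/negP; rewrite gt_eqF//.
  have := Gpos v v0; move: ((v *m G *m v^T) 0 0) ((v *m v^T) 0 0) v2 => g w w0 g0.
  have [->|tn0] := eqVneq t 0; first by rewrite subr0 mul1r mul0r addr0.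
  rewrite ltr_wpDl ?mulr_ge0 ?subr_ge0 ?(ltW w0)// mulr_gt0//.
  by rewrite lt_neqAle eq_sym tn0.
have fc : continuous f.
  move=> t; apply: for_continuous_sum => s _.
  apply: for_continuousM; first exact: for_continuous_cst.
  apply: for_continuous_prod => i.
  have -> : (fun t => A t i (s i)) = (fun t => (1 - t) *+ (i == s i) + t * G i (s i)).
    by apply/funext => u; rewrite !mxE.
  apply: for_continuousD; last first.
    by apply: for_continuousM; [exact: cvg_id|exact: for_continuous_cst].
  case: (i == s i); last exact: for_continuous_cst.
  apply: for_continuousD; first exact: for_continuous_cst.
  by apply: for_continuousN; exact: cvg_id.
have f0 : f 0 = 1 by rewrite /f /A subr0 scale0r addr0 det1.
have f1 : f 1 = \det G by rewrite /f /A subrr raddf0 add0r scale1r.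
rewrite -f1 ltNge; apply/negP => f1neg.
have [|c c01 fc0] := @IVT R f 0 1 0 ler01 (continuous_subspaceT fc).
  by rewrite f0 ge_min f1neg orbT le_max ler01.
by move: c01; rewrite in_itv /= => /f_neq0; rewrite fc0 eqxx.
Qed.

End Positive_definite.

(** * Locality and continuity of the differential operators *)

Section Congruence.
Context {R : realType} {n : nat}.
Variables (U : set 'rV[R]_n) (G : 'rV[R]_n -> 'M[R]_n) (u : 'rV[R]_n).
Hypotheses (oU : open U) (Uu : U u).

Lemma dif_eq_on (E E' : 'rV[R]_n -> R) : {in U, E =1 E'} -> dif E u = dif E' u.
Proof. by move=> EE; apply/rowP => i; rewrite !mxE; exact: pd_eq_on EE. Qed.

Lemma graddot_eq_on (E E' F F' : 'rV[R]_n -> R) :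
  {in U, E =1 E'} -> {in U, F =1 F'} -> graddot G E F u = graddot G E' F' u.
Proof. by move=> EE FF; rewrite /graddot (dif_eq_on EE) (dif_eq_on FF). Qed.

Lemma hessian_eq_on (F F' : 'rV[R]_n -> R) : {in U, F =1 F'} ->
  hessian G F u = hessian G F' u.
Proof.
move=> FF; have FF1 k : {in U, pd k F =1 pd k F'}.
  by move=> v /[!inE] Uv; exact: pd_eq_on FF.
apply/matrixP => i j; rewrite [LHS]mxE [RHS]mxE (pd_eq_on i oU Uu (FF1 j)).
by under eq_bigr => k _ do rewrite (FF1 k u (mem_set Uu)).
Qed.

Lemma laplacian_eq_on (F F' : 'rV[R]_n -> R) : {in U, F =1 F'} ->
  laplacian G F u = laplacian G F' u.
Proof. by move=> FF; rewrite /laplacian (hessian_eq_on FF). Qed.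

Hypotheses (G1 : mC1 U G) (Gunit : forall v, U v -> G v \in unitmx).

Lemma for_continuous_graddot (E F : 'rV[R]_n -> R) :
  C1_on U E -> C1_on U F -> {for u, continuous (graddot G E F)}.
Proof.
move=> E1 F1.
have -> : graddot G E F = (fun v => \sum_j (\sum_i pd i E v * invmx (G v) i j) * pd j F v).
  apply/funext => v; rewrite /graddot mxE; apply: eq_bigr => j _.
  by rewrite !mxE; congr (_ * _); apply: eq_bigr => i _; rewrite !mxE.
apply: for_continuous_sum => j _; apply: for_continuousM; last first.
  exact: (C1_on_pd_continuous F1 Uu).
apply: for_continuous_sum => i _; apply: for_continuousM.
  exact: (C1_on_pd_continuous E1 Uu).
exact: (C1_on_continuous (mC1_invmx oU G1 Gunit i j) Uu).
Qed.

Lemma for_continuous_christoffel k i j :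
  {for u, continuous (fun v => christoffel G v k i j)}.
Proof.
apply: for_continuousM; first exact: for_continuous_cst.
apply: for_continuous_sum => l _; apply: for_continuousM.
  exact: (C1_on_continuous (mC1_invmx oU G1 Gunit k l) Uu).
apply: for_continuousD; last apply: for_continuousN.
  by apply: for_continuousD; exact: (C1_on_pd_continuous (G1 _ _) Uu).
exact: (C1_on_pd_continuous (G1 _ _) Uu).
Qed.

Lemma for_continuous_laplacian (F : 'rV[R]_n -> R) :
  C2_on U F -> {for u, continuous (laplacian G F)}.
Proof.
move=> [F1 F2].
have -> : laplacian G F = (fun v => \sum_i \sum_j invmx (G v) i j *
    (pd j (pd i F) v - \sum_k christoffel G v k j i * pd k F v)).
  apply/funext => v; apply: eq_bigr => i _; rewrite mxE; apply: eq_bigr => j _.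
  by rewrite mxE.
apply: for_continuous_sum => i _; apply: for_continuous_sum => j _.
apply: for_continuousM.
  exact: (C1_on_continuous (mC1_invmx oU G1 Gunit i j) Uu).
apply: for_continuousD; first exact: (C1_on_pd_continuous (F2 i) Uu).
apply: for_continuousN; apply: for_continuous_sum => k _; apply: for_continuousM.
  exact: for_continuous_christoffel.
exact: (C1_on_pd_continuous F1 Uu).
Qed.

End Congruence.

(** * Chart independence of gradient products and Laplacians *)

Section Manifold_charts.
Context {R : realType} {m : nat} {S : topologicalType} (Y : manifold R m S).

Lemma smooth_C2 (U : set 'rV[R]_m) F : smooth_on U F -> C2_on U F.
Proof. by move=> F2; split => [|i]; [exact: (F2 [::])|exact: (F2 [:: i])]. Qed.

Definition C2_fun (F : S -> R) : Prop := forall a : Y, C2_on (cod a) (F \o param a).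

Lemma smooth_C2_fun F : smooth_fun Y F -> C2_fun F.
Proof. by move=> F2 a; exact: smooth_C2. Qed.

Lemma C2_C1_fun F : C2_fun F -> C1_fun Y F.
Proof. by move=> F2 a; have [] := F2 a. Qed.

Lemma cod_coord (a : Y) p : dom a p -> cod a (coord a p).
Proof. by exists p. Qed.

Lemma dom_param (a : Y) u : cod a u -> dom a (param a u).
Proof. by move=> [p ap <-]; rewrite coordK. Qed.

Lemma paramK (a : Y) u : cod a u -> coord a (param a u) = u.
Proof. by move=> [p ap <-]; rewrite coordK. Qed.

Lemma open_image_coord (a : Y) (O : set S) : open O -> O `<=` dom a ->
  open (coord a @` O).
Proof.
move=> oO Oa; rewrite openE => _ [p Op <-]; rewrite /interior.
have cu : cod a (coord a p) by apply: cod_coord; exact: Oa.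
have n1 : nbhs (coord a p) (cod a) by apply: open_nbhs_nbhs; split => //; exact: open_cod.
have n2 : nbhs (coord a p) (param a @^-1` O).
  apply: (param_continuous cu); apply: open_nbhs_nbhs; split => //.
  by rewrite coordK//; exact: Oa.
apply: filterS (filterI n1 n2) => v [cv Ov]; exists (param a v) => //.
exact: paramK.
Qed.

Definition overlap (a b : Y) : set 'rV[R]_m := coord a @` (dom a `&` dom b).

Lemma open_overlap a b : open (overlap a b).
Proof.
apply: open_image_coord => [|p []//]; apply: openI; exact: open_dom.
Qed.

Lemma overlap_transition a b u : overlap a b u -> cod b (transition a b u).
Proof. by move=> [p [ap bp] <-]; rewrite /transition /= coordK//; exact: cod_coord. Qed.

Lemma fun_transition (F : S -> R) a b :
  {in overlap a b, F \o param a =1 (F \o param b) \o transition a b}.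
Proof.
move=> u; rewrite inE => -[p [ap bp] <-].
by rewrite /transition /= coordK// coordK.
Qed.

Lemma transition_C2 a b k : C2_on (overlap a b) (fun v => transition a b v 0 k).
Proof. by apply: smooth_C2; exact: transition_smooth. Qed.

(** Meant for an [F] defined through [chart_at]: chart independence permits the chart chosen at p to
    be used on a whole neighbourhood of p. *)
Lemma continuous_charts (F : S -> R) (f : Y -> 'rV[R]_m -> R) :
  (forall (a : Y) p, dom a p -> F p = f a (coord a p)) ->
  (forall (a : Y) u, cod a u -> {for u, continuous (f a)}) -> continuous F.
Proof.
move=> Ff fc p; pose a := chart_at Y p; have ap : dom a p := chart_atP Y p.
apply: (for_continuous_near (f := f a \o coord a)).
  have na : nbhs p (dom a) by apply: open_nbhs_nbhs; split => //; exact: open_dom.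
  by apply: filterS na => q aq; rewrite (Ff a).
apply: continuous_comp; first exact: coord_continuous.
by apply: fc; exact: cod_coord.
Qed.

Lemma continuous_coord_fun (F : S -> R) (a : Y) u :
  continuous F -> cod a u -> {for u, continuous (F \o param a)}.
Proof.
by move=> Fc au; apply: continuous_comp; [exact: param_continuous|exact: Fc].
Qed.

Variable h : metric Y.

Lemma gram_mC1 a : mC1 (cod a) (gram h a).
Proof. by move=> i j; exact: (@gram_smooth _ _ _ _ h a i j [::]). Qed.

Lemma gram_det_gt0 a u : cod a u -> 0 < \det (gram h a u).
Proof. by move=> au; apply: posdef_det => v; exact: gram_posdef. Qed.

Lemma gram_unit a u : cod a u -> gram h a u \in unitmx.
Proof. by move=> au; rewrite unitmxE unitfE gt_eqF// gram_det_gt0. Qed.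

Lemma gram_transition a b u : overlap a b u -> gram h a u =
  jac (transition a b) u *m gram h b (transition a b u) *m (jac (transition a b) u)^T.
Proof.
move=> [p [ap bp] <-]; rewrite (gram_change h ap bp).
by rewrite /transition /= coordK.
Qed.

Lemma graddot_chart (E F : S -> R) (a b : Y) p : C1_fun Y E -> C2_fun F ->
  dom a p -> dom b p ->
  graddot (gram h a) (E \o param a) (F \o param a) (coord a p) =
  graddot (gram h b) (E \o param b) (F \o param b) (coord b p).
Proof.
move=> E1 F2 ap bp.
have Up : overlap a b (coord a p) by exists p.
have oU : open (overlap a b) by exact: open_overlap.
have oV : open (cod b) by exact: open_cod.
rewrite (graddot_eq_on _ oU Up (fun_transition E (b := b)) (fun_transition F (b := b))).
rewrite (graddot_change oU oV (@overlap_transition a b)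
  (@transition_C2 a b) (H := gram h a) (G := gram h b) _ _ (E1 b) (F2 b) Up).
- by rewrite /transition /= coordK.
- by move=> u [q [aq _] <-]; apply: gram_unit; exact: cod_coord.
- exact: gram_transition.
Qed.

Lemma laplacian_chart (F : S -> R) (a b : Y) p : C2_fun F -> dom a p -> dom b p ->
  laplacian (gram h a) (F \o param a) (coord a p) =
  laplacian (gram h b) (F \o param b) (coord b p).
Proof.
move=> F2 ap bp.
have Up : overlap a b (coord a p) by exists p.
have oU : open (overlap a b) by exact: open_overlap.
have oV : open (cod b) by exact: open_cod.
rewrite (laplacian_eq_on _ oU Up (fun_transition F (b := b))).
rewrite (laplacian_change oU oV (@overlap_transition a b)
  (@transition_C2 a b) (H := gram h a) (G := gram h b) _ _ _ _ _ (F2 b) Up).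
- by rewrite /transition /= coordK.
- exact: gram_mC1.
- by move=> u; exact: gram_sym.
- by move=> u; exact: gram_unit.
- by move=> u [q [aq _] <-]; apply: gram_unit; exact: cod_coord.
- exact: gram_transition.
Qed.

Definition graddot_at (E F : S -> R) p : R :=
  let a := chart_at Y p in
  graddot (gram h a) (E \o param a) (F \o param a) (coord a p).

Definition laplacian_at (F : S -> R) p : R :=
  let a := chart_at Y p in laplacian (gram h a) (F \o param a) (coord a p).

(** The divergence of E grad F. *)
Definition green_density (E F : S -> R) p : R :=
  graddot_at E F p + E p * laplacian_at F p.

Lemma green_density_chart E F (a : Y) p : C1_fun Y E -> C2_fun F -> dom a p ->
  green_density E F p =
    graddot (gram h a) (E \o param a) (F \o param a) (coord a p)
    + (E \o param a) (coord a p) * laplacian (gram h a) (F \o param a) (coord a p).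
Proof.
move=> E1 F2 ap; rewrite /green_density /graddot_at /laplacian_at.
rewrite (graddot_chart E1 F2 (chart_atP Y p) ap).
by rewrite (laplacian_chart F2 (chart_atP Y p) ap) /= coordK.
Qed.

Lemma continuous_graddot_at E F : C1_fun Y E -> C2_fun F ->
  continuous (graddot_at E F).
Proof.
move=> E1 F2; apply: (continuous_charts
  (f := fun a => graddot (gram h a) (E \o param a) (F \o param a))).
  by move=> a p ap; exact: graddot_chart (chart_atP Y p) ap.
move=> a u au; have oa : open (cod a) by exact: open_cod.
apply: (for_continuous_graddot oa au (@gram_mC1 a)).
- by move=> v; exact: gram_unit.
- exact: E1.
- exact: (F2 a).1.
Qed.

Lemma continuous_laplacian_at F : C2_fun F -> continuous (laplacian_at F).
Proof.
move=> F2; apply: (continuous_charts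
  (f := fun a => laplacian (gram h a) (F \o param a))).
  by move=> a p ap; exact: laplacian_chart (chart_atP Y p) ap.
move=> a u au; have oa : open (cod a) by exact: open_cod.
apply: (for_continuous_laplacian oa au (@gram_mC1 a)).
  by move=> v; exact: gram_unit.
exact: F2.
Qed.

Lemma C1_fun_continuous (F : S -> R) : C1_fun Y F -> continuous F.
Proof.
move=> F1; apply: (continuous_charts (f := fun a => F \o param a)).
  by move=> a p ap; rewrite /= coordK.
by move=> a u au; exact: (C1_on_continuous (F1 a) au).
Qed.

Lemma continuous_green_density E F : C1_fun Y E -> C2_fun F ->
  continuous (green_density E F).
Proof.
move=> E1 F2 p; apply: for_continuousD; first exact: continuous_graddot_at.
apply: for_continuousM; first exact: C1_fun_continuous.
exact: continuous_laplacian_at.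
Qed.

End Manifold_charts.

(** * Green's formula *)

Section C1_functions.
Context {R : realType} {m : nat} {S : topologicalType} (Y : manifold R m S).

Lemma C1_funM (E F : S -> R) :
  C1_fun Y E -> C1_fun Y F -> C1_fun Y (fun p => E p * F p).
Proof.
move=> E1 F1 a; have oa : open (cod a) by exact: open_cod.
exact: (C1_onM oa (E1 a) (F1 a)).
Qed.

Lemma C1_funV (E : S -> R) :
  C1_fun Y E -> (forall p, E p != 0) -> C1_fun Y (fun p => (E p)^-1).
Proof.
move=> E1 E0 a; have oa : open (cod a) by exact: open_cod.
by apply: (C1_onV oa (E1 a)) => u _; exact: E0.
Qed.

Lemma C1_fun_sum (I : Type) (ks : seq I) (E : I -> S -> R) :
  (forall k, C1_fun Y (E k)) -> C1_fun Y (fun p => \sum_(k <- ks) E k p).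
Proof.
move=> E1 a; have oa : open (cod a) by exact: open_cod.
exact: (C1_on_sum oa ks (P := xpredT) (fun k _ => E1 k a)).
Qed.

Variable h : metric Y.

(** Linearity in E: a partition of unity can act on E while F stays fixed. *)
Lemma green_density_sum (I : Type) (ks : seq I) (E : I -> S -> R) (F : S -> R) p :
  (forall k, C1_fun Y (E k)) ->
  green_density h (fun q => \sum_(k <- ks) E k q) F p =
  \sum_(k <- ks) green_density h (E k) F p.
Proof.
move=> E1; rewrite /green_density big_split /= mulr_suml; congr (_ + _).
set a := chart_at Y p; have oa : open (cod a) by exact: open_cod.
have cp : cod a (coord a p) by apply: cod_coord; exact: chart_atP.
rewrite /graddot_at -/a /graddot.
have -> : dif ((fun q => \sum_(k <- ks) E k q) \o param a) (coord a p) =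
    \sum_(k <- ks) dif (E k \o param a) (coord a p).
  apply/rowP => i; rewrite [LHS]mxE summxE.
  rewrite (pd_sum oa ks (P := xpredT) i (fun k _ => E1 k a) cp).
  by apply: eq_bigr => k _; rewrite mxE.
by rewrite !mulmx_suml summxE.
Qed.

(** Vanishing on a neighbourhood, and not just at p, is what removes the gradient term as well. *)
Lemma green_density_near0 (E F : S -> R) p :
  (\forall q \near p, E q = 0) -> green_density h E F p = 0.
Proof.
move=> E0; rewrite /green_density (nbhs_singleton E0) mul0r addr0.
set a := chart_at Y p; have ap : dom a p := chart_atP Y p.
have cp : cod a (coord a p) := cod_coord ap.
rewrite /graddot_at -/a /graddot.
suff -> : dif (E \o param a) (coord a p) = 0 by rewrite !mul0mx mxE.
apply/rowP => i; rewrite [LHS]mxE [RHS]mxE.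
rewrite (@pd_near _ _ _ (fun=> 0)) ?pd_cst//.
have pc : param a v @[v --> coord a p] --> p.
  by have := param_continuous cp; rewrite /prop_for /continuous_at coordK.
exact: (pc _ E0).
Qed.

Lemma C1_on_local n (U : set 'rV[R]_n) (F : 'rV[R]_n -> R) :
  (forall u, U u -> exists V : set 'rV[R]_n, V u /\ C1_on V F) -> C1_on U F.
Proof. by move=> H u /H [V [Vu F1]]; exact: F1. Qed.

End C1_functions.

(** * Bump functions *)

Section Bumps.
Context {R : realType}.

(** The squared positive part is C^1 but not C^2. This suffices for a cut-off, which enters the
    divergence of the flux through first derivatives only. *)
Definition sqr_plus (t : R) : R := Num.max 0 t ^+ 2.

Lemma is_derive_sqr_plus (t : R) : is_derive t 1 sqr_plus (2 * Num.max 0 t).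
Proof.
have [t0|t0|->] := ltgtP t 0.
- rewrite mulr0; apply: (@near_eq_is_derive _ _ _ (fun=> 0)).
    have : \forall s \near t, s < 0 by exact: lt_nbhsl.
    by apply: filterS => s s0; rewrite /sqr_plus max_l ?ltW// expr0n.
- apply: (@near_eq_is_derive R R^o R^o (fun s : R => s ^+ 2 : R^o)).
    have : \forall s \near t, 0 < s by exact: lt_nbhsr.
    by apply: filterS => s s0; rewrite /sqr_plus max_r ?ltW.
  apply: DeriveDef; first exact: exprn_derivable.
  by rewrite exp_derive /GRing.scale /= mulr1 expr1.
- rewrite mulr0.
  (* At 0 the difference quotient is bounded by |s|. *)
  have H : (fun e : R => e^-1 *: ((sqr_plus \o shift 0) (e *: (1 : R)) - sqr_plus 0))
      @ 0^' --> (0 : R).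
    apply/cvgrPdist_le => e e0; near=> s.
    rewrite sub0r normrN /= addr0 /sqr_plus maxxx expr0n subr0.
    rewrite [s%:A]mulr1 normrM normfV.
    have s0 : `|s| != 0 by rewrite normr_eq0; near: s; exact: nbhs_dnbhs_neq.
    have sp : `|Num.max 0 s| <= `|s|.
      by case: (leP 0 s) => //; rewrite normr0.
    rewrite normrX (@le_trans _ _ (`|s|^-1 * `|s| ^+ 2))//.
      by rewrite ler_wpM2l ?invr_ge0// lerXn2r// nnegrE.
    rewrite expr2 mulKf//; apply/ltW; near: s; exact: dnbhs0_lt.
  apply: DeriveDef; first by apply/cvg_ex; exists 0.
  exact: cvg_lim H.
Unshelve. all: by end_near. Qed.

Context {m : nat} (x : 'rV[R]_m) (r : R).

(** The sum of squares is differentiable where the maximum norm is not, and the Euclidean ball of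
    radius r lies in the cube of radius r. *)
Definition cutoff_arg (u : 'rV[R]_m) : R := r ^+ 2 - \sum_i (u 0 i - x 0 i) ^+ 2.

Definition cutoff (u : 'rV[R]_m) : R := sqr_plus (cutoff_arg u).

Lemma is_derive_coord n (i j : 'I_n) (v : 'rV[R]_n) :
  is_derive v (delta_mx 0 j) (fun u : 'rV[R]_n => u 0 i : R^o)
    ((delta_mx 0 j : 'rV[R]_n) 0 i).
Proof.
have did := @derivable_id _ _ v (delta_mx 0 j : 'rV[R]_n).
apply: DeriveDef; first by have /derivable_mxP := did; apply.
have := congr1 (fun A : 'rV[R]_n => A 0 i) (derive_mx did).
by rewrite derive_id [RHS]mxE.
Qed.

Lemma C1_on_coord n (U : set 'rV[R]_n) i : C1_on U (fun u => u 0 i).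
Proof.
move=> u _; split; first exact: matrix_normedtype.coord_continuous.
move=> j; split; first by have /@ex_derive := is_derive_coord i j u.
have -> : pd j (fun u : 'rV[R]_n => u 0 i) = fun=> (delta_mx 0 j : 'rV[R]_n) 0 i.
  by apply/funext => v; exact: (is_derive_pd (is_derive_coord i j v)).
exact: for_continuous_cst.
Qed.

Lemma C1_on_cutoff (U : set 'rV[R]_m) : open U -> C1_on U cutoff.
Proof.
move=> oU.
have c1 i : C1_on U (fun u => u 0 i - x 0 i).
  exact: (C1_onD oU (C1_on_coord i) (C1_on_cst oU (- x 0 i))).
have s1 : C1_on U (fun u => \sum_i (u 0 i - x 0 i) * (u 0 i - x 0 i)).
  by apply: (C1_on_sum oU) => i _; exact: (C1_onM oU (c1 i) (c1 i)).
have b1 : C1_on U cutoff_arg := C1_onD oU (C1_on_cst oU (r ^+ 2)) (C1_onN oU s1).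
apply: (@C1_on_comp1 _ _ _ oU cutoff_arg sqr_plus (fun t => 2 * Num.max 0 t) b1 _ _).1.
  by move=> u _; exact: is_derive_sqr_plus.
move=> u _; apply: for_continuousM; first exact: for_continuous_cst.
apply: (@continuous_max R R); [exact: for_continuous_cst|exact: cvg_id].
Qed.

Lemma cutoff_ge0 u : 0 <= cutoff u.
Proof. exact: sqr_ge0. Qed.

Lemma cutoff_supp u : 0 < r -> cutoff u != 0 -> `|u - x| < r.
Proof.
move=> r0; rewrite sqrf_eq0; have [b0|b0] := leP (cutoff_arg u) 0.
  by rewrite eqxx.
move=> _.
have ui i : `|(u - x) 0 i| < r.
  rewrite !mxE -(ltr_pXn2r (n := 2)) ?nnegrE ?(ltW r0)//.
  rewrite real_normK ?num_real//; apply: le_lt_trans (_ : _ <= \sum_i (u 0 i - x 0 i) ^+ 2) _.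
    by rewrite (bigD1 i)//= lerDl sumr_ge0// => j _; exact: sqr_ge0.
  by rewrite -subr_gt0.
have -> : `|u - x| = \big[Num.max/0]_ij `|(u - x) ij.1 ij.2| by exact: mx_normrE.
by apply: bigmax_lt => // -[a i] _ /=; rewrite ord1.
Qed.

Lemma cutoff_center : 0 < r -> 0 < cutoff x.
Proof.
move=> r0; have -> : cutoff x = (r ^+ 2) ^+ 2.
  rewrite /cutoff /cutoff_arg big1 ?subr0 /sqr_plus ?max_r ?exprn_ge0 ?ltW//.
  by move=> i _; rewrite subrr expr0n.
by rewrite !exprn_gt0.
Qed.

End Bumps.

(** * Green's formula in one chart *)

Section Green.
Context {R : realType} {m : nat} {S : ptopologicalType}.
Context (Y : manifold R m S) (h : metric Y).

(** The set is the image of a compact cube, hence closed because S is Hausdorff. Closedness in S,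
    rather than in [dom a], is what allows bumps to be extended by zero. *)
Lemma closed_pullback_cube (a : Y) x r : cube x r `<=` cod a ->
  closed (pullback a (cube x r)).
Proof.
move=> Qa; apply: compact_closed; first exact: manifold_hausdorff Y.
have -> : pullback a (cube x r) = param a @` cube x r.
  apply/seteqP; split => [p [ap px]|_ [u ux <-]].
    by exists (coord a p) => //; rewrite coordK.
  have au := Qa _ ux; split; first exact: dom_param.
  by rewrite /= paramK.
apply: continuous_compact; last exact: cube_compact.
apply: continuous_in_subspaceT => u; rewrite inE => /Qa au.
exact: param_continuous.
Qed.

Definition bump_at (a : Y) x r (p : S) : R :=
  if `[< dom a p >] then cutoff x r (coord a p) else 0.

Lemma bump_at_supp (a : Y) x r p : 0 < r -> bump_at a x r p != 0 ->
  pullback a (cube x r) p.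
Proof.
rewrite /bump_at => r0; case: asboolP => [ap|_]; last by rewrite eqxx.
by move=> /(cutoff_supp r0) px; split => //; exact: ltW.
Qed.

(** Seen in another chart b, points of [dom a] are handled by the transition map, and the other
    points have a neighbourhood missing the closed set that carries the bump. *)
Lemma bump_at_C1 (a : Y) x r : 0 < r -> cube x r `<=` cod a ->
  C1_fun Y (bump_at a x r).
Proof.
move=> r0 Qa b; apply: C1_on_local => u bu.
have [aq|naq] := pselect (dom a (param b u)).
  exists (overlap b a); split.
    by exists (param b u); [split => //; exact: dom_param|exact: paramK].
  have oU : open (overlap b a) by exact: open_overlap.
  have oV : open (cod a) by exact: open_cod.
  have T1 k : C1_on (overlap b a) (fun v => transition b a v 0 k).
    exact: (transition_C2 b a k).1.
  apply: (C1_on_eq oU _ (C1_on_comp oU oV (@overlap_transition _ _ _ _ b a) T1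
    (C1_on_cutoff x r oV))).
  move=> v; rewrite inE => -[q [bq aq'] <-].
  rewrite /bump_at /transition /= coordK//.
  by case: asboolP.
pose O : set S := dom b `&` ~` pullback a (cube x r).
have oO : open (coord b @` O).
  apply: open_image_coord => [|p []//].
  apply: openI; first exact: open_dom.
  by apply: closed_openC; exact: closed_pullback_cube.
exists (coord b @` O); split.
  by exists (param b u); [split; [exact: dom_param|move=> []]|exact: paramK].
apply: (C1_on_eq oO _ (C1_on_cst oO 0)) => v; rewrite inE => -[q [bq nq] <-].
rewrite /= coordK//; apply/esym/eqP; rewrite -[_ == _]negbK; apply/negP.
by move=> /(bump_at_supp r0).
Qed.

Context (sigma : {measure set (borel S) -> \bar R}) (hsigma : is_volume h sigma).

Lemma continuous_density (a : Y) u : cod a u ->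
  {for u, continuous (fun v => Num.sqrt (\det (gram h a v)))}.
Proof.
move=> au; have oa : open (cod a) by exact: open_cod.
have D1 : C1_on (cod a) (volume_density (gram h a)).
  exact: (C1_on_density oa (@gram_mC1 _ _ _ _ h a) (@gram_det_gt0 _ _ _ _ h a)).
exact: (C1_on_continuous D1 au).
Qed.

(** Doubling the radius leaves a collar between the support of E and the faces of the larger cube,
    so the flux vanishes on those faces. *)
Lemma integral_green_local (a : Y) x r (E F : S -> R) :
  0 < r -> cube x (2 * r) `<=` cod a -> C1_fun Y E -> C2_fun Y F ->
  (forall p, E p != 0 -> pullback a (cube x r) p) ->
  sigma.-integrable setT (fun p => (green_density h E F p)%:E) ->
  (\int[sigma]_p (green_density h E F p)%:E = 0)%E.
Proof.
move=> r0 Q2a E1 F2 Esupp Fint.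
have oa : open (cod a) by exact: open_cod.
have r20 : 0 < 2 * r by rewrite mulr_gt0.
have r_lt : r < 2 * r by rewrite mulrC ltr_pMr// ltr1n.
have Qa : cube x r `<=` cod a.
  by move=> u ux; apply: Q2a; apply: le_trans ux (ltW r_lt).
pose V := density_flux (gram h a) (E \o param a) (F \o param a).
have V1 i : C1_on (cod a) (V i).
  exact: (C1_on_flux oa (@gram_mC1 _ _ _ _ h a) (@gram_det_gt0 _ _ _ _ h a) i (E1 a) (F2 a)).
have Gsym u : cod a u -> (gram h a u)^T = gram h a u by exact: gram_sym.
have GV u : cod a u -> green_density h E F (param a u) *
    Num.sqrt (\det (gram h a u)) = \sum_i pd i (V i) u.
  move=> au.
  rewrite (divergence_flux oa (@gram_mC1 _ _ _ _ h a) Gsym (@gram_det_gt0 _ _ _ _ h a)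
    (E1 a) (F2 a) au).
  rewrite (green_density_chart h E1 F2 (dom_param au)) mulrC.
  by rewrite /volume_density /= coordK ?paramK//; exact: dom_param.
have supp p : green_density h E F p != 0 -> dom a p /\ `|coord a p - x| < 2 * r.
  move=> Fp; have [[ap px]|np] := pselect (pullback a (cube x r) p).
    by split => //; exact: le_lt_trans px r_lt.
  exfalso; move/negP : Fp; apply; apply/eqP; apply: green_density_near0.
  have : nbhs p (~` pullback a (cube x r)).
    apply: open_nbhs_nbhs; split => //; apply: closed_openC.
    exact: closed_pullback_cube.
  apply: filterS => q nq; apply/eqP; rewrite -[_ == _]negbK; apply/negP.
  by move=> /Esupp.
have V0 i u : cube x (2 * r) u -> `|u 0 i - x 0 i| = 2 * r -> V i u = 0.
  move=> ux ui; have au := Q2a _ ux.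
  suff E0 : E (param a u) = 0 by rewrite /V /density_flux /= E0 mul0r mulr0.
  apply/eqP; rewrite -[_ == _]negbK; apply/negP => /Esupp[_ /=].
  rewrite paramK// /cube /= => ur.
  have := rV_norm_coord (u - x) i; rewrite !mxE ui => ur2.
  by have := lt_le_trans r_lt (le_trans ur2 ur); rewrite ltxx.
have Fc u : cube x (2 * r) u ->
    {for u, continuous (green_density h E F \o param a)}.
  by move=> /Q2a; apply: continuous_coord_fun; exact: continuous_green_density.
have Dc u : cube x (2 * r) u ->
    {for u, continuous (fun v => Num.sqrt (\det (gram h a v)))}.
  by move=> /Q2a; exact: continuous_density.
have le0 : (\int[sigma]_p (green_density h E F p)%:E <= 0)%E.
  apply: (integral_local_le0 hsigma r20 Q2a supp Fc Dc V1 V0).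
  by move=> u /Q2a; exact: GV.
have ge0 : (\int[sigma]_p (- 1 * green_density h E F p)%:E <= 0)%E.
  apply: (@integral_local_le0 _ _ _ _ h sigma hsigma a x (2 * r) _
    (fun i u => - 1 * V i u) r20 Q2a).
  - by move=> p; rewrite mulN1r oppr_eq0; exact: supp.
  - move=> u ux; apply: (for_continuousM _ (Fc _ ux)); exact: for_continuous_cst.
  - exact: Dc.
  - by move=> i; exact: (C1_onZ oa _ (V1 i)).
  - by move=> i u ux ui; rewrite V0// mulr0.
  - move=> u /Q2a au; rewrite -mulrA GV// mulr_sumr; apply: eq_bigr => i _.
    by rewrite (pdZ oa _ _ (V1 i) au).
apply/eqP; rewrite eq_le le0 /=.
move: ge0; under eq_integral do rewrite EFinM.
by rewrite integralZl// EFinN mulN1e oppe_le0.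
Qed.

Hypothesis Scompact : compact [set: S].

Lemma chart_cube (p : S) : exists2 r : R, 0 < r &
  cube (coord (chart_at Y p) p) (2 * r) `<=` cod (chart_at Y p).
Proof.
set a := chart_at Y p; have ap : dom a p := chart_atP Y p.
have oa : open (cod a) by exact: open_cod.
have [r r0 rP] := rV_openP oa (cod_coord ap).
exists (r / 2); first by rewrite divr_gt0.
by rewrite mulrC divfK//; exact: rP.
Qed.

Definition chart_radius p : R := projT1 (cid2 (chart_cube p)).

Lemma chart_radius_gt0 p : 0 < chart_radius p.
Proof. by rewrite /chart_radius; case: (cid2 _). Qed.

Lemma chart_radiusP p :
  cube (coord (chart_at Y p) p) (2 * chart_radius p) `<=` cod (chart_at Y p).
Proof. by rewrite /chart_radius; case: (cid2 _). Qed.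

Lemma chart_radius_sub p :
  cube (coord (chart_at Y p) p) (chart_radius p) `<=` cod (chart_at Y p).
Proof.
move=> u up; apply: (chart_radiusP (p := p)); apply: le_trans up _.
by rewrite mulrC ler_pMr ?chart_radius_gt0// ler1n.
Qed.

Definition chart_bump p : S -> R :=
  bump_at (chart_at Y p) (coord (chart_at Y p) p) (chart_radius p).

Lemma chart_bump_C1 p : C1_fun Y (chart_bump p).
Proof. by apply: bump_at_C1; [exact: chart_radius_gt0|exact: chart_radius_sub]. Qed.

Lemma chart_bump_ge0 p q : 0 <= chart_bump p q.
Proof. by rewrite /chart_bump /bump_at; case: ifP => // _; exact: cutoff_ge0. Qed.

Lemma chart_bump_supp p q : chart_bump p q != 0 ->
  pullback (chart_at Y p) (cube (coord (chart_at Y p) p) (chart_radius p)) q.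
Proof. by apply: bump_at_supp; exact: chart_radius_gt0. Qed.

(** The sum of these bumps has no zero, so dividing by it yields a partition of unity. *)
Lemma finite_bumps : exists ps : seq S,
  forall q, exists2 p, p \in ps & 0 < chart_bump p q.
Proof.
have := Scompact; rewrite compact_cover => /(_ S setT (fun p => [set q | 0 < chart_bump p q])).
case.
- move=> p _; apply: (open_comp (f := chart_bump p) (D := [set t | 0 < t])).
    by move=> q _; exact: C1_fun_continuous (chart_bump_C1 p) q.
  exact: open_gt.
- move=> p _; exists p => //=; rewrite /chart_bump /bump_at.
  by rewrite asboolT ?cutoff_center ?chart_radius_gt0//; exact: chart_atP.
move=> D _ Dcover; exists (finmap.enum_fset D) => q.
by have [p pD qp] := Dcover q I; exists p.
Qed.

End Green.

(** * Green's formula on a closed manifold *)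

Section Global_green.
Context {R : realType} {m : nat} {S : ptopologicalType}.
Context (Y : manifold R m S) (h : metric Y).
Context (sigma : {measure set (borel S) -> \bar R}) (hsigma : is_volume h sigma).

(** Near p the density is at least half its value at p, so a small cell inside O already has
    positive volume. *)
Lemma volume_open_gt0 (O : set S) p : open O -> O p -> (0 < sigma O)%E.
Proof.
move=> oO Op; pose a := chart_at Y p; have ap : dom a p := chart_atP Y p.
pose x := coord a p; pose D v := Num.sqrt (\det (gram h a v)).
have ax : cod a x by exact: cod_coord.
have Dx : 0 < D x by rewrite sqrtr_gt0; exact: gram_det_gt0.
pose W := coord a @` (O `&` dom a).
have oW : open W.
  apply: open_image_coord => [|q []//]; apply: openI => //; exact: open_dom.
have [r1 r10 r1P] : exists2 r : R, 0 < r & forall v, `|v - x| <= r -> W v.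
  by apply: rV_openP => //; exists p.
have /cvgrPdist_le /(_ (D x / 2)) := @continuous_density _ _ _ _ h a x ax.
rewrite divr_gt0// => /(_ isT) nD; have [r2 r20 r2P] := (rV_nbhsP _ _).1 nD.
pose r := Num.min r1 r2; have r0 : 0 < r by rewrite lt_min r10.
have near_x u : cell x r u -> `|u - x| <= r1 /\ `|u - x| <= r2.
  move=> /(cell_norm r0) ux; split; apply: le_trans ux _.
    by rewrite ge_min lexx.
  by rewrite ge_min lexx orbT.
have Wc : W `<=` cod a by move=> u [q [_ aq] <-]; exact: cod_coord.
have cellW : cell x r `<=` W by move=> u /near_x[/r1P].
have lohi u : cell x r u -> D x / 2 <= D u <= D x + D x / 2.
  move=> /near_x[_ /r2P] /=; rewrite ler_distl => /andP[]; rewrite -/(D x) -/(D u).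
  by move=> ? ?; apply/andP; split; lra.
have lo0 : 0 <= D x / 2 by rewrite divr_ge0// ltW.
have /andP[lo _] := volume_cell hsigma r0 lo0 (subset_trans cellW Wc) lohi.
apply: lt_le_trans (_ : sigma (pullback a (cell x r)) <= _)%E.
  by apply: lt_le_trans lo; rewrite lte_fin mulr_gt0 ?exprn_gt0 ?divr_gt0.
apply: le_measure; rewrite ?inE.
- exact: measurable_pullback_cell.
- exact: open_borel.
- move=> q [aq /cellW [q' [Oq' aq'] E]].
  by rewrite -[q](coordK aq) -E coordK.
Qed.

Hypothesis Scompact : compact [set: S].

Lemma volume_finite : (sigma setT < +oo)%E.
Proof.
have [ps psP] := finite_bumps Y Scompact.
pose x p : 'rV[R]_m := coord (chart_at Y p) p.
(* With r the chart radius, the cell runs from x - r to x + 2 r in each coordinate. The excess on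
   the right makes the half-open cell contain the closed cube of radius r that carries the bump, and
   the cell stays within the cube of radius 2 r. *)
pose c p : 'rV[R]_m := \row_i (x p 0 i - chart_radius Y p).
pose B p : set (borel S) :=
  pullback (chart_at Y p) (cell (c p) (3 * chart_radius Y p)).
have r0 p := chart_radius_gt0 Y p.
have e0 p : 0 < 3 * chart_radius Y p by rewrite mulr_gt0.
have cell_sub p : cell (c p) (3 * chart_radius Y p) `<=`
    cube (x p) (2 * chart_radius Y p).
  move=> u uc; apply/rV_norm_leP; first by rewrite mulr_ge0// ltW.
  move=> i; have := uc i; have := r0 p; rewrite !mxE ler_norml => rp /andP[ui1 ui2].
  by apply/andP; split; lra.
have mB p : measurable (B p) by exact: measurable_pullback_cell.
have fB p : sigma (B p) \is a fin_num.
  have [M M0 MP] := compact_bound (@cube_compact R m (x p) (2 * chart_radius Y p))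
    (fun u up => @continuous_density _ _ _ _ h _ _ (chart_radiusP up)).
  have lohi u : cell (c p) (3 * chart_radius Y p) u ->
      0 <= Num.sqrt (\det (gram h (chart_at Y p) u)) <= M.
    move=> /cell_sub /MP Hu; rewrite sqrtr_ge0 /=.
    exact: le_trans (ler_norm _) Hu.
  have sub := subset_trans (cell_sub p) (@chart_radiusP _ _ _ Y p).
  have /andP[_ hi] := volume_cell hsigma (e0 p) (lexx 0) sub lohi.
  by rewrite ge0_fin_numE ?measure_ge0//; exact: le_lt_trans hi (ltry _).
have := @le_integral_nonmeas _ _ _ sigma (fun=> 1%:E)
  (fun q => (\sum_(p <- ps) 1 * \1_(B p) q)%:E).
rewrite integral_indic_sum// integral_cst// mul1e => H.
apply: le_lt_trans (H _) (ltry _) => q; rewrite lee_fin.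
have [p pps pq] := psP q.
have Bq : B p q.
  have [aq qp] := chart_bump_supp (lt0r_neq0 pq).
  split => // i; have := le_trans (rV_norm_coord _ i) qp.
  have := r0 p; rewrite !mxE ler_norml /x => rp /andP[? ?].
  by apply/andP; split; lra.
rewrite (big_rem p)//= indicE mem_set// mulr1 lerDl sumr_ge0// => k _.
Qed.

Lemma integrable_continuous (F : S -> R) : continuous F ->
  sigma.-integrable setT (fun p => (F p)%:E).
Proof.
move=> Fc; apply: (@measurable_bounded_integrable _ (borel S) R sigma F setT) => //.
- exact: volume_finite.
- exact: continuous_borel.
- have [M M0 MP] := compact_bound Scompact (fun p _ => Fc p).
  exists M; split; first exact: num_real.
  by move=> t Mt p _ /=; apply: le_trans (MP p I) (ltW Mt).
Qed.

(** Only the first argument of the density is decomposed; each piece is F times a normalized bump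
    and falls under [integral_green_local]. *)
Lemma integral_green (F : S -> R) : C2_fun Y F ->
  (\int[sigma]_p (green_density h F F p)%:E = 0)%E.
Proof.
move=> F2; have [ps psP] := finite_bumps Y Scompact.
have F1 := C2_C1_fun F2.
pose B q := \sum_(p <- ps) chart_bump Y p q.
have B0 q : B q != 0.
  have [p pps pq] := psP q; rewrite gt_eqF// /B (big_rem p)//=.
  by rewrite ltr_wpDr// sumr_ge0// => k _; exact: chart_bump_ge0.
have B1 : C1_fun Y B by apply: C1_fun_sum => p; exact: chart_bump_C1.
pose E p q := F q * (chart_bump Y p q * (B q)^-1).
have E1 p : C1_fun Y (E p).
  have b1 : C1_fun Y (chart_bump Y p) by exact: chart_bump_C1.
  have v1 : C1_fun Y (fun q => (B q)^-1) by exact: C1_funV.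
  have bv1 := C1_funM b1 v1.
  exact: (C1_funM F1 bv1).
have FE : F = fun q => \sum_(p <- ps) E p q.
  by apply/funext => q; rewrite -mulr_sumr -mulr_suml -/(B q) mulfV// mulr1.
have int0 p : (\int[sigma]_q (green_density h (E p) F q)%:E = 0)%E.
  apply: (integral_green_local hsigma (chart_radius_gt0 Y p)
    (@chart_radiusP _ _ _ Y p) (E1 p) F2).
    move=> q Eq; apply: chart_bump_supp; apply: contraNN Eq => /eqP Eq.
    by rewrite /E Eq mul0r mulr0.
  by apply: integrable_continuous; exact: continuous_green_density.
under eq_integral do rewrite {1}FE green_density_sum// -sumEFin.
rewrite integral_sum//; last first.
  by move=> p; apply: integrable_continuous; exact: continuous_green_density.
by rewrite big1.
Qed.

End Global_green.

(** * The second fundamental form *)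

Section Cholesky.
Context {R : realType}.

(** Symmetric elimination: [E] clears the first row and column, leaving the pivot [a] and the Schur
    complement [S], to which the induction hypothesis applies. *)
Lemma posdef_frame n (H : 'M[R]_n) : H^T = H ->
  (forall v : 'rV[R]_n, v != 0 -> 0 < (v *m H *m v^T) 0 0) ->
  exists2 C : 'M[R]_n, C \in unitmx & C *m H *m C^T = 1%:M.
Proof.
elim: n H => [H _ _|n IH H Hsym Hpos].
  by exists 1%:M; [exact: unitmx1|apply/matrixP => -[]].
pose H' : 'M[R]_(1 + n) := H.
pose a := H' 0 0.
pose b : 'M[R]_(1, n) := ursubmx H'.
pose D : 'M[R]_n := drsubmx H'.
have HE : H' = block_mx a%:M b b^T D.
  rewrite -[LHS]submxK; congr block_mx.
    rewrite [LHS]mx11_scalar; congr (_%:M); rewrite !mxE /a.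
    by congr (H' _ _); apply: val_inj.
  by rewrite /b trmx_ursub; congr dlsubmx; rewrite [RHS]Hsym.
have a0 : 0 < a.
  have d0 : (delta_mx 0 0 : 'rV[R]_n.+1) != 0.
    apply/negP => /eqP/rowP/(_ 0); rewrite !mxE !eqxx => /eqP.
    by rewrite oner_eq0.
  by have := Hpos _ d0; rewrite -rowE trmx_delta -colE !mxE.
have an0 : a != 0 by rewrite gt_eqF.
pose E : 'M[R]_(1 + n) := block_mx 1%:M 0 (- (a^-1 *: b^T)) 1%:M.
pose S := D - a^-1 *: (b^T *m b).
have EHE : E *m H' *m E^T = block_mx a%:M 0 0 S.
  have EH : E *m H' = block_mx a%:M b 0 S.
    rewrite HE mulmx_block !mul1mx !mul0mx !addr0; congr block_mx.
      by rewrite mulNmx -scalemxAl mul_mx_scalar scalerA mulVf// scale1r addNr.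
    by rewrite mulNmx -scalemxAl addrC.
  have ET : E^T = block_mx 1%:M (- (a^-1 *: b)) 0 1%:M.
    by rewrite tr_block_mx !trmx1 trmx0 linearN linearZ /= trmxK.
  rewrite EH ET mulmx_block !mulmx1 !mulmx0 !mul0mx !addr0 !add0r; congr block_mx.
  by rewrite mul_scalar_mx scalerN scalerA mulfV// scale1r addNr.
have Eu : E \in unitmx by rewrite unitmxE det_lblock !det1 mulr1 unitr1.
have Dsym : D^T = D by rewrite /D trmx_drsub; congr drsubmx; exact: Hsym.
have Ssym : S^T = S.
  by rewrite linearB linearZ /= trmx_mul trmxK Dsym.
(* The value of S at v is the value of H at the nonzero vector (0, v) E. *)
have Spos (v : 'rV[R]_n) : v != 0 -> 0 < (v *m S *m v^T) 0 0.
  move=> v0; pose z : 'rV[R]_(1 + n) := row_mx 0 v.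
  have zE0 : z *m E != 0.
    apply/negP => /eqP zE; move/negP : v0; apply; apply/eqP.
    have : z = 0 by rewrite -[z](mulmxK Eu) zE mul0mx.
    by rewrite -[0]row_mx0 => /eq_row_mx[].
  have := Hpos _ zE0.
  have -> : z *m E *m H *m (z *m E)^T = z *m (E *m H' *m E^T) *m z^T.
    by rewrite trmx_mul !mulmxA.
  rewrite EHE tr_row_mx mul_row_block mul_row_col !mul0mx !mulmx0 !add0r.
  by rewrite trmx0 mulmx0 add0r.
have [C' C'u C'S] := IH S Ssym Spos.
pose s := Num.sqrt a.
have s0 : 0 < s by rewrite sqrtr_gt0.
pose K : 'M[R]_(1 + n) := block_mx (s^-1)%:M 0 0 C'.
have Ku : K \in unitmx.
  rewrite unitmxE det_lblock det_scalar1 unitrM -unitmxE C'u andbT.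
  by rewrite unitfE invr_eq0 gt_eqF.
exists (K *m E); first by rewrite unitmx_mul Ku.
have -> : K *m E *m H *m (K *m E)^T = K *m (E *m H' *m E^T) *m K^T.
  by rewrite trmx_mul !mulmxA.
rewrite EHE /K tr_block_mx !mulmx_block !(mul0mx, mulmx0, addr0, add0r, trmx0) C'S.
rewrite tr_scalar_mx -!scalar_mxM -[a](sqr_sqrtr (ltW a0)) -/s expr2.
by rewrite mulKf ?gt_eqF// mulfV ?gt_eqF// -scalar_mx_block.
Qed.

Variables (n : nat) (H : 'M[R]_n).
Hypotheses (Hsym : H^T = H).
Hypothesis Hpos : forall v : 'rV[R]_n, v != 0 -> 0 < (v *m H *m v^T) 0 0.

Lemma invmx_posdef_frame :
  exists2 C : 'M[R]_n, C \in unitmx & invmx H = C^T *m C.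
Proof.
have [C Cu CH] := posdef_frame Hsym Hpos; exists C => //.
have E : C *m (H *m C^T) = 1%:M by rewrite mulmxA.
have {}E : H *m (C^T *m C) = 1%:M by have := mulmx1C E; rewrite mulmxA.
have Hu : H \in unitmx by case/mulmx1_unit : E.
by rewrite -[RHS]mul1mx -(mulVmx Hu) -mulmxA E mulmx1.
Qed.

Lemma mx_norm2_ge0 p q (A : 'M[R]_(p, q)) : 0 <= \tr (A *m A^T).
Proof.
apply: sumr_ge0 => i _; rewrite mxE; apply: sumr_ge0 => j _.
by rewrite mxE -expr2 sqr_ge0.
Qed.

Lemma mx_norm2_eq0 p q (A : 'M[R]_(p, q)) : \tr (A *m A^T) = 0 -> A = 0.
Proof.
move=> /eqP; rewrite psumr_eq0 => [/allP A0|i _]; last first.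
  by rewrite mxE sumr_ge0// => j _; rewrite mxE -expr2 sqr_ge0.
apply/matrixP => i j; have := A0 i (mem_index_enum _).
rewrite mxE psumr_eq0 => [/allP/(_ j (mem_index_enum _))|k _]; last first.
  by rewrite mxE -expr2 sqr_ge0.
by rewrite !mxE -expr2 sqrf_eq0 => /eqP.
Qed.

(** In the orthonormal frame given by the rows of C, the trace is the sum of the squared entries of
    C A C^T; [?= iff] carries the equality case along. *)
Lemma form_norm2_ge0 (A : 'M[R]_n) :
  0 <= \tr (invmx H *m A *m invmx H *m A^T) ?= iff (A == 0).
Proof.
have [C Cu ->] := invmx_posdef_frame.
have -> : \tr (C^T *m C *m A *m (C^T *m C) *m A^T) =
    \tr ((C *m A *m C^T) *m (C *m A *m C^T)^T).
  rewrite !trmx_mul trmxK -!mulmxA mxtrace_mulC; congr (\tr _).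
  by rewrite -!mulmxA.
split; first exact: mx_norm2_ge0.
apply/eqP/eqP => [/esym/mx_norm2_eq0 A0|->]; last first.
  by rewrite mulmx0 mul0mx mul0mx mxtrace0.
have CTu : C^T \in unitmx by rewrite unitmx_tr.
by rewrite -[A](mulKmx Cu) -[C *m A](mulmxK CTu) A0 mul0mx mulmx0.
Qed.

Lemma covector_norm2_ge0 (v : 'rV[R]_n) : 0 <= (v *m invmx H *m v^T) 0 0.
Proof.
have [C Cu ->] := invmx_posdef_frame.
have -> : v *m (C^T *m C) *m v^T = (v *m C^T) *m (v *m C^T)^T.
  by rewrite trmx_mul trmxK !mulmxA.
by rewrite -trace_mx11 mx_norm2_ge0.
Qed.

End Cholesky.

(** * The second fundamental form under changes of charts *)

Section Change_of_charts.
Context {R : realType}.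

Lemma pd_coord n (i j : 'I_n) (u : 'rV[R]_n) :
  pd j (fun v : 'rV[R]_n => v 0 i) u = (delta_mx 0 j : 'rV[R]_n) 0 i.
Proof. exact: is_derive_pd (is_derive_coord i j u). Qed.

(** A function with prescribed constant differential [w]; taking N for [w] gives a test function
    with nonzero normal derivative. *)
Definition linear_fun n (w y : 'rV[R]_n) : R := \sum_k w 0 k * y 0 k.

Lemma pd_linear_fun n (w y : 'rV[R]_n) i : pd i (linear_fun w) y = w 0 i.
Proof.
have oT : open [set: 'rV[R]_n] by exact: openT.
have c1 k := C1_on_coord (U := [set: 'rV[R]_n]) k.
rewrite (pd_sum oT _ i (fun k _ => C1_onZ oT (w 0 k) (c1 k))) //.
rewrite (bigD1 i)//= big1 ?addr0.
  by rewrite (pdZ oT _ _ (c1 i))// pd_coord mxE !eqxx mulr1.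
move=> k ki; rewrite (pdZ oT _ _ (c1 k))// pd_coord mxE eqxx /=.
by rewrite (negPf ki) mulr0.
Qed.

Lemma C2_on_linear_fun n (U : set 'rV[R]_n) (w : 'rV[R]_n) : open U ->
  C2_on U (linear_fun w).
Proof.
move=> oU; split=> [|i].
  by apply: (C1_on_sum oU) => k _; apply: (C1_onZ oU); exact: C1_on_coord.
have -> : pd i (linear_fun w) = fun=> w 0 i.
  by apply/funext => y; exact: pd_linear_fun.
exact: C1_on_cst.
Qed.

Lemma dif_linear_fun n (w y : 'rV[R]_n) : dif (linear_fun w) y = w.
Proof. by apply/rowP => i; rewrite mxE pd_linear_fun. Qed.

Lemma jac_comp m n p (U : set 'rV[R]_m) (V : set 'rV[R]_n)
    (T : 'rV[R]_m -> 'rV[R]_n) (T' : 'rV[R]_n -> 'rV[R]_p) u :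
  open U -> open V -> (forall v, U v -> V (T v)) ->
  (forall k, C1_on U (fun v => T v 0 k)) -> (forall k, C1_on V (fun v => T' v 0 k)) ->
  U u -> jac (T' \o T) u = jac T u *m jac T' (T u).
Proof.
move=> oU oV TUV T1 T'1 Uu; apply/matrixP => i k; rewrite [LHS]mxE [RHS]mxE.
rewrite (pd_comp oU oV TUV T1 i (T'1 k) Uu).
by apply: eq_bigr => j _; rewrite !mxE.
Qed.

Lemma jac_eq_on m n (U : set 'rV[R]_m) (T T' : 'rV[R]_m -> 'rV[R]_n) u :
  open U -> U u -> {in U, T =1 T'} -> jac T u = jac T' u.
Proof.
move=> oU Uu TT; apply/matrixP => i k; rewrite [LHS]mxE [RHS]mxE.
by apply: (pd_eq_on i oU Uu) => v Uv; rewrite TT.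
Qed.

Variables (m : nat) (U U' : set 'rV[R]_m) (V V' : set 'rV[R]_m.+1).
Variables (tau : 'rV[R]_m -> 'rV[R]_m) (sig : 'rV[R]_m.+1 -> 'rV[R]_m.+1).
Variables (T T' : 'rV[R]_m -> 'rV[R]_m.+1).
Hypotheses (oU : open U) (oU' : open U') (oV : open V) (oV' : open V').
Hypotheses (tauU : forall u, U u -> U' (tau u)) (TU' : forall u, U' u -> V' (T' u)).
Hypotheses (sigV : forall y, V' y -> V (sig y)) (TU : forall u, U u -> V (T u)).
Hypothesis TE : {in U, T =1 sig \o T' \o tau}.
Hypothesis tau2 : forall k, C2_on U (fun v => tau v 0 k).
Hypothesis sig2 : forall k, C2_on V' (fun v => sig v 0 k).
Hypothesis T2 : forall k, C2_on U (fun v => T v 0 k).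
Hypothesis T'2 : forall k, C2_on U' (fun v => T' v 0 k).
Variables (G G' : 'rV[R]_m.+1 -> 'M[R]_m.+1) (H H' : 'rV[R]_m -> 'M[R]_m).
Hypotheses (G1 : mC1 V G) (G'1 : mC1 V' G') (H'1 : mC1 U' H').
Hypotheses (Gsym : forall y, V y -> (G y)^T = G y).
Hypotheses (G'sym : forall y, V' y -> (G' y)^T = G' y).
Hypotheses (H'sym : forall y, U' y -> (H' y)^T = H' y).
Hypotheses (Gunit : forall y, V y -> G y \in unitmx).
Hypotheses (G'unit : forall y, V' y -> G' y \in unitmx).
Hypotheses (Hunit : forall u, U u -> H u \in unitmx).
Hypotheses (H'unit : forall u, U' u -> H' u \in unitmx).
Hypothesis GE : forall y, V' y -> G' y = jac sig y *m G (sig y) *m (jac sig y)^T.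
Hypothesis HE : forall u, U u -> H u = jac tau u *m H' (tau u) *m (jac tau u)^T.
Hypothesis HTE : forall u, U u -> H u = jac T u *m G (T u) *m (jac T u)^T.
Hypothesis H'TE : forall u, U' u -> H' u = jac T' u *m G' (T' u) *m (jac T' u)^T.
Variables (N N' : 'rV[R]_m.+1) (u : 'rV[R]_m).
Hypothesis Uu : U u.
Hypotheses (JN : jac T u *m G (T u) *m N^T = 0) (NN : N *m G (T u) *m N^T = 1%:M).
Hypotheses (JN' : jac T' (tau u) *m G' (T' (tau u)) *m N'^T = 0).
Hypotheses (NN' : N' *m G' (T' (tau u)) *m N'^T = 1%:M).
Hypothesis NE : N = N' *m jac sig (T' (tau u)).

(* Both sides are read off from the Hessian of a function with nonzero normal
   derivative, and Hessians are already known to transform as tensors. *)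
Lemma scalar_form_change : scalar_form T G N u =
  jac tau u *m scalar_form T' G' N' (tau u) *m (jac tau u)^T.
Proof.
pose F := linear_fun N.
have F2 W : open W -> C2_on W F by exact: C2_on_linear_fun.
have U'u := tauU Uu; have V'y := TU' U'u.
have TuE : T u = sig (T' (tau u)) by rewrite TE ?inE.
have Fs2 : C2_on V' (F \o sig) := C2_on_comp oV' oV sigV sig2 (F2 V oV).
have FsT2 : C2_on U' ((F \o sig) \o T') := C2_on_comp oU' oV' TU' T'2 Fs2.
have E1 := hessian_hypersurface oU oV TU T2 G1 Gsym Gunit Hunit HTE Uu JN NN (F2 V oV).
have E2 := hessian_hypersurface oU' oV' TU' T'2 G'1 G'sym G'unit H'unit H'TE U'u JN' NN' Fs2.
have E3 := hessian_change oU oU' tauU tau2 H'1 H'sym H'unit Hunit HE FsT2 Uu.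
have E4 := hessian_change oV' oV sigV sig2 G1 Gsym Gunit G'unit GE (F2 V oV) V'y.
have dF : dif (F \o sig) (T' (tau u)) = N *m (jac sig (T' (tau u)))^T.
  by rewrite (dif_comp oV' oV sigV sig2 (F2 V oV).1 V'y) dif_linear_fun.
rewrite dF E4 -TuE trmx_mul trmxK (mulmxA N') -NE in E2.
rewrite dif_linear_fun in E1.
have E5 : hessian H (F \o T) u = hessian H ((F \o sig) \o T' \o tau) u.
  by apply: (hessian_eq_on _ oU Uu) => v Uv; rewrite /= TE.
have JE : jac T u = jac tau u *m jac T' (tau u) *m jac sig (T' (tau u)).
  rewrite (jac_eq_on oU Uu TE).
  have sT1 k : C1_on U' (fun v => (sig \o T') v 0 k).
    exact: (C1_on_comp oU' oV' TU' (fun k => (T'2 k).1) (sig2 k).1).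
  rewrite (jac_comp oU oU' tauU (fun k => (tau2 k).1) sT1 Uu).
  rewrite (jac_comp oU' oV' TU' (fun k => (T'2 k).1) (fun k => (sig2 k).1) U'u).
  by rewrite mulmxA.
(* The normal derivative of [F] is the Euclidean square of the coordinate vector N, which is nonzero
   as N has unit length for G. *)
have c0 : (N *m N^T) 0 0 != 0.
  apply/negP => /eqP c0; have : N = 0.
    by apply: mx_norm2_eq0; rewrite trace_mx11.
  move=> N0; have := NN; rewrite N0 !mul0mx => /matrixP/(_ 0 0).
  by rewrite !mxE eqxx => /esym/eqP; rewrite oner_eq0.
(* The tangential Hessian terms on both sides agree by [JE]; cancelling them leaves the two second
   forms with the same nonzero factor. *)
apply: (scalerI c0); move: E1; rewrite E5 E3 E2 JE.
rewrite mulmxDr mulmxDl -scalemxAr -scalemxAl !trmx_mul !mulmxA => /addrI <-.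
by [].
Qed.

End Change_of_charts.

Section C2_local.
Context {R : realType} {n : nat}.

Lemma C2_on_eq (U : set 'rV[R]_n) (F G : 'rV[R]_n -> R) :
  open U -> {in U, F =1 G} -> C2_on U F -> C2_on U G.
Proof.
move=> oU FG [F1 F2]; split=> [|i]; first exact: (C1_on_eq oU FG).
apply: (C1_on_eq oU _ (F2 i)) => u /[!inE] Uu; exact: (pd_eq_on i oU Uu).
Qed.

Lemma C2_on_local (U : set 'rV[R]_n) (F : 'rV[R]_n -> R) :
  (forall u, U u -> exists V : set 'rV[R]_n, V u /\ C2_on V F) -> C2_on U F.
Proof.
move=> H; split=> [|i]; apply: C1_on_local => u /H[V [Vu [F1 F2]]]; exists V.
  exact: (conj Vu F1).
exact: (conj Vu (F2 i)).
Qed.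

End C2_local.

Section Matrix_continuity.
Context {R : realType} {T : topologicalType} (x : T).

Lemma for_continuous_eq (U : topologicalType) (f g : T -> U) :
  f =1 g -> {for x, continuous f} -> {for x, continuous g}.
Proof. by move=> /funext ->. Qed.

Definition mcont p q (A : T -> 'M[R]_(p, q)) :=
  forall i j, {for x, continuous (fun y => A y i j)}.

Lemma mcont_mulmx p q r (A : T -> 'M[R]_(p, q)) (B : T -> 'M[R]_(q, r)) :
  mcont A -> mcont B -> mcont (fun y => A y *m B y).
Proof.
move=> Ac Bc i j.
apply: (for_continuous_eq (f := fun y => \sum_k A y i k * B y k j)) => [y|].
  by rewrite mxE.
by apply: for_continuous_sum => k _; exact: for_continuousM.
Qed.

Lemma mcont_tr p q (A : T -> 'M[R]_(p, q)) :
  mcont A -> mcont (fun y => (A y)^T).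
Proof.
by move=> Ac i j; apply: for_continuous_eq (Ac j i) => y; rewrite mxE.
Qed.

End Matrix_continuity.

(** * Geometry of the immersed hypersurface *)

Section Hypersurface_charts.
Context {R : realType} {m : nat} {S : ptopologicalType} {M : topologicalType}.
Context (X : manifold R m.+1 M) (g : metric X).
Context (Y : manifold R m S) (h : metric Y).
Context (iota : S -> M) (hiota : isometric_immersion h g iota).

Lemma open_chart_dom (a : Y) (b : X) : open (dom a `&` iota @^-1` dom b).
Proof.
have [ic _ _] := hiota; apply: openI; first exact: open_dom.
by move/continuousP : ic; apply; exact: open_dom.
Qed.

Lemma open_locdom (a : Y) (b : X) : open (locdom iota a b).
Proof. by apply: open_image_coord => [|p []//]; exact: open_chart_dom. Qed.

Lemma locdom_cod (a : Y) (b : X) u : locdom iota a b u -> cod a u.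
Proof. by move=> [p [ap _] <-]; exact: cod_coord. Qed.

Lemma locmap_coord (a : Y) (b : X) p : dom a p ->
  locmap iota a b (coord a p) = coord b (iota p).
Proof. by move=> ap; rewrite /locmap /= coordK. Qed.

Lemma locmap_cod (a : Y) (b : X) u : locdom iota a b u -> cod b (locmap iota a b u).
Proof. by move=> [p [ap bp] <-]; rewrite locmap_coord//; exact: cod_coord. Qed.

Lemma locmap_C2 (a : Y) (b : X) k :
  C2_on (locdom iota a b) (fun v => locmap iota a b v 0 k).
Proof. by have [_ T2 _] := hiota; apply: smooth_C2; exact: T2. Qed.

Lemma locmap_gram (a : Y) (b : X) u : locdom iota a b u ->
  gram h a u = jac (locmap iota a b) u *m gram g b (locmap iota a b u)
    *m (jac (locmap iota a b) u)^T.
Proof.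
have [_ _ HE] := hiota.
by move=> [p [ap bp] <-]; rewrite (HE a b p ap bp) locmap_coord.
Qed.

Lemma C2_fun_immersion (f : M -> R) : C2_fun X f -> C2_fun Y (f \o iota).
Proof.
move=> f2 a; apply: C2_on_local => u [p ap <-].
pose b := chart_at X (iota p); have bp : dom b (iota p) by exact: chart_atP.
exists (locdom iota a b); split; first by exists p.
have oU : open (locdom iota a b) by exact: open_locdom.
have oV : open (cod b) by exact: open_cod.
apply: (C2_on_eq (F := (f \o param b) \o locmap iota a b) oU).
  move=> v; rewrite inE => -[q [aq bq] <-].
  by rewrite /= locmap_coord// !coordK.
exact: (C2_on_comp oU oV (@locmap_cod a b) (@locmap_C2 a b) (f2 b)).
Qed.

Context (nu : X -> S -> 'rV[R]_m.+1) (hnu : unit_normal (Y := Y) g iota nu).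

Lemma normal_tangent (a : Y) (b : X) p : dom a p -> dom b (iota p) ->
  jac (locmap iota a b) (coord a p) *m gram g b (locmap iota a b (coord a p))
    *m (nu b p)^T = 0.
Proof. by have [_ _ H _] := hnu => ap bp; rewrite locmap_coord// H. Qed.

Lemma normal_unit (a : Y) (b : X) p : dom a p -> dom b (iota p) ->
  nu b p *m gram g b (locmap iota a b (coord a p)) *m (nu b p)^T = 1%:M.
Proof. by have [_ _ _ H] := hnu => ap bp; rewrite locmap_coord// H. Qed.

Lemma second_formE (a : Y) (b : X) p : dom a p ->
  second_form g iota nu a b p =
  scalar_form (locmap iota a b) (gram g b) (nu b p) (coord a p).
Proof.
move=> ap; rewrite /second_form /scalar_form -(locmap_coord b ap).
by [].
Qed.

Lemma second_form_chart (a a' : Y) (b b' : X) p :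
  dom a p -> dom a' p -> dom b (iota p) -> dom b' (iota p) ->
  second_form g iota nu a b p =
  jac (transition a a') (coord a p) *m second_form g iota nu a' b' p
    *m (jac (transition a a') (coord a p))^T.
Proof.
move=> ap a'p bp b'p.
(* The points lying in all four chart domains; over them every map required by [scalar_form_change]
   is defined. *)
pose D := (dom a `&` iota @^-1` dom b) `&` (dom a' `&` iota @^-1` dom b').
have oD : open D by apply: openI; exact: open_chart_dom.
pose U := coord a @` D; pose U' := coord a' @` D.
have oU : open U by apply: open_image_coord => // q [[]].
have oU' : open U' by apply: open_image_coord => // q [_ []].
have oV : open (cod b) by exact: open_cod.
pose V' := overlap b' b.
have oV' : open V' by exact: open_overlap.
have Uu : U (coord a p) by exists p.
have UE u : U u -> locdom iota a b u by move=> [q [[aq bq] _] <-]; exists q.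
have U'E u : U' u -> locdom iota a' b' u by move=> [q [_ [aq bq]] <-]; exists q.
have UO u : U u -> overlap a a' u by move=> [q [[aq bq] [a'q _]] <-]; exists q.
have C2W W W' (F : 'rV[R]_m -> R) : W' `<=` W -> C2_on W F -> C2_on W' F.
  by move=> sub F2; apply: C2_on_local => u /sub Wu; exists W.
have tE q : dom a q -> transition a a' (coord a q) = coord a' q.
  by move=> aq; rewrite /transition /= coordK.
have tauU u : U u -> U' (transition a a' u).
  by move=> [q Dq <-]; rewrite tE; [exists q|case: Dq => -[]].
have TU' u : U' u -> V' (locmap iota a' b' u).
  move=> [q [[aq bq] [a'q b'q]] <-]; rewrite locmap_coord//.
  by exists (iota q).
have sigV y : V' y -> cod b (transition b' b y) by exact: overlap_transition.
have TU u : U u -> cod b (locmap iota a b u) by move=> /UE /locmap_cod.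
have TE : {in U, locmap iota a b =1 transition b' b \o locmap iota a' b' \o transition a a'}.
  move=> u; rewrite inE => -[q [[aq bq] [a'q b'q]] <-].
  by rewrite /= tE// !locmap_coord// /transition /= coordK.
have tau2 k : C2_on U (fun v => transition a a' v 0 k).
  exact: C2W UO (@transition_C2 _ _ _ _ a a' k).
have sig2 k : C2_on V' (fun v => transition b' b v 0 k) by exact: transition_C2.
have T2 k : C2_on U (fun v => locmap iota a b v 0 k).
  exact: C2W UE (@locmap_C2 a b k).
have T'2 k : C2_on U' (fun v => locmap iota a' b' v 0 k).
  exact: C2W U'E (@locmap_C2 a' b' k).
have V'c y : V' y -> cod b' y by move=> [q [b'q _] <-]; exact: cod_coord.
have Ua u : U u -> cod a u by move=> /UE /locdom_cod.
have U'a u : U' u -> cod a' u by move=> /U'E /locdom_cod.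
have G1 : mC1 (cod b) (gram g b) by exact: gram_mC1.
have G'1 : mC1 V' (gram g b').
  by move=> i j; apply: C1_onW V'c _; exact: gram_mC1.
have H'1 : mC1 U' (gram h a').
  by move=> i j; apply: C1_onW U'a _; exact: gram_mC1.
have Gsym y : cod b y -> (gram g b y)^T = gram g b y by exact: gram_sym.
have G'sym y : V' y -> (gram g b' y)^T = gram g b' y by move=> /V'c; exact: gram_sym.
have H'sym y : U' y -> (gram h a' y)^T = gram h a' y by move=> /U'a; exact: gram_sym.
have Gu y : cod b y -> gram g b y \in unitmx by exact: gram_unit.
have G'u y : V' y -> gram g b' y \in unitmx by move=> /V'c; exact: gram_unit.
have Hu u : U u -> gram h a u \in unitmx by move=> /Ua; exact: gram_unit.
have H'u u : U' u -> gram h a' u \in unitmx by move=> /U'a; exact: gram_unit.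
have GE y : V' y -> gram g b' y = jac (transition b' b) y *m
    gram g b (transition b' b y) *m (jac (transition b' b) y)^T.
  exact: gram_transition.
have HE u : U u -> gram h a u = jac (transition a a') u *m
    gram h a' (transition a a' u) *m (jac (transition a a') u)^T.
  by move=> /UO; exact: gram_transition.
have HTE u : U u -> gram h a u = jac (locmap iota a b) u *m
    gram g b (locmap iota a b u) *m (jac (locmap iota a b) u)^T.
  by move=> /UE; exact: locmap_gram.
have H'TE u : U' u -> gram h a' u = jac (locmap iota a' b') u *m
    gram g b' (locmap iota a' b' u) *m (jac (locmap iota a' b') u)^T.
  by move=> /U'E; exact: locmap_gram.
have JN := normal_tangent ap bp; have NN := normal_unit ap bp.
have JN' := normal_tangent a'p b'p; have NN' := normal_unit a'p b'p.
rewrite -(tE p ap) in JN' NN'.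
have NE : nu b p = nu b' p *m
    jac (transition b' b) (locmap iota a' b' (transition a a' (coord a p))).
  have [_ H _ _] := hnu; rewrite (H b' b p b'p bp) tE// locmap_coord//.
rewrite !second_formE// -(tE p ap).
exact: (scalar_form_change oU oU' oV oV' tauU TU' sigV TU TE tau2 sig2 T2 T'2
  G1 G'1 H'1 Gsym G'sym H'sym Gu G'u Hu H'u GE HE HTE H'TE Uu JN NN JN' NN' NE).
Qed.

Definition form_norm2 (a : Y) (b : X) p : R :=
  \tr (invmx (gram h a (coord a p)) *m second_form g iota nu a b p
       *m invmx (gram h a (coord a p)) *m (second_form g iota nu a b p)^T).

(** The Jacobians produced by [second_form_chart] are absorbed by those of the inverse metric, up to
    cyclicity of the trace. *)
Lemma second_form_norm2_chart (a : Y) (b : X) p : dom a p -> dom b (iota p) ->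
  second_form_norm2 h g iota nu p = form_norm2 a b p.
Proof.
move=> ap bp; have a0p := chart_atP Y p; have b0p := chart_atP X (iota p).
rewrite /second_form_norm2 /form_norm2.
move: (chart_at Y p) (chart_at X _) a0p b0p => a' b' a'p b'p.
have Hu : gram h a' (coord a' p) \in unitmx by apply: gram_unit; exact: cod_coord.
rewrite (second_form_chart a'p ap b'p bp).
move: Hu; rewrite (gram_change h a'p ap).
set J := jac _ _; set H := gram h a _; set A := second_form _ _ _ a _ _ => Hu.
have [_ _ ->] := invmx_congruence Hu; set K := invmx (J *m _ *m _).
rewrite !trmx_mul trmxK -!mulmxA [LHS]mxtrace_mulC.
rewrite [in RHS]mxtrace_mulC -!mulmxA [RHS]mxtrace_mulC -!mulmxA.
by [].
Qed.

(** The charts in the definition may change near p; [second_form_norm2_chart] freezes them at the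
    pair chosen for p, where the coordinate expression is continuous. *)
Lemma continuous_second_form_norm2 : continuous (second_form_norm2 h g iota nu).
Proof.
move=> p; pose a := chart_at Y p; pose b := chart_at X (iota p).
have ap : dom a p by exact: chart_atP.
have bp : dom b (iota p) by exact: chart_atP.
have oU : open (locdom iota a b) by exact: open_locdom.
have oV : open (cod b) by exact: open_cod.
have Up : locdom iota a b (coord a p) by exists p.
pose T := locmap iota a b; pose nu' := nu b \o param a.
pose A v := \matrix_(i, j) (acceleration T (gram g b) v i j *m gram g b (T v) *m (nu' v)^T) 0 0.
pose Q v := \tr (invmx (gram h a v) *m A v *m invmx (gram h a v) *m (A v)^T).
have QE : \near p, (Q \o coord a) p = second_form_norm2 h g iota nu p.
  have np : nbhs p (dom a `&` iota @^-1` dom b).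
    by apply: open_nbhs_nbhs; split => //; exact: open_chart_dom.
  apply: filterS np => q [aq bq]; rewrite (second_form_norm2_chart aq bq).
  by rewrite /form_norm2 second_formE// /scalar_form /Q /A /nu' /= coordK.
apply: (for_continuous_near QE).
apply: continuous_comp; first exact: coord_continuous.
have T1 k : C1_on (locdom iota a b) (fun v => T v 0 k).
  exact: (@locmap_C2 a b k).1.
have TV u : locdom iota a b u -> cod b (T u) by exact: locmap_cod.
have G1 : mC1 (cod b) (gram g b) by exact: gram_mC1.
have Gu y : cod b y -> gram g b y \in unitmx by exact: gram_unit.
have Gc : mcont (coord a p) (fun v => gram g b (T v)).
  move=> i j; apply: (for_continuous_comp_T oU T1 (F := fun y => gram g b y i j) Up).
  exact: C1_on_continuous (G1 i j) (TV _ Up).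
have Hc : mcont (coord a p) (fun v => invmx (gram h a v)).
  move=> i j; have oa : open (cod a) by exact: open_cod.
  apply: (C1_on_continuous (mC1_invmx oa (@gram_mC1 _ _ _ _ h a) _ i j)).
    by move=> v; exact: gram_unit.
  exact: cod_coord.
have nc : mcont (coord a p) nu'.
  move=> i k; rewrite ord1; have [ns _ _ _] := hnu.
  exact: C1_on_continuous (ns a b k [::]) Up.
have Ac : mcont (coord a p) A.
  move=> i j; pose Acc v := acceleration T (gram g b) v i j.
  apply: (for_continuous_eq
    (f := fun v => (Acc v *m gram g b (T v) *m (nu' v)^T) 0 0)) => [v|].
    by rewrite [RHS]mxE.
  apply: mcont_mulmx; last exact: mcont_tr.
  apply: mcont_mulmx Gc => i0 k; rewrite ord1.
  apply: (for_continuous_eq (f := fun v => pd i (pd j (fun v => T v 0 k)) v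
    + \sum_r \sum_s christoffel (gram g b) (T v) k r s
        * pd i (fun v => T v 0 r) v * pd j (fun v => T v 0 s) v)) => [v|].
    by rewrite [RHS]mxE.
  apply: for_continuousD.
    exact: C1_on_pd_continuous ((@locmap_C2 a b k).2 j) Up.
  apply: for_continuous_sum => r _; apply: for_continuous_sum => s _.
  apply: for_continuousM; last exact: C1_on_pd_continuous (T1 s) Up.
  apply: for_continuousM; last exact: C1_on_pd_continuous (T1 r) Up.
  apply: (for_continuous_comp_T oU T1 (F := fun y => christoffel (gram g b) y k r s) Up).
  have Cc := for_continuous_christoffel oV (TV _ Up) G1 Gu.
  exact: (Cc k r s).
apply: for_continuous_sum => i _.
by apply: mcont_mulmx; [do 2?apply: mcont_mulmx|exact: mcont_tr].
Qed.

Lemma second_form_norm2_ge0 p : 0 <= second_form_norm2 h g iota nu p.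
Proof.
have ap := chart_atP Y p; have cp := cod_coord ap.
have Hpos v := @gram_posdef _ _ _ _ h _ _ v cp.
exact: (form_norm2_ge0 (gram_sym h cp) Hpos _).1.
Qed.

Lemma second_form_norm2_eq0 (a : Y) (b : X) p : dom a p -> dom b (iota p) ->
  second_form_norm2 h g iota nu p = 0 -> second_form g iota nu a b p = 0.
Proof.
move=> ap bp; rewrite (second_form_norm2_chart ap bp) => /esym/eqP.
have cp := cod_coord ap; have Hpos v := @gram_posdef _ _ _ _ h _ _ v cp.
by rewrite (form_norm2_ge0 (gram_sym h cp) Hpos _).2 => /eqP.
Qed.

Lemma graddot_at_ge0 (F : S -> R) p : 0 <= graddot_at h F F p.
Proof.
have ap := chart_atP Y p; have cp := cod_coord ap.
have Hpos v := @gram_posdef _ _ _ _ h _ _ v cp.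
exact: (covector_norm2_ge0 (gram_sym h cp) Hpos).
Qed.

Lemma stability_integrand (f psi : M -> R) p : (0 < m)%N ->
  electrostatic g f psi -> minimal h g iota nu -> f (iota p) != 0 ->
  (second_form_norm2 h g iota nu p + ricci_normal g iota nu p) * f (iota p) ^+ 2 =
  second_form_norm2 h g iota nu p * f (iota p) ^+ 2
    + 2 * graddot_at h (psi \o iota) (psi \o iota) p
    - f (iota p) * laplacian_at h (f \o iota) p.
Proof.
move=> m0 [fs psis eqs] Hmin fp.
rewrite mulrDl -addrA; congr (_ + _).
rewrite /ricci_normal /graddot_at /laplacian_at.
have ap := chart_atP Y p; have bp := chart_atP X (iota p).
move: (chart_at Y p) (chart_at X _) ap bp => a b ap bp.
have oU : open (locdom iota a b) by exact: open_locdom.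
have oV : open (cod b) by exact: open_cod.
have Up : locdom iota a b (coord a p) by exists p.
have Hu u : locdom iota a b u -> gram h a u \in unitmx.
  by move=> /locdom_cod; exact: gram_unit.
have funE (F : M -> R) : {in locdom iota a b,
    (F \o iota) \o param a =1 (F \o param b) \o locmap iota a b}.
  by move=> v; rewrite inE => -[q [aq bq] <-]; rewrite /= locmap_coord// !coordK.
have [] := eqs b (locmap iota a b (coord a p)) (locmap_cod Up).
  by rewrite /= locmap_coord// coordK.
move=> ric lap _.
have f2 : C2_fun X f by exact: smooth_C2_fun.
have psi2 : C2_fun X psi by exact: smooth_C2_fun.
have := ricci_normal_hypersurface oU oV (@locmap_cod a b) (@locmap_C2 a b)
  (@gram_mC1 _ _ _ _ g b) (@gram_sym _ _ _ _ g b) (@gram_unit _ _ _ _ g b) Hu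
  (@locmap_gram a b) Up (normal_tangent ap bp) (normal_unit ap bp) m0
  (f2 b) (psi2 b).1 _ ric lap.
rewrite -second_formE// (Hmin a b p ap bp) /= locmap_coord// coordK// => /(_ fp erefl) ->.
rewrite (laplacian_eq_on _ oU Up (funE f)).
by rewrite (graddot_eq_on _ oU Up (funE psi) (funE psi)).
Qed.

End Hypersurface_charts.

Theorem proposition1
  (R : realType) (n : nat) (hn : (3 <= n)%N)
  (M : topologicalType) (X : manifold R n M) (g : metric X)
  (Mconn : connected [set: M]) (Morient : oriented X)
  (f psi : M -> R) (Mstatic : electrostatic g f psi)
  (S : ptopologicalType) (Y : manifold R n.-1 S) (h : metric Y)
  (sigma : {measure set (borel S) -> \bar R}) (hsigma : is_volume h sigma)
  (Scompact : compact [set: S]) (Sconn : connected [set: S])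
  (iota : S -> M) (hiota : isometric_immersion h g iota)
  (nu : X -> S -> 'rV[R]_n) (hnu : unit_normal (Y := Y) g iota nu)
  (Smin : minimal h g iota nu) (Sstable : stable h g iota nu sigma)
  (fpos : forall p : S, 0 < f (iota p)) :
  totally_geodesic (Y := Y) g iota nu.
Proof.
(* With n = m + 1 the dimension [n.-1] of the hypersurface becomes m by computation, as the local
   results require. *)
case: n hn X g Mconn Morient Mstatic Y h hsigma iota hiota nu hnu Smin Sstable fpos
  => [//|m] hm X g _ _ Mstatic Y h hsigma iota hiota nu hnu Smin Sstable fpos.
have m0 : (0 < m)%N by case: m hm {X g Mstatic Y h hsigma hiota nu hnu Smin Sstable}.
move=> a b p ap bp; apply: (second_form_norm2_eq0 hiota hnu ap bp).
pose w q := second_form_norm2 h g iota nu q * f (iota q) ^+ 2.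
suff : w p = 0.
  by move/eqP; rewrite mulf_eq0 sqrf_eq0 (gt_eqF (fpos p)) orbF => /eqP.
have [fs psis _] := Mstatic.
pose phi := f \o iota; pose Psi := psi \o iota.
have phi2 : C2_fun Y phi := C2_fun_immersion hiota (smooth_C2_fun fs).
have phi1 := C2_C1_fun phi2; have phic := C1_fun_continuous phi1.
have wc : continuous w.
  move=> q; apply: for_continuousM; first exact: (continuous_second_form_norm2 hiota hnu).
  by apply: for_continuousM; exact: phic.
have w0 q : 0 <= w q.
  by rewrite mulr_ge0 ?sqr_ge0//; exact: second_form_norm2_ge0.
(* If w were positive at p, continuity would keep it above half of that value on an open set [O],
   whose volume is positive. *)
apply/eqP; rewrite eq_le w0 andbT leNgt; apply/negP => wp.
pose d := w p / 2; have d0 : 0 < d by rewrite divr_gt0.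
pose O : set S := w @^-1` [set t | d < t].
have oO : open O by move/continuousP : wc; apply; exact: open_gt.
have Op : O p by rewrite /O /= /d; lra.
have mO : measurable (O : set (borel S)) by exact: open_borel.
have Ofin : (sigma O < +oo)%E.
  apply: le_lt_trans (volume_finite hsigma Scompact).
  by apply: le_measure; rewrite ?inE.
pose k q := - (phi q * laplacian_at h phi q).
have kc : continuous k.
  move=> q; apply: (for_continuousN (f := fun r => phi r * laplacian_at h phi r)).
  apply: for_continuousM; first exact: phic.
  exact: continuous_laplacian_at.
have ki := integrable_continuous hsigma Scompact kc.
have gi := integrable_continuous hsigma Scompact (continuous_green_density phi1 phi2).
have Ofin' : sigma O \is a fin_num by rewrite ge0_fin_numE.
have Oi : sigma.-integrable setT (fun q => d%:E * (\1_O q)%:E)%E.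
  by apply: integrableZl => //; exact: integrable_indic_fin.
(* The squared gradient is the Green density plus [k], and the Green density integrates to zero. *)
have grad_int : (\int[sigma]_q (gradnorm2_at h phi q)%:E = \int[sigma]_q (k q)%:E)%E.
  transitivity (\int[sigma]_q ((green_density h phi phi q)%:E + (k q)%:E))%E.
    by apply: eq_integral => q _; rewrite -EFinD addrK.
  by rewrite integralD//= (integral_green hsigma Scompact phi2) add0e.
(* The stability integrand is w + 2 |grad Psi|^2 + k with w >= d 1_O. The minorant k + d 1_O is
   integrable by construction, and the pointwise comparison is enough for [le_integral_nonmeas]. *)
have lower q : ((k q)%:E + d%:E * (\1_O q)%:E <=
    ((second_form_norm2 h g iota nu q + ricci_normal g iota nu q) * phi q ^+ 2)%:E)%E.
  rewrite -EFinM -EFinD lee_fin.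
  rewrite (stability_integrand hiota hnu m0 Mstatic Smin (lt0r_neq0 (fpos q))).
  have dw : d * \1_O q <= w q.
    rewrite indicE; have [/[!inE] Oq|_] := boolP (q \in O).
      by rewrite mulr1; exact: ltW.
    by rewrite mulr0.
  have grad0 := graddot_at_ge0 h Psi q; rewrite -/(w q) -/phi -/Psi -/(phi q).
  by rewrite addrC lerD2r (le_trans dw)// lerDl mulr_ge0.
have := le_trans (le_integral_nonmeas sigma lower) (Sstable phi phi1).
rewrite grad_int integralD//= integralZl//; last exact: integrable_indic_fin.
rewrite integral_indic// setIT.
have Kfin : (\int[sigma]_q (k q)%:E)%E \is a fin_num by exact: integrable_fin_num.
(* Cancelling the finite integral of [k] leaves d sigma(O) <= 0, which contradicts the positive
   volume of [O]. *)
rewrite -(fineK Kfin) -(fineK Ofin') -EFinM -EFinD lee_fin gerDl.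
apply/negP; rewrite -ltNge mulr_gt0// fine_gt0// Ofin andbT.
exact: (volume_open_gt0 hsigma oO Op).
Qed.
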